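(* Let $\mathcal A,\mathcal B$ be approximately unital operator algebras, let $E$ be a right $\mathcal B$-rigged module and let $F$ be a right $\mathcal A$-rigged module such that $E\sim_{\sigma M}F$. Then $E\sim_{\sigma\Delta}F$.
   Context: Approximately unital means having a contractive approximate identity. $\mathbb B(H,K)$ is the space of bounded operators $H\to K$; $\overline{[Z\,X]}$, $\overline{[Z\,W\,X]}$ denote norm closures of linear spans of products. Rigged modules (in the sense of Blecher): for $\mathcal A$ approximately unital, a right $\mathcal A$-operator module $Y$ is a right $\mathcal A$-rigged module if there are a net $(n(b))_{b\in B}$ of positive integers and right $\mathcal A$-module maps $\Phi_b:Y\to C_{n(b)}(\mathcal A)$, $\Psi_b:C_{n(b)}(\mathcal A)\to Y$, $b\in B$, such that: (i) the maps $\Phi_b,\Psi_b$ are completely contractive; (ii) $\Psi_b\circ\Phi_b\to Id_Y$ strongly on $Y$; (iii) the maps $\Psi_b$ are right $\mathcal A$-essential maps (that is, $\Psi_b\,e_i\to\Psi_b$ for a bounded approximate identity $(e_i)_{i\in I}$ of $\mathcal A$); (iv) $\Phi_c\circ\Psi_b\circ\Phi_b\to\Phi_c$ for all $c\in B$ (uniformly in norm). Here $C_n(\mathcal A)$ is the space of columns of length $n$ over $\mathcal A$. With $E_b=\Psi_b\circ\Phi_b$, put $\tilde Y=\{f\in CB_{\mathcal A}(Y,\mathcal A): f\circ E_b\to f\text{ uniformly}\}$, where $CB_{\mathcal A}$ denotes completely bounded right $\mathcal A$-module maps; $\tilde Y$ is independent of the particular directed set and nets $\{\Phi_b,\Psi_b\}$.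 A linear subspace $M\subseteq\mathbb B(H,K)$ is a TRO if $MM^\star M\subseteq M$. A norm closed TRO $M$ is a $\sigma$-TRO if there are sequences $(m_i),(n_j)$ in $M$ with $\lim_n\sum_{i=1}^n m_im_i^\star m=m$ and $\lim_t\sum_{j=1}^t m\,n_j^\star n_j=m$ for all $m\in M$, and $\|\sum_{i=1}^n m_im_i^\star\|\le1$, $\|\sum_{j=1}^t n_j^\star n_j\|\le1$ for all $n,t$. A right $\mathcal A$-module $Y$ (an operator space) is a doubly $\sigma\Delta$-$\mathcal A$-rigged module if there are a completely isometric homomorphism $a:\mathcal A\to a(\mathcal A)\subseteq\mathbb B(H)$, a $\sigma$-TRO $M\subseteq\mathbb B(H,K)$ with $M^\star M\,a(\mathcal A)\subseteq a(\mathcal A)$ and $\overline{[M^\star M\,a(\mathcal A)]}=\overline{[a(\mathcal A)\,M^\star M]}$, and a surjective completely isometric right $\mathcal A$-module map $Y\to\overline{[M\,a(\mathcal A)]}$. Such $Y$ is a right $\mathcal A$-rigged module. $\sigma$-Morita equivalence: $E\sim_{\sigma M}F$ if there is a doubly $\sigma\Delta$-$\mathcal A$-rigged module $Y$ such that $\mathcal A\cong\tilde Y\otimes^h_{\mathcal B}Y$, $\mathcal B\cong Y\otimes^h_{\mathcal A}\tilde Y$ and $F\cong E\otimes^h_{\mathcal B}Y$ (the tensor products presuppose that $Y$ is a $\mathcal B$-$\mathcal A$-bimodule and $\tilde Y$ an $\mathcal A$-$\mathcal B$-bimodule). Here $\otimes^h_{\mathcal B}$ is the balanced Haagerup tensor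 product over $\mathcal B$ and $\cong$ is completely isometric isomorphism. $\sigma\Delta$ equivalence of operator spaces: $X\sim_{\sigma\Delta}W$ if there are completely isometric maps $\phi:X\to\mathbb B(H,K)$, $\psi:W\to\mathbb B(L,R)$ and $\sigma$-TROs $M_1\subseteq\mathbb B(H,L)$, $M_2\subseteq\mathbb B(K,R)$ with $\phi(X)=\overline{[M_2^\star\psi(W)M_1]}$ and $\psi(W)=\overline{[M_2\phi(X)M_1^\star]}$; equivalently, $X$ and $W$ are stably isomorphic, i.e. their spatial tensor products with the compact operators on an infinite dimensional Hilbert space are completely isometrically isomorphic. *)

(* Defs.v *)
From HB Require Import structures.
From mathcomp Require Import all_boot all_order all_algebra.
From mathcomp Require Import all_classical all_reals all_analysis.
From mathcomp Require Import complex.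
Set Implicit Arguments.
Unset Strict Implicit.
Unset Printing Implicit Defensive.
Import Order.TTheory GRing.Theory Num.Theory.
Import numFieldNormedType.Exports.
Local Open Scope classical_set_scope.
Local Open Scope complex_scope.
Local Open Scope ring_scope.

(* The norm of a normed module over [R[i]] takes its values in the nonnegative
   reals inside [R[i]]; [rnorm] is the same number seen in [R]. *)
Definition rnorm (R : realType) (V : normedModType R[i]) (x : V) : R :=
  complex.Re `|x|.

Record directed := Directed {
  dcar :> Type;
  dle : dcar -> dcar -> Prop;
  dinh : inhabited dcar;
  drefl : forall i, dle i i;
  dtrans : forall i j k, dle i j -> dle j k -> dle i k;
  ddir : forall i j, exists k, dle i k /\ dle j k }.

Definition tails (D : directed) : set_system D :=
  [set S | exists i0, forall i, dle i0 i -> S i].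
Arguments tails : clear implicits.

(* [T i] tends to [T0] uniformly on bounded sets along [F]: for linear maps,
   convergence in operator norm. *)
Definition unif_cvg (R : realType) (X : Type) (Z : zmodType)
    (nX : X -> R) (nZ : Z -> R) (I : Type) (F : set_system I)
    (T : I -> X -> Z) (T0 : X -> Z) : Prop :=
  forall e : R, 0 < e ->
    \forall i \near F, forall x, nZ (T i x - T0 x) <= e * nX x.

(* A [dot] form is linear in its first variable. *)
Record hilbert (R : realType) := Hilbert {
  hcar :> completeNormedModType R[i];
  dot : {dot hcar for (@Num.conj R[i])};
  dot_norm : forall x : hcar, `|x| ^+ 2 = dot x x }.

Section Operators.
Context {R : realType}.

Definition bounded_op (H K : hilbert R) : set (H -> K) :=
  [set T | linear T /\ exists c : R, forall x, rnorm (T x) <= c * rnorm x].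

(* The value [0] is only used for operators with no adjoint, hence never for
   elements of [bounded_op H K]. *)
Definition adj (H K : hilbert R) (T : H -> K) : K -> H :=
  xget 0 [set S | forall x y, dot K (T x) y = dot H x (S y)].

Definition adjs (H K : hilbert R) (M : set (H -> K)) : set (K -> H) :=
  @adj H K @` M.

Definition prods (H K L : hilbert R) (M : set (K -> L)) (N : set (H -> K)) :
  set (H -> L) := [set S \o T | S in M & T in N].

Definition lspan (H K : hilbert R) (M : set (H -> K)) : set (H -> K) :=
  [set T | exists n (c : 'I_n -> R[i]) (S : 'I_n -> H -> K),
     (forall i, M (S i)) /\ T = \sum_(i < n) c i *: S i].

Definition norm_closure (H K : hilbert R) (M : set (H -> K)) : set (H -> K) :=
  [set T | forall e : R, 0 < e ->
     exists2 S, M S & forall x, rnorm (T x - S x) <= e * rnorm x].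

Definition clspan (H K : hilbert R) (M : set (H -> K)) : set (H -> K) :=
  norm_closure (lspan M).

Record is_TRO (H K : hilbert R) (M : set (H -> K)) : Prop := {
  tro_bounded : M `<=` @bounded_op H K;
  tro0 : M 0;
  tro_lin : forall (c : R[i]) S T, M S -> M T -> M (c *: S + T);
  tro_mul : prods (prods M (adjs M)) M `<=` M }.

Record is_sigmaTRO (H K : hilbert R) (M : set (H -> K)) : Prop := {
  stro_tro : is_TRO M;
  stro_closed : norm_closure M `<=` M;
  stro_left : exists m : nat -> H -> K,
    [/\ forall i, M (m i),
        forall T, M T -> unif_cvg (@rnorm R H) (@rnorm R K) \oo
          (fun n => (\sum_(i < n) (m i \o adj (m i))) \o T) T
      & forall n x, rnorm ((\sum_(i < n) (m i \o adj (m i))) x) <= rnorm x];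
  stro_right : exists m : nat -> H -> K,
    [/\ forall i, M (m i),
        forall T, M T -> unif_cvg (@rnorm R H) (@rnorm R K) \oo
          (fun n => T \o (\sum_(i < n) (adj (m i) \o m i))) T
      & forall n x, rnorm ((\sum_(i < n) (adj (m i) \o m i)) x) <= rnorm x] }.

Definition mxnorm (V : Type) := forall m n, 'M[V]_(m, n) -> R.

Definition vnorm (V : Type) (nV : mxnorm V) (x : V) : R :=
  nV 1%N 1%N (const_mx x).

Definition cb_by (X Y : Type) (nX : mxnorm X) (nY : mxnorm Y)
    (f : X -> Y) (c : R) : Prop :=
  forall m n (x : 'M[X]_(m, n)), nY m n (map_mx f x) <= c * nX m n x.

Definition cbounded (X Y : Type) (nX : mxnorm X) (nY : mxnorm Y)
  (f : X -> Y) : Prop := exists c : R, cb_by nX nY f c.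

Definition ccontr (X Y : Type) (nX : mxnorm X) (nY : mxnorm Y)
  (f : X -> Y) : Prop := cb_by nX nY f 1.

Definition cisom (X Y : Type) (nX : mxnorm X) (nY : mxnorm Y)
    (f : X -> Y) : Prop :=
  forall m n (x : 'M[X]_(m, n)), nY m n (map_mx f x) = nX m n x.

(* Norm of [T] as an operator from the n-fold to the m-fold Hilbert sum. *)
Definition op_mxnorm (H K : hilbert R) : mxnorm (H -> K) :=
  fun m n T =>
    sup [set Num.sqrt (\sum_(i < m) rnorm (\sum_(j < n) T i j (xi j)) ^+ 2)
        | xi in [set xi : 'I_n -> H | \sum_(j < n) rnorm (xi j) ^+ 2 <= 1]].

Definition is_repr (X : lmodType R[i]) (nX : mxnorm X) (H K : hilbert R)
    (u : {linear X -> (H -> K)}) : Prop :=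
  range u `<=` @bounded_op H K /\ cisom nX (@op_mxnorm H K) u.

(* Product of a matrix over [X] and a matrix over [Y] along [t]. *)
Definition mxmul (X Y : Type) (Z : zmodType) (t : X -> Y -> Z) m n p
    (x : 'M[X]_(m, n)) (y : 'M[Y]_(n, p)) : 'M[Z]_(m, p) :=
  \matrix_(i, j) \sum_(k < n) t (x i k) (y k j).

End Operators.

(* [mnorm_repr] also forces the axioms of a matrix norm; likewise [oa_repr] and
   [is_repr] make the product of an operator algebra completely contractive. *)
Record opSpace (R : realType) := OpSpace {
  oscar :> completeNormedModType R[i];
  mnorm : @mxnorm R oscar;
  mnorm1 : forall x : oscar, vnorm mnorm x = rnorm x;
  mnorm_repr : exists (H K : hilbert R) (u : {linear oscar -> (H -> K)}),
    is_repr mnorm u }.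
Arguments mnorm {R} _ {m n} _.
Notation osnorm X := (fun m n => @mnorm _ X m n).

Record opAlg (R : realType) := OpAlg {
  oacar :> opSpace R;
  amul : {bilinear oacar -> oacar -> oacar};
  amulA : associative amul;
  oa_repr : exists (H : hilbert R) (u : {linear oacar -> (H -> H)}),
    is_repr (osnorm oacar) u /\ forall a b, u (amul a b) = u a \o u b }.
Arguments amul {R _}.

Record rmod (R : realType) (A : opAlg R) := RMod {
  rmcar :> opSpace R;
  ract : {bilinear rmcar -> A -> rmcar};
  ractA : forall y a b, ract (ract y a) b = ract y (amul a b);
  ract_contr : forall m n p (y : 'M[rmcar]_(m, n)) (a : 'M[A]_(n, p)),
    mnorm rmcar (mxmul ract y a) <= mnorm rmcar y * mnorm A a }.
Arguments ract {R A _}.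

Section Rigged.
Context {R : realType}.

Definition is_bai (A : opAlg R) (D : directed) (e : D -> A) (c : R) : Prop :=
  [/\ forall i, rnorm (e i) <= c,
      forall a, (fun i => amul (e i) a) @ tails D --> a
    & forall a, (fun i => amul a (e i)) @ tails D --> a].

Definition approx_unital (A : opAlg R) : Prop :=
  exists (D : directed) (e : D -> A), is_bai e 1.

(* [C_n(A)] is ['I_n -> A]; a matrix over it is a matrix over [A] with [n] times
   as many rows. *)
Definition col_mxnorm (A : opAlg R) n : @mxnorm R ('I_n -> A) :=
  fun k l x => mnorm A (\mxcol_(i < k) (\matrix_(r < n, j < l) x i j r)).
Arguments col_mxnorm : clear implicits.

(* [Psi e_i] is the map [x |-> Psi (e_i x)]; the convergence is in norm
   (pointwise convergence would hold for every bounded module map). *)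
Definition essential (A : opAlg R) (Y : rmod A) n (Psi : ('I_n -> A) -> Y) :
    Prop :=
  exists (D : directed) (e : D -> A) (c : R), is_bai e c /\
    unif_cvg (vnorm (col_mxnorm A n)) (@rnorm R Y) (tails D)
      (fun i x => Psi (fun k => amul (e i) (x k))) Psi.

Record rigging (A : opAlg R) (Y : rmod A) := Rigging {
  rdir : directed;
  rn : rdir -> nat;
  rPhi : forall b, {linear Y -> ('I_(rn b) -> A)};
  rPsi : forall b, {linear ('I_(rn b) -> A) -> Y};
  rn_gt0 : forall b, (0 < rn b)%N;
  rPhi_mod : forall b y a k, rPhi b (ract y a) k = amul (rPhi b y k) a;
  rPsi_mod : forall b x a,
    rPsi b (fun k => amul (x k) a) = ract (rPsi b x) a;
  rPhi_contr : forall b, ccontr (osnorm Y) (col_mxnorm A (rn b)) (rPhi b);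
  rPsi_contr : forall b, ccontr (col_mxnorm A (rn b)) (osnorm Y) (rPsi b);
  r_cvg : forall y, (fun b => rPsi b (rPhi b y)) @ tails rdir --> y;
  r_ess : forall b, essential (rPsi b);
  r_unif : forall c,
    unif_cvg (@rnorm R Y) (vnorm (col_mxnorm A (rn c))) (tails rdir)
      (fun b => rPhi c \o rPsi b \o rPhi b) (rPhi c) }.

Arguments rPhi {A Y} r b.
Arguments rPsi {A Y} r b.

Definition rigged (A : opAlg R) (Y : rmod A) : Prop := inhabited (rigging Y).

Definition tilde_set (A : opAlg R) (Y : rmod A) (r : rigging Y) :
    set (Y -> A) :=
  [set f | [/\ linear f,
    forall y a, f (ract y a) = amul (f y) a,
    cbounded (osnorm Y) (osnorm A) f
  & unif_cvg (@rnorm R Y) (@rnorm R A) (tails (rdir r))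
      (fun b => f \o rPsi r b \o rPhi r b) f]].

(* Matrix norms of [CB(Y, A)]: an m x n matrix of maps has the cb norm of the
   corresponding map from [Y] to the m x n matrices over [A]. *)
Definition cb_mxnorm (A : opAlg R) (Y : rmod A) : @mxnorm R (Y -> A) :=
  fun m n F => inf [set c : R | 0 <= c /\
    forall p q (y : 'M[Y]_(p, q)),
      mnorm A (\mxblock_(k < p, l < q) (\matrix_(i < m, j < n) F i j (y k l)))
        <= c * mnorm Y y].

(* A copy of the operator space of maps [tilde_set r]: [tev f] is the map that
   the element [f] stands for. *)
Record tilde (A : opAlg R) (Y : rmod A) (r : rigging Y) := Tilde {
  tcar :> opSpace R;
  tev : {linear tcar -> (Y -> A)};
  tev_isom : cisom (osnorm tcar) (@cb_mxnorm A Y) tev;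
  tev_range : range tev = tilde_set r }.
Arguments tev {A Y r _}.

Definition balanced (X Y B : Type) (V : Type) (rB : X -> B -> X)
    (lB : B -> Y -> Y) (t : X -> Y -> V) : Prop :=
  forall x b y, t (rB x b) y = t x (lB b y).

(* The matrices over the algebraic balanced tensor product
   of [X] and [Y] with entries [\sum_k x_ik (x) y_kj] and
   [\sum_k x'_ik (x) y'_kj] are equal, that is, every balanced bilinear map
   identifies them. *)
Definition bal_tens_eq (X Y : lmodType R[i]) (B : Type) (rB : X -> B -> X)
    (lB : B -> Y -> Y) m n p q
    (x : 'M[X]_(m, p)) (y : 'M[Y]_(p, n))
    (x' : 'M[X]_(m, q)) (y' : 'M[Y]_(q, n)) : Prop :=
  forall (V : lmodType R[i]) (t : {bilinear X -> Y -> V}),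
    balanced rB lB t -> mxmul t x y = mxmul t x' y'.

(* The Haagerup matrix seminorm on the algebraic balanced tensor product, i.e.
   the quotient of the Haagerup norm by the span of the
   [x b (x) y - x (x) b y]. *)
Definition haagerup_norm (X Y : opSpace R) (B : Type) (rB : X -> B -> X)
    (lB : B -> Y -> Y) m n p (x : 'M[X]_(m, p)) (y : 'M[Y]_(p, n)) : R :=
  inf [set c : R | exists q (x' : 'M[X]_(m, q)) (y' : 'M[Y]_(q, n)),
         bal_tens_eq rB lB x y x' y' /\ c = mnorm X x' * mnorm Y y'].

(* [Z], with [t] as the canonical map, is the completion of the algebraic
   balanced tensor product of [X] and [Y] for the Haagerup matrix seminorms. *)
Record is_haagerup (X Y Z : opSpace R) (B : Type) (rB : X -> B -> X)
    (lB : B -> Y -> Y) (t : {bilinear X -> Y -> Z}) : Prop := {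
  haag_balanced : balanced rB lB t;
  haag_norm : forall m n p (x : 'M[X]_(m, p)) (y : 'M[Y]_(p, n)),
    mnorm Z (mxmul t x y) = haagerup_norm rB lB x y;
  haag_dense : dense [set z : Z | exists n (x : 'I_n -> X) (y : 'I_n -> Y),
    z = \sum_(k < n) t (x k) (y k)] }.

Definition doubly_sigmaDelta (A : opAlg R) (Y : rmod A) : Prop :=
  exists (H K : hilbert R) (a : {linear A -> (H -> H)}) (M : set (H -> K))
         (u : {linear Y -> (H -> K)}),
    [/\ is_repr (osnorm A) a /\ (forall x y, a (amul x y) = a x \o a y),
        is_sigmaTRO M,
        prods (prods (adjs M) M) (range a) `<=` range a,
        clspan (prods (prods (adjs M) M) (range a)) =
          clspan (prods (range a) (prods (adjs M) M))
      & [/\ is_repr (osnorm Y) u,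
            range u = clspan (prods M (range a))
          & forall y x, u (ract y x) = u y \o a x]].

Record is_left_action (B : opAlg R) (A : opAlg R) (Y : rmod A)
    (l : {bilinear B -> Y -> Y}) : Prop := {
  lactA : forall b c y, l b (l c y) = l (amul b c) y;
  lact_ract : forall b y a, l b (ract y a) = ract (l b y) a;
  lact_contr : forall m n p (b : 'M[B]_(m, n)) (y : 'M[Y]_(n, p)),
    mnorm Y (mxmul l b y) <= mnorm B b * mnorm Y y }.

(* [l] is the left action of [B] on [Y]; [lt] and [rt] are the induced actions
   [(a f)(y) = a f(y)] and [(f b)(y) = f(b y)] of [A] and [B] on [Yt].  The
   three tensor product identifications are isomorphisms of (bi)modules. *)
Definition sigmaMorita (A B : opAlg R) (E : rmod B) (F : rmod A) : Prop :=
  exists (Y : rmod A) (r : rigging Y) (Yt : tilde r)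
         (l : {bilinear B -> Y -> Y})
         (lt : {bilinear A -> Yt -> Yt}) (rt : {bilinear Yt -> B -> Yt})
         (tA : {bilinear Yt -> Y -> A}) (tB : {bilinear Y -> Yt -> B})
         (tF : {bilinear E -> Y -> F}),
    [/\ doubly_sigmaDelta Y,
        [/\ is_left_action l,
            forall a f y, tev (lt a f) y = amul a (tev f y)
          & forall f b y, tev (rt f b) y = tev f (l b y)],
        [/\ is_haagerup rt l tA,
            forall a f y, tA (lt a f) y = amul a (tA f y)
          & forall f y a, tA f (ract y a) = amul (tA f y) a],
        [/\ is_haagerup (@ract R A Y) lt tB,
            forall b y f, tB (l b y) f = amul b (tB y f)
          & forall y f b, tB y (rt f b) = amul (tB y f) b]
      & is_haagerup (@ract R B E) l tF /\
        forall x y a, tF x (ract y a) = ract (tF x y) a].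

Definition sigmaDelta (X W : opSpace R) : Prop :=
  exists (H K L Q : hilbert R)
         (phi : {linear X -> (H -> K)}) (psi : {linear W -> (L -> Q)})
         (M1 : set (H -> L)) (M2 : set (K -> Q)),
    [/\ is_repr (osnorm X) phi,
        is_repr (osnorm W) psi,
        is_sigmaTRO M1 /\ is_sigmaTRO M2,
        range phi = clspan (prods (prods (adjs M2) (range psi)) M1)
      & range psi = clspan (prods (prods M2 (range phi)) (adjs M1))].

End Rigged.

(* Main.v *)
(* Y is realized as the closed span of M a(A), with M a sigma-TRO in B(H, K). If
   sum_j m_j m_j^* is an approximate unit for M and e runs over an approximate
   identity of A, choose w_j in Y representing m_j a(e); then sum_j w_j (a(e) m_j^* . )
   is a contractive approximate identity for Y. After amplifying a, the rigging of
   F yields a complete isometry psi of F with psi(g x) = psi(g) a(x). The operators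
   sum_j psi(x (x) w_j) a(e) m_j^* on K converge in norm to phi(x), for each x in E, and
   phi(x) u(y) = psi(x (x) y), where u represents Y. Since B is the completion of
   Y (x) Yt, phi is completely isometric. Its range is the closed span of psi(F) M^*,
   and psi(F) is that of phi(E) M, so M^* and the scalar operators are the two
   TROs of the sigma-Delta equivalence.

   Norm convergence on K, where the approximate units only act strongly, rests on
   the following: if P, X' are contractions, P X' is close to X' and X X' is close
   to X, then X P is close to X, since a contraction which almost fixes a vector
   has an adjoint which almost fixes it. *)
From HB Require Import structures.
Require Import Defs.
From mathcomp Require Import all_boot all_order all_algebra.
From mathcomp Require Import all_classical all_reals all_analysis.
From mathcomp Require Import complex.
From mathcomp Require Import ring lra.

Set Implicit Arguments.
Unset Strict Implicit.
Unset Printing Implicit Defensive.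
Import Order.TTheory GRing.Theory Num.Theory.
Import numFieldNormedType.Exports.
Local Open Scope classical_set_scope.
Local Open Scope complex_scope.
Local Open Scope ring_scope.

(** * Norms and Hilbert spaces over the complex numbers *)

(** The obstacle is that [phi x] must be a norm limit of operators on [fK f], while the convergences
    at hand are strong or one-sided. Two facts help. Each element of [B] acts on [Y] as a norm limit
    of finite sums of maps z -> y g(z), so pointwise convergence of the approximate identity of [Y]
    becomes uniform after that action. Moreover the elements tB(y0 g0(y1), g'(y') g) span a dense
    subspace of [B]; on x times such an element the approximants factor as a fixed operator times
    approximants built from g'(y') g, and the extra factor g'(y') lets the norm of [B] control how
    far a unit of [B] moves that functional. The lower bound for [phi] exploits the infimum in the
    Haagerup norm: a good factorization of tF(x, y), obtained from its norm in [F], is multiplied by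
    elements of [Yt] and yields a factorization of x b in [E]. That the products a(x) adj(m) m' span
    a(A) is not part of the data of [Y]; it comes from the identification of [A] with the tensor
    product of [Yt] and [Y]. *)

Section RealNorm.
Context {R : realType}.
Implicit Types V : normedModType R[i].

Lemma rnormE V (x : V) : `|x| = (rnorm x)%:C.
Proof.
by rewrite /rnorm; have := ger0_Im (normr_ge0 x); case: (`|x|) => a b /= ->.
Qed.

Lemma rnorm_ge0 V (x : V) : 0 <= rnorm x.
Proof. by rewrite -ler0c -rnormE. Qed.
Hint Resolve rnorm_ge0 : core.

Lemma rnorm0 V : rnorm (0 : V) = 0.
Proof. by rewrite /rnorm normr0. Qed.

Lemma rnorm0_eq0 V (x : V) : rnorm x = 0 -> x = 0.
Proof. by move=> x0; apply/normr0_eq0; rewrite rnormE x0. Qed.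

Lemma rnormD V (x y : V) : rnorm (x + y) <= rnorm x + rnorm y.
Proof. by rewrite -lecR rmorphD /= -!rnormE ler_normD. Qed.

Lemma rnormN V (x : V) : rnorm (- x) = rnorm x.
Proof. by rewrite /rnorm normrN. Qed.

Lemma rnormBC V (x y : V) : rnorm (x - y) = rnorm (y - x).
Proof. by rewrite -rnormN opprB. Qed.

Lemma rnorm_triangle V (z x y : V) : rnorm (x - y) <= rnorm (x - z) + rnorm (z - y).
Proof. by rewrite -[x - y](subrKA z) rnormD. Qed.

Lemma rnormZ V (c : R[i]) (x : V) : rnorm (c *: x) = complex.Re `|c| * rnorm x.
Proof.
rewrite /rnorm normrZ [`|x|]rnormE.
have := ger0_Im (normr_ge0 c); case: (`|c|) => a b /= ->.
by rewrite mul0r subr0.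
Qed.

Lemma Re_norm_ge0 (c : R[i]) : 0 <= complex.Re `|c|.
Proof. by have := normr_ge0 c; rewrite lecE => /andP[]. Qed.
Hint Resolve Re_norm_ge0 : core.

Lemma rnorm_sum V (I : Type) (s : seq I) (P : pred I) (f : I -> V) :
  rnorm (\sum_(i <- s | P i) f i) <= \sum_(i <- s | P i) rnorm (f i).
Proof.
elim/big_rec2: _ => [|i y x _ le_xy]; first by rewrite rnorm0.
by rewrite (le_trans (rnormD _ _))// lerD2l.
Qed.

(** Real bounds keep the estimates inside [R]; the topology itself asks for bounds in [R[i]], whose
    order is only partial. *)
Definition ncvg V (I : Type) (F : set_system I) (f : I -> V) (l : V) : Prop :=
  forall e : R, 0 < e -> \forall i \near F, rnorm (f i - l) <= e.

Lemma ncvgP V (I : Type) (F : set_system I) {FF : Filter F} (f : I -> V) (l : V) :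
  f @ F --> l <-> ncvg F f l.
Proof.
split=> [fl e e0|fl].
  have eC : 0 < e%:C :> R[i] by rewrite ltcR.
  move/cvgrPdist_le/(_ _ eC) : fl; apply: filterS => i.
  by rewrite rnormE lecR rnormBC.
apply/cvgrPdist_le => eC eC0.
have e0 : 0 < complex.Re eC by move: eC0; rewrite ltcE => /andP[].
have -> : eC = (complex.Re eC)%:C.
  by move: eC0; rewrite ltcE => /andP[/eqP + _]; case: (eC) => a b /= ->.
by have := fl _ e0; apply: filterS => i; rewrite rnormE lecR rnormBC.
Qed.

Lemma ncvg_unique V (I : Type) (F : set_system I) {FF : ProperFilter F}
  (f : I -> V) (l l' : V) : ncvg F f l -> ncvg F f l' -> l = l'.
Proof. by move=> /ncvgP fl /ncvgP; apply: cvg_unique fl => //. Qed.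

Lemma ncvgD V (I : Type) (F : set_system I) {FF : Filter F} (f g : I -> V) l l' :
  ncvg F f l -> ncvg F g l' -> ncvg F (fun i => f i + g i) (l + l').
Proof. by move=> /ncvgP h1 /ncvgP h2; apply/ncvgP; exact: cvgD. Qed.

Lemma ncvgZ V (I : Type) (F : set_system I) {FF : Filter F} (c : R[i]) (f : I -> V) l :
  ncvg F f l -> ncvg F (fun i => c *: f i) (c *: l).
Proof. by move=> /ncvgP h1; apply/ncvgP; exact: cvgZr. Qed.

Lemma rnorm_lim_le V (I : Type) (F : set_system I) {FF : ProperFilter F}
    (f : I -> V) (l : V) (c : R) :
  ncvg F f l -> (\forall i \near F, rnorm (f i) <= c) -> rnorm l <= c.
Proof.
move=> fl fc; rewrite leNgt; apply/negP => lc.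
have e0 : 0 < (rnorm l - c) / 2 by rewrite divr_gt0// subr_gt0.
have [i [h1 h2]] : exists i, rnorm (f i) <= c /\ rnorm (f i - l) <= (rnorm l - c) / 2.
  apply: (@filter_ex _ F); near=> i; split; first by near: i.
  by near: i; exact: fl.
have := rnormD (f i) (l - f i); rewrite addrCA subrr addr0 (rnormBC l).
by move: h1 h2 lc; lra.
Unshelve. all: by end_near. Qed.

(** The centre [l'] depends on [e] and need not be a value of [f]: in [opcvg_lim] it is the value of
    an approximating operator. *)
Lemma ncvg_cauchy (V : completeNormedModType R[i]) (I : Type) (F : set_system I)
    {FF : ProperFilter F} (f : I -> V) :
  (forall e : R, 0 < e -> exists l', \forall i \near F, rnorm (f i - l') <= e) ->
  exists l, ncvg F f l.
Proof.
move=> fC; exists (lim (f @ F)).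
apply/ncvgP; apply: cauchy_cvg; apply: cauchy_exP => eC eC0.
have e0 : 0 < complex.Re eC / 2 by move: eC0; rewrite ltcE => /andP[_ /=]; lra.
have [l' hl] := fC _ e0; exists l'.
apply: filterS hl => i hi; rewrite /= -ball_normE /= rnormE rnormBC.
move: eC0; rewrite ltcE => /andP[/eqP /= + _].
case: (eC) e0 hi => a b /= e0 hi ->; rewrite ltcR; lra.
Qed.

End RealNorm.
#[global] Hint Extern 0 (is_true (0 <= rnorm _)) => exact: rnorm_ge0 : core.
#[global] Hint Extern 0 (is_true (0 <= complex.Re `|_|)) => exact: Re_norm_ge0 : core.

(** * Inner products and the Riesz representation theorem *)

Section Operators.
Context {R : realType}.
Implicit Types H K L : hilbert R.

Lemma Re_conj (z : R[i]) : complex.Re (Num.conj z) = complex.Re z.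
Proof. by case: z. Qed.

Lemma ReM_i (z : R[i]) : complex.Re ('i * z) = - complex.Im z.
Proof. by case: z => a b /=; ring. Qed.

Lemma ReM_real (t : R) (z : R[i]) : complex.Re (t%:C * z) = t * complex.Re z.
Proof. by case: z => a b /=; ring. Qed.

Lemma ReM_realr (t : R) (z : R[i]) : complex.Re (z * t%:C) = complex.Re z * t.
Proof. by rewrite mulrC ReM_real mulrC. Qed.

(** The real part determines the whole product, since multiplying by ['i] turns the imaginary part
    into a real one ([dot_Im]); real estimates then suffice. *)
Definition rdot H (x y : H) : R := complex.Re (dot H x y).

Lemma rdotDl H (x y z : H) : rdot (x + y) z = rdot x z + rdot y z.
Proof. by rewrite /rdot linearDl /=; case: (dot H x z) => a b; case: (dot H y z). Qed.

Lemma rdotC H (x y : H) : rdot x y = rdot y x.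
Proof. by rewrite /rdot hermC expr0 mul1r Re_conj. Qed.

Lemma rdotDr H (x y z : H) : rdot x (y + z) = rdot x y + rdot x z.
Proof. by rewrite rdotC rdotDl !(rdotC x). Qed.

Lemma rdotZl H (t : R) (x y : H) : rdot (t%:C *: x) y = t * rdot x y.
Proof. by rewrite /rdot linearZl_LR /= ReM_real. Qed.

Lemma rdotZr H (t : R) (x y : H) : rdot x (t%:C *: y) = t * rdot x y.
Proof. by rewrite rdotC rdotZl rdotC. Qed.

Lemma rdotNl H (x y : H) : rdot (- x) y = - rdot x y.
Proof. by have := @rdotZl H (-1) x y; rewrite rmorphN1 scaleN1r mulN1r. Qed.

Lemma rdotNr H (x y : H) : rdot x (- y) = - rdot x y.
Proof. by rewrite rdotC rdotNl rdotC. Qed.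

Lemma rdot0l H (x : H) : rdot 0 x = 0.
Proof. by rewrite /rdot linear0l. Qed.

Lemma rdot_suml H n (f : 'I_n -> H) (y : H) :
  rdot (\sum_(i < n) f i) y = \sum_(i < n) rdot (f i) y.
Proof.
elim: n f => [|n IH] f; first by rewrite !big_ord0 rdot0l.
by rewrite !big_ord_recr /= rdotDl IH.
Qed.

Lemma rdotxx H (x : H) : rdot x x = rnorm x ^+ 2.
Proof.
rewrite /rdot -dot_norm rnormE -rmorphXn /=.
by [].
Qed.

Lemma dot_Im H (x y : H) : complex.Im (dot H x y) = - rdot ('i *: x) y.
Proof. by rewrite /rdot linearZl_LR /= ReM_i opprK. Qed.

Lemma rdot_inj H (y z : H) : (forall x, rdot x y = rdot x z) -> y = z.
Proof.
move=> yz; apply/subr0_eq/rnorm0_eq0/eqP; rewrite -sqrf_eq0 -rdotxx.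
by rewrite {2}/GRing.add /= rdotDr rdotNr yz subrr.
Qed.

Lemma rnorm_sqD H (x y : H) :
  rnorm (x + y) ^+ 2 = rnorm x ^+ 2 + rnorm y ^+ 2 + 2 * rdot x y.
Proof. by rewrite -!rdotxx !rdotDl !rdotDr (rdotC y x); ring. Qed.

Lemma rnorm_sqB H (x y : H) :
  rnorm (x - y) ^+ 2 = rnorm x ^+ 2 + rnorm y ^+ 2 - 2 * rdot x y.
Proof. by rewrite rnorm_sqD rnormN rdotNr; ring. Qed.

Lemma rdot_le H (x y : H) : rdot x y <= rnorm x * rnorm y.
Proof.
have [y0|y0] := eqVneq (rnorm y) 0.
  by rewrite (rnorm0_eq0 y0) rdotC rdot0l rnorm0 mulr0.
have y_gt0 : 0 < rnorm y by rewrite lt_neqAle eq_sym y0 rnorm_ge0.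
have := rnorm_ge0 ((rnorm y)%:C *: x - (rnorm x)%:C *: y).
move/(@exprn_ge0 _ 2); rewrite rnorm_sqB rdotZl rdotZr.
have nZ (t : R) (z : H) : 0 <= t -> rnorm (t%:C *: z) = t * rnorm z.
  by move=> t0; rewrite rnormZ ger0_norm// ler0c.
rewrite !nZ//.
have [x0|x0] := eqVneq (rnorm x) 0.
  by move=> _; rewrite (rnorm0_eq0 x0) rdot0l rnorm0 mul0r.
have x_gt0 : 0 < rnorm x by rewrite lt_neqAle eq_sym x0 rnorm_ge0.
have -> : (rnorm y * rnorm x) ^+ 2 + (rnorm x * rnorm y) ^+ 2 -
    2 * (rnorm y * (rnorm x * rdot x y)) =
    2 * (rnorm x * rnorm y) * (rnorm x * rnorm y - rdot x y) by ring.
by rewrite pmulr_rge0 ?subr_ge0// !mulr_gt0.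
Qed.

(** The real Cauchy-Schwarz inequality, after [x] is rotated by the phase that makes the product
    nonnegative. *)
Lemma norm_dot_le H (x y : H) : complex.Re `|dot H x y| <= rnorm x * rnorm y.
Proof.
set z := dot H x y; have [->|zn] := eqVneq z 0.
  by rewrite normr0 /= mulr_ge0.
have nz : `|z| != 0 by rewrite normr_eq0.
pose c := Num.conj z / `|z|.
have cn : complex.Re `|c| = 1.
  by rewrite /c normrM normfV normr_id norm_conjC mulfV.
have -> : complex.Re `|z| = rdot (c *: x) y.
  rewrite /rdot linearZl_LR /= -/z /c.
  have -> // : Num.conj z / `|z| * z = `|z|.
  by rewrite mulrAC [Num.conj z * z]mulrC -normCK expr2 mulfK.
by apply: le_trans (rdot_le _ _) _; rewrite rnormZ cn mul1r.
Qed.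

Lemma rnormZr H (t : R) (x : H) : rnorm (t%:C *: x) = `|t| * rnorm x.
Proof. by rewrite rnormZ normc_def /= expr0n addr0 sqrtr_sqr. Qed.

(** Variational proof: [J x = |x|^2 - 2 g x] is bounded below, a minimizing sequence is Cauchy, and
    the first variation at its limit [z] gives [g v = rdot v z]. Here [g] is real linear; complex
    linearity returns in [dot_rdot]. *)
Lemma riesz H (g : H -> R) (c : R) :
    (forall x y, g (x + y) = g x + g y) -> (forall (t : R) x, g (t%:C *: x) = t * g x) ->
    (forall x, g x <= c * rnorm x) ->
  exists z, forall x, g x = rdot x z.
Proof.
move=> gD gZ gc.
pose J x := rnorm x ^+ 2 - 2 * g x.
have Jlb x : - c ^+ 2 <= J x.
  have := gc x; rewrite /J => gx.
  have := sqr_ge0 (rnorm x - c); nra.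
have infJ : has_inf (range J).
  by split; [exists (J 0), 0 | exists (- c ^+ 2) => _ [x _ <-]].
set m := inf (range J).
have mJ x : m <= J x by apply: ge_inf; [case: infJ | exists x].
have /choice [u uP] : forall n, exists x, J x <= m + n.+1%:R^-1.
  move=> n; have n0 : 0 < n.+1%:R^-1 :> R by rewrite invr_gt0.
  by have [_ [x _ <-] /ltW] := inf_adherent n0 infJ; exists x.
have JD x y (t : R) : J (x + t%:C *: y) =
    J x + t ^+ 2 * rnorm y ^+ 2 + 2 * t * (rdot y x - g y).
  rewrite /J gD gZ rnorm_sqD rdotZr rnormZr exprMn real_normK ?num_real//.
  by rewrite (rdotC x y); ring.
(* Parallelogram law: [J] at the midpoint of [u i] and [u j] is at least [m]. *)
have uC i j : rnorm (u i - u j) ^+ 2 <= 2 * i.+1%:R^-1 + 2 * j.+1%:R^-1.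
  have := mJ ((2^-1 : R)%:C *: (u i + u j)).
  rewrite /J gZ gD rnormZr ger0_norm ?invr_ge0// exprMn rnorm_sqD.
  have -> : (2^-1 : R) ^+ 2 = 4^-1 by rewrite exprVn; congr (_ ^-1); ring.
  have := uP i; have := uP j; rewrite /J rnorm_sqB.
  move: (i.+1%:R^-1) (j.+1%:R^-1) (rnorm (u i) ^+ 2) (rnorm (u j) ^+ 2) => a b p q.
  move: (g _) (g _) (rdot _ _) => g1 g2 d; lra.
have small (e : R) : 0 < e -> exists N, forall n, (N <= n)%N -> n.+1%:R^-1 <= e.
  move=> e0; exists (Num.truncn e^-1) => n Nn.
  rewrite invf_ple ?posrE//; apply/ltW/(lt_le_trans (Num.Theory.truncnS_gt _)).
  by rewrite ler_nat ltnS.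
have [z uz] : exists z, ncvg \oo u z.
  apply: ncvg_cauchy => e e0.
  have [N NP] := small _ (divr_gt0 (exprn_gt0 2 e0) (ltr0n _ 4)).
  exists (u N); exists N => // n /= Nn.
  rewrite -(@ler_pXn2r _ 2)// ?nnegrE ?rnorm_ge0 ?(ltW e0)//.
  apply: le_trans (uC _ _) _; have := NP _ Nn; have := NP _ (leqnn N).
  by move: (_.+1%:R^-1) (_.+1%:R^-1) => a b; lra.
exists z => v; apply/eqP; rewrite eq_sym -subr_eq0; apply/eqP; set D := _ - _.
(* As [z] is reached only in the limit, minimality along [z + t v] is read off at [u n] with an
   error [e]. A nonnegative quadratic in [t] without constant term forces [D = 0]. *)
have key (t : R) : 0 <= t ^+ 2 * rnorm v ^+ 2 + 2 * t * D.
  apply/ler_addgt0Pl => e e0.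
  have a0 : 0 < 2 * `|t| * rnorm v + 1.
    have := rnorm_ge0 v; have := normr_ge0 t; nra.
  have [N NP] := small _ (divr_gt0 e0 (ltr0n _ 2)).
  have d0 := divr_gt0 (divr_gt0 e0 (ltr0n R 2)) a0.
  have [n [nN nz]] : exists n, (N <= n)%N /\
      rnorm (u n - z) <= e / 2 / (2 * `|t| * rnorm v + 1).
    apply: (@filter_ex _ \oo); near=> n; split; first by near: n; exists N.
    by near: n; exact: uz.
  have := mJ (u n + t%:C *: v); rewrite JD => mn.
  have un := uP n; have Nn := NP n nN.
  have h : `|rdot v (u n) - rdot v z| <= rnorm v * rnorm (u n - z).
    rewrite -rdotNr -rdotDr ler_norml rdot_le andbT lerNl -rdotNl.
    by rewrite (le_trans (rdot_le _ _))// rnormN.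
  have h2 : 2 * t * (rdot v (u n) - g v) <= 2 * t * D + e / 2.
    have -> : rdot v (u n) - g v = D + (rdot v (u n) - rdot v z) by rewrite /D; ring.
    rewrite mulrDr lerD2l (le_trans (ler_norm _))// !normrM ger0_norm//.
    have h3 : rnorm (u n - z) * (2 * `|t| * rnorm v + 1) <= e / 2.
      by rewrite -ler_pdivlMr.
    have h4 : 2 * `|t| * `|rdot v (u n) - rdot v z| <= 2 * `|t| * (rnorm v * rnorm (u n - z)).
      by rewrite ler_wpM2l// mulr_ge0.
    have := rnorm_ge0 (u n - z); lra.
  by move: mn un Nn h2; move: (_.+1%:R^-1) => a0'; lra.
have n0 : 0 < rnorm v ^+ 2 + 1 by rewrite ltr_wpDl// sqr_ge0.
(* Nearly the minimizer of the quadratic; the added 1 keeps the denominator positive when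
   [v = 0]. *)
have := key (- D / (rnorm v ^+ 2 + 1)).
set q := rnorm v ^+ 2 in n0 *.
have -> : (- D / (q + 1)) ^+ 2 * q + 2 * (- D / (q + 1)) * D =
   - (D / (q + 1)) ^+ 2 * (q + 2) by field; rewrite gt_eqF.
rewrite mulNr oppr_ge0 => h.
have q2 : 0 < q + 2 by lra.
have : (D / (q + 1)) ^+ 2 <= 0 by rewrite -(pmulr_lle0 _ q2).
rewrite le_eqVlt ltNge sqr_ge0 orbF sqrf_eq0 mulf_eq0 invr_eq0 (gt_eqF n0) orbF.
by move/eqP.
Unshelve. all: by end_near. Qed.

End Operators.

(** * Bounded operators and adjoints *)

Section Adjoint.
Context {R : realType}.
Implicit Types H K L : hilbert R.

Definition opbd H K (T : H -> K) (c : R) : Prop :=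
  forall x, rnorm (T x) <= c * rnorm x.

Lemma lin_combE (U : Type) (V : lmodType R[i]) (a : R[i]) (S T : U -> V) x :
  (a *: S + T) x = a *: S x + T x.
Proof. by []. Qed.

Section LinearFun.
Context {U V : lmodType R[i]} (T : U -> V).
Hypothesis Tlin : linear T.

Lemma linfD x y : T (x + y) = T x + T y.
Proof. by have := Tlin 1 x y; rewrite !scale1r. Qed.

Lemma linf0 : T 0 = 0.
Proof. by apply: (addrI (T 0)); rewrite -linfD !addr0. Qed.

Lemma linfZ c x : T (c *: x) = c *: T x.
Proof. by have := Tlin c x 0; rewrite !addr0 linf0 addr0. Qed.

Lemma linfN x : T (- x) = - T x.
Proof. by have := linfZ (-1) x; rewrite !scaleN1r. Qed.

Lemma linfB x y : T (x - y) = T x - T y.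
Proof. by rewrite linfD linfN. Qed.

Lemma linf_sum (I : Type) (s : seq I) (P : pred I) (f : I -> U) :
  T (\sum_(i <- s | P i) f i) = \sum_(i <- s | P i) T (f i).
Proof.
elim/big_rec2: _ => [|i x y _ <-]; first exact: linf0.
by rewrite linfD.
Qed.

End LinearFun.

Lemma opbd_le H K (T : H -> K) c d : c <= d -> opbd T c -> opbd T d.
Proof. by move=> cd Tc x; rewrite (le_trans (Tc x))// ler_wpM2r. Qed.

Lemma bounded_opP H K (T : H -> K) :
  bounded_op T <-> linear T /\ exists2 c : R, 0 <= c & opbd T c.
Proof.
split=> [[Tl [c Tc]]|[Tl [c _ Tc]]]; split=> //; last by exists c.
by exists `|c|; rewrite ?normr_ge0//; apply: opbd_le Tc; rewrite ler_norm.
Qed.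

Lemma bounded_lin H K (T : H -> K) : bounded_op T -> linear T.
Proof. by case. Qed.

Lemma bounded0 H K : @bounded_op R H K 0.
Proof.
split=> [a x y|]; first by rewrite scaler0 addr0.
by exists 0 => x; rewrite rnorm0 mul0r.
Qed.

Lemma bounded_id H : @bounded_op R H H id.
Proof. by split=> //; exists 1 => x; rewrite mul1r. Qed.

Lemma bounded_comp H K L (S : K -> L) (T : H -> K) :
  bounded_op S -> bounded_op T -> bounded_op (S \o T).
Proof.
move=> /bounded_opP[Sl [c c0 Sc]] /bounded_opP[Tl [d d0 Td]]; split.
  by move=> a x y; rewrite /= Tl Sl.
exists (c * d) => x; rewrite (le_trans (Sc _))// -mulrA ler_wpM2l//.
Qed.

Lemma bounded_linear_comb H K (a : R[i]) (S T : H -> K) :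
  bounded_op S -> bounded_op T -> bounded_op (a *: S + T).
Proof.
move=> /bounded_opP[Sl [c c0 Sc]] /bounded_opP[Tl [d d0 Td]]; split.
  move=> b x y; rewrite !lin_combE Tl Sl.
  by rewrite !scalerDr !scalerA (mulrC a) addrACA.
exists (complex.Re `|a| * c + d) => x; rewrite mulrDl lin_combE.
rewrite (le_trans (rnormD _ _))// lerD//.
by rewrite rnormZ -mulrA ler_wpM2l.
Qed.

Lemma boundedD H K (S T : H -> K) :
  bounded_op S -> bounded_op T -> bounded_op (S + T).
Proof. by move=> Sb Tb; rewrite -[S]scale1r; exact: bounded_linear_comb. Qed.

Lemma boundedZ H K (a : R[i]) (T : H -> K) :
  bounded_op T -> bounded_op (a *: T).
Proof. by move=> Tb; rewrite -[_ *: _]addr0; apply: bounded_linear_comb => //; exact: bounded0. Qed.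

Lemma boundedB H K (S T : H -> K) :
  bounded_op S -> bounded_op T -> bounded_op (S - T).
Proof. by move=> Sb Tb; rewrite -scaleN1r; apply: boundedD => //; exact: boundedZ. Qed.

Lemma bounded_sum H K (I : Type) (s : seq I) (P : pred I) (T : I -> H -> K) :
  (forall i, P i -> bounded_op (T i)) -> bounded_op (\sum_(i <- s | P i) T i).
Proof.
move=> Tb; elim/big_rec: _ => [|i S Pi Sb]; first exact: bounded0.
exact: boundedD (Tb _ Pi) Sb.
Qed.

Lemma sum_fctE (U : Type) (V : zmodType) (I : Type) (s : seq I) (P : pred I) (f : I -> U -> V) x :
  (\sum_(i <- s | P i) f i) x = \sum_(i <- s | P i) f i x.
Proof. by rewrite fct_sumE. Qed.

Lemma dot_rdot H K (T : H -> K) (S : K -> H) :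
  linear T -> (forall x y, rdot (T x) y = rdot x (S y)) ->
  forall x y, dot K (T x) y = dot H x (S y).
Proof.
move=> Tl TS x y; apply/eqP; rewrite eq_complex; apply/andP; split.
  exact/eqP/TS.
by rewrite !dot_Im -(linfZ Tl) TS.
Qed.

Lemma dot_injr H (y z : H) : (forall x, dot H x y = dot H x z) -> y = z.
Proof. by move=> yz; apply: rdot_inj => x; rewrite /rdot yz. Qed.

Lemma adj_unique H K (T : H -> K) (S : K -> H) :
  (forall x y, dot K (T x) y = dot H x (S y)) -> adj T = S.
Proof.
move=> TS; have h : forall x y, dot K (T x) y = dot H x (adj T y).
  by apply: (@xgetPex _ 0 [set S | forall x y, dot K (T x) y = dot H x (S y)]); exists S.
apply/funext => y; apply: dot_injr => x.
by rewrite -h TS.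
Qed.

(** Riesz applied, for each [y], to the real functional [x |-> Re <T x, y>]. *)
Lemma adjP H K (T : H -> K) : bounded_op T ->
  forall x y, dot K (T x) y = dot H x (adj T y).
Proof.
move=> /bounded_opP[Tl [c c0 Tc]].
have /choice[S TS] : forall y, exists z, forall x, rdot (T x) y = rdot x z.
  move=> y; apply: (@riesz _ _ _ (c * rnorm y)) => [x x'|t x|x].
  - by rewrite (linfD Tl) rdotDl.
  - by rewrite (linfZ Tl) rdotZl.
  - by rewrite (le_trans (rdot_le _ _))// mulrAC ler_wpM2r.
have {}TS := @dot_rdot _ _ T S Tl (fun x y => TS y x).
by rewrite (adj_unique TS).
Qed.

Lemma rdot_adj H K (T : H -> K) : bounded_op T ->
  forall x y, rdot (T x) y = rdot x (adj T y).
Proof. by move=> Tb x y; rewrite /rdot (adjP Tb). Qed.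

Lemma opbd_sq_le (c a b : R) : 0 <= a -> 0 <= c -> 0 <= b -> a ^+ 2 <= c * b * a -> a <= c * b.
Proof.
move=> a0 c0 b0 h; have [->|an0] := eqVneq a 0; first by rewrite mulr_ge0.
by rewrite -(@ler_pM2r _ a) ?lt_neqAle 1?eq_sym ?an0.
Qed.

Lemma adj_linear H K (T : H -> K) : bounded_op T -> linear (adj T).
Proof.
move=> Tb a y z; apply: dot_injr => x.
by rewrite -(adjP Tb) !linearDr !linearZr_LR /= !(adjP Tb).
Qed.

Lemma adj_opbd H K (T : H -> K) c : bounded_op T -> 0 <= c -> opbd T c -> opbd (adj T) c.
Proof.
move=> Tb c0 Tc y; apply: opbd_sq_le => //.
rewrite -rdotxx -(rdot_adj Tb) (le_trans (rdot_le _ _))//.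
by rewrite mulrAC ler_wpM2r.
Qed.

Lemma bounded_adj H K (T : H -> K) : bounded_op T -> bounded_op (adj T).
Proof.
move=> Tb; have /bounded_opP[Tl [c c0 Tc]] := Tb.
by split; [exact: adj_linear|exists c; exact: adj_opbd].
Qed.

Lemma dotC H (x y : H) : dot H x y = Num.conj (dot H y x).
Proof. by rewrite hermC expr0 mul1r. Qed.

Lemma adjK H K (T : H -> K) : bounded_op T -> adj (adj T) = T.
Proof.
by move=> Tb; apply: adj_unique => x y; rewrite dotC -(adjP Tb) -dotC.
Qed.

Lemma adj_comp H K L (S : K -> L) (T : H -> K) :
  bounded_op S -> bounded_op T -> adj (S \o T) = adj T \o adj S.
Proof. by move=> Sb Tb; apply: adj_unique => x y /=; rewrite (adjP Sb) (adjP Tb). Qed.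

Lemma adj_linear_comb H K (a : R[i]) (S T : H -> K) : bounded_op S -> bounded_op T ->
  adj (a *: S + T) = Num.conj a *: adj S + adj T.
Proof.
move=> Sb Tb; apply: adj_unique => x y; rewrite !lin_combE.
rewrite linearDl linearDr linearZl_LR linearZr_LR /= (adjP Sb) (adjP Tb).
by rewrite conjCK.
Qed.

Lemma adj0 H K : adj (0 : H -> K) = 0.
Proof. by apply: adj_unique => x y; rewrite linear0l linear0r. Qed.

Lemma adjB H K (S T : H -> K) : bounded_op S -> bounded_op T ->
  adj (S - T) = adj S - adj T.
Proof.
by move=> Sb Tb; rewrite addrC -scaleN1r adj_linear_comb// rmorphN1 scaleN1r addrC.
Qed.

Lemma adj_sum H K (I : Type) (s : seq I) (P : pred I) (T : I -> H -> K) :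
  (forall i, P i -> bounded_op (T i)) ->
  adj (\sum_(i <- s | P i) T i) = \sum_(i <- s | P i) adj (T i).
Proof.
move=> Tb; elim: s => [|i s IH]; first by rewrite !big_nil adj0.
rewrite !big_cons; case: ifP => // Pi.
rewrite -[T i]scale1r adj_linear_comb ?conjC1 ?scale1r ?IH//; first exact: Tb.
exact: bounded_sum.
Qed.

Lemma adj_id H : adj (id : H -> H) = id.
Proof. exact: adj_unique. Qed.

End Adjoint.

(** * Matrix norms *)

Section MatrixNorm.
Context {R : realType}.
Implicit Types H K L : hilbert R.

(** Squares avoid the root in [op_mxnorm], and arbitrary finite index types let amplified matrices
    be indexed by pairs without flattening. *)
Definition mxbd (I J : finType) H K (T : I -> J -> H -> K) (c : R) : Prop :=
  forall xi : J -> H, \sum_i rnorm (\sum_j T i j (xi j)) ^+ 2 <=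
    c ^+ 2 * \sum_j rnorm (xi j) ^+ 2.

Lemma sumsq_ge0 (V : normedModType R[i]) (J : finType) (xi : J -> V) :
  0 <= \sum_j rnorm (xi j) ^+ 2.
Proof. by apply: sumr_ge0 => j _; exact: sqr_ge0. Qed.

Lemma le_sumsq (V : normedModType R[i]) (J : finType) (xi : J -> V) j :
  rnorm (xi j) ^+ 2 <= \sum_j rnorm (xi j) ^+ 2.
Proof.
by rewrite (bigD1 j)//= lerDl; apply: sumr_ge0 => k _; exact: sqr_ge0.
Qed.

Lemma mxbd_le (I J : finType) H K (T : I -> J -> H -> K) c d :
  0 <= c -> c <= d -> mxbd T c -> mxbd T d.
Proof.
move=> c0 cd Tc xi; rewrite (le_trans (Tc xi))// ler_wpM2r ?sumsq_ge0//.
by rewrite ler_pXn2r// nnegrE// (le_trans c0).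
Qed.

Lemma mxbd_comp (I J P : finType) H K L (S : I -> J -> K -> L) (T : J -> P -> H -> K) c d :
  (forall i j, linear (S i j)) -> mxbd S c -> mxbd T d ->
  mxbd (fun i p x => \sum_j S i j (T j p x)) (c * d).
Proof.
move=> Sl Sc Td xi; rewrite exprMn -mulrA.
apply: le_trans (ler_wpM2l (sqr_ge0 c) (Td xi)); apply: le_trans (Sc _).
rewrite le_eqVlt; apply/orP; left; apply/eqP; apply: eq_bigr => i _; congr (rnorm _ ^+ 2).
by rewrite exchange_big; apply: eq_bigr => j _; rewrite (linf_sum (Sl i j)).
Qed.

Lemma mxbd_eq (I J : finType) H K (S T : I -> J -> H -> K) c :
  (forall i j x, S i j x = T i j x) -> mxbd S c -> mxbd T c.
Proof.
move=> ST Sc; have -> : T = S by apply/funext => i; apply/funext => j; apply/funext.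
exact: Sc.
Qed.

Lemma sum_imset (V : nmodType) (I I' : finType) (h : I' -> I) (F : I -> V) :
  injective h -> (forall i, i \notin h @: [set: I']%SET -> F i = 0) ->
  \sum_i F i = \sum_i' F (h i').
Proof.
move=> hi F0; rewrite (bigID (mem (h @: [set: I']%SET)))/= [X in _ + X]big1 ?addr0//.
by rewrite big_imset/=; [apply: eq_bigl => i; rewrite inE|move=> ? ? _ _; exact: hi].
Qed.

Lemma le_sum_inj (I I' : finType) (h : I' -> I) (F : I -> R) :
  injective h -> (forall i, 0 <= F i) -> \sum_i' F (h i') <= \sum_i F i.
Proof.
move=> hi F0; rewrite [leRHS](bigID (mem (h @: [set: I']%SET)))/= big_imset/=.
  by under [X in _ <= X + _]eq_bigl do rewrite inE; rewrite lerDl sumr_ge0.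
by move=> ? ? _ _; exact: hi.
Qed.

Lemma mxbd_sub (I J I' J' : finType) H K (T : I -> J -> H -> K) (h : I' -> I) (g : J' -> J) c :
  (forall i j, linear (T i j)) -> injective h -> injective g -> mxbd T c ->
  mxbd (fun i j => T (h i) (g j)) c.
Proof.
move=> Tl hi gi Tc xi.
(* Extension of [xi] by zero off the image of [g]. *)
pose eta (j : J) : H := if [pick j' | g j' == j] is Some j' then xi j' else 0.
have etag j : eta (g j) = xi j.
  rewrite /eta; case: pickP => [j' /eqP/gi -> //|/(_ j)].
  by rewrite eqxx.
have eta0 j : j \notin g @: [set: J']%SET -> eta j = 0.
  move=> jg; rewrite /eta; case: pickP => // j' /eqP j'j.
  by move: jg; rewrite -j'j imset_f.
have := Tc eta; rewrite (sum_imset (F := fun j => rnorm (eta j) ^+ 2) gi); last first.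
  by move=> j /eta0 ->; rewrite rnorm0 expr0n.
under [X in _ <= _ * X -> _]eq_bigr do rewrite etag.
apply: le_trans; apply: le_trans (le_sum_inj hi _); last by move=> i; exact: sqr_ge0.
rewrite le_eqVlt; apply/orP; left; apply/eqP; apply: eq_bigr => i _; congr (rnorm _ ^+ 2).
rewrite (sum_imset (F := fun j => T (h i) j (eta j)) gi).
  by apply: eq_bigr => j _; rewrite etag.
by move=> j /eta0 ->; rewrite (linf0 (Tl _ _)).
Qed.

(** Block diagonal: the copies of [T] act on orthogonal summands, so the bound stays [c]. *)
Lemma mxbd_ampl (I J P : finType) H K (T : I -> J -> H -> K) c :
  mxbd T c ->
  mxbd (fun (ip : P * I) (jp : P * J) => if ip.1 == jp.1 then T ip.2 jp.2 else 0) c.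
Proof.
move=> Tc xi; rewrite -(pair_bigA _ (fun p i => rnorm (\sum_(jp : P * J)
   (if p == jp.1 then T i jp.2 else 0) (xi jp)) ^+ 2))/=.
have -> : \sum_j rnorm (xi j) ^+ 2 = \sum_p \sum_j rnorm (xi (p, j)) ^+ 2.
  by rewrite pair_bigA; apply: eq_bigr => -[].
rewrite mulr_sumr.
apply: ler_sum => p _; apply: le_trans (Tc (fun j => xi (p, j))).
rewrite le_eqVlt; apply/orP; left; apply/eqP; apply: eq_bigr => i _; congr (rnorm _ ^+ 2).
transitivity (\sum_p' \sum_j (if p == p' then T i j else 0) (xi (p', j))).
  by rewrite pair_bigA; apply: eq_bigr => -[].
rewrite (bigD1 p)//= eqxx [X in _ + X]big1 ?addr0//.
by move=> p' p'p; apply: big1 => j _; rewrite eq_sym (negPf p'p).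
Qed.

(** A crude bound; what matters is that, at a fixed size, it is finite and tends to 0 with [D]. *)
Lemma mxbd_entries (I J : finType) H K (T : I -> J -> H -> K) D :
  0 <= D -> (forall i j, opbd (T i j) D) ->
  mxbd T (Num.sqrt #|I|%:R * #|J|%:R * D).
Proof.
move=> D0 Td xi.
set s := \sum_j rnorm (xi j) ^+ 2; have s0 : 0 <= s by exact: sumsq_ge0.
have xis j : rnorm (xi j) <= Num.sqrt s.
  by rewrite -[leLHS]ger0_norm// -sqrtr_sqr ler_sqrt// le_sumsq.
have Tij i : rnorm (\sum_j T i j (xi j)) <= #|J|%:R * D * Num.sqrt s.
  apply: le_trans (rnorm_sum _ _ _) _.
  rewrite -mulrA mulr_natl -sumr_const; apply: ler_sum => j _.
  by apply: le_trans (Td i j _) _; exact: ler_wpM2l.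
apply: (@le_trans _ _ (\sum_(i : I) (#|J|%:R * D * Num.sqrt s) ^+ 2)).
  apply: ler_sum => i _; rewrite ler_pXn2r// ?nnegrE//.
  by rewrite !mulr_ge0// sqrtr_ge0.
rewrite sumr_const -[_ *+ _]mulr_natl !exprMn !sqr_sqrtr ?ler0n//.
by rewrite !mulrA.
Qed.

Lemma row_mxbd_bounded (I J : finType) H K (T : I -> J -> H -> K) :
  (forall i j, bounded_op (T i j)) -> exists2 c, 0 <= c & mxbd T c.
Proof.
move=> Tb; have /choice[d dP] : forall ij : I * J, exists d, 0 <= d /\ opbd (T ij.1 ij.2) d.
  by move=> ij; have /bounded_opP[_ [d d0 Td]] := Tb ij.1 ij.2; exists d.
pose D := \sum_ij d ij.
have D0 : 0 <= D by apply: sumr_ge0 => ij _; case: (dP ij).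
have dD i j : d (i, j) <= D.
  by rewrite /D (bigD1 (i, j))//= lerDl; apply: sumr_ge0 => ij _; case: (dP ij).
exists (Num.sqrt #|I|%:R * #|J|%:R * D); first by rewrite !mulr_ge0 ?sqrtr_ge0.
apply: mxbd_entries => // i j; have [_ h] := dP (i, j).
exact: opbd_le (dD i j) h.
Qed.

Definition op_mxset m n H K (T : 'M[H -> K]_(m, n)) : set R :=
  [set Num.sqrt (\sum_(i < m) rnorm (\sum_(j < n) T i j (xi j)) ^+ 2)
     | xi in [set xi : 'I_n -> H | \sum_(j < n) rnorm (xi j) ^+ 2 <= 1]].

Lemma op_mxset_sup m n H K (T : 'M[H -> K]_(m, n)) :
  (forall i j, bounded_op (T i j)) -> op_mxset T 0 /\ has_sup (op_mxset T).
Proof.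
move=> Tb; have S0 : op_mxset T 0.
  exists (fun=> 0); first by rewrite /= big1// => j _; rewrite rnorm0 expr0n.
  rewrite big1 ?sqrtr0// => i _; rewrite big1 ?rnorm0 ?expr0n// => j _.
  by rewrite (linf0 (bounded_lin (Tb _ _))).
split => //; split; first by exists 0.
have [d d0 Td] := row_mxbd_bounded Tb; exists d => _ [xi /= xi1 <-].
rewrite -[leRHS](ger0_norm d0) -sqrtr_sqr ler_sqrt ?sqr_ge0//.
by apply: le_trans (Td xi) _; rewrite ler_piMr// sqr_ge0.
Qed.

Lemma op_mxnorm_ge0 m n H K (T : 'M[H -> K]_(m, n)) :
  (forall i j, bounded_op (T i j)) -> 0 <= op_mxnorm T.
Proof.
move=> /op_mxset_sup[S0 [_ supS]]; exact: ub_le_sup.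
Qed.

Lemma op_mxnormP m n H K (T : 'M[H -> K]_(m, n)) c :
  (forall i j, bounded_op (T i j)) -> 0 <= c ->
  op_mxnorm T <= c <-> mxbd (fun i j => T i j) c.
Proof.
move=> Tb c0; rewrite /op_mxnorm; set S := image _ _.
have [S0 supS] : S 0 /\ has_sup S := op_mxset_sup Tb.
split=> [Sc xi|Tc].
  set s := \sum_j rnorm (xi j) ^+ 2; have s0 : 0 <= s by exact: sumsq_ge0.
  have [s00|sn0] := eqVneq s 0.
    have xi0 j : xi j = 0.
      apply: rnorm0_eq0; apply/eqP; rewrite -sqrf_eq0 eq_le sqr_ge0 andbT.
      by rewrite -s00 le_sumsq.
    rewrite s00 mulr0 big1// => i _; rewrite big1 ?rnorm0 ?expr0n// => j _.
    by rewrite xi0 (linf0 (bounded_lin (Tb _ _))).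
  have s_gt0 : 0 < s by rewrite lt_neqAle eq_sym sn0.
  pose t := (Num.sqrt s)^-1; have t0 : 0 <= t by rewrite invr_ge0 sqrtr_ge0.
  have ts : t ^+ 2 = s^-1 by rewrite exprVn sqr_sqrtr.
  have : Num.sqrt (\sum_(i < m) rnorm (\sum_(j < n) T i j (t%:C *: xi j)) ^+ 2) <= c.
    apply: (le_trans _ Sc); apply: ub_le_sup; first by case: supS.
    exists (fun j => t%:C *: xi j) => //=.
    under eq_bigr do rewrite rnormZr exprMn real_normK ?num_real// ts.
    by rewrite -mulr_sumr mulVf.
  rewrite -[leRHS](ger0_norm c0) -sqrtr_sqr ler_sqrt ?sqr_ge0//.
  under eq_bigr => i _.
    under eq_bigr do rewrite (linfZ (bounded_lin (Tb _ _))).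
    rewrite -scaler_sumr rnormZr exprMn real_normK ?num_real// ts.
    over.
  by rewrite -mulr_sumr mulrC ler_pdivrMr.
apply: ge_sup; first by exists 0.
move=> _ [xi /= xi1 <-]; rewrite -[leRHS](ger0_norm c0) -sqrtr_sqr ler_sqrt ?sqr_ge0//.
by apply: le_trans (Tc xi) _; rewrite ler_piMr// sqr_ge0.
Qed.

End MatrixNorm.

(** * Matrix norms of operator spaces through representations *)

Section MatrixNorm2.
Context {R : realType}.
Implicit Types (H K L : hilbert R) (X : opSpace R).

(* Minkowski, through [(a + b)^2 <= (1 + d/c) a^2 + (1 + c/d) b^2]. *)
Lemma mxbdD (I J : finType) H K (S T : I -> J -> H -> K) c d :
  0 < c -> 0 < d -> mxbd S c -> mxbd T d ->
  mxbd (fun i j x => S i j x + T i j x) (c + d).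
Proof.
move=> c0 d0 Sc Td xi; set s := \sum_j rnorm (xi j) ^+ 2.
have s0 : 0 <= s by exact: sumsq_ge0.
apply: (@le_trans _ _ ((1 + d / c) * (c ^+ 2 * s) + (1 + c / d) * (d ^+ 2 * s))); last first.
  rewrite le_eqVlt; apply/orP; left; apply/eqP; field.
  by rewrite !gt_eqF.
have dc : 0 <= d / c by rewrite divr_ge0 ?ltW.
have cd : 0 <= c / d by rewrite divr_ge0 ?ltW.
apply: le_trans (lerD (ler_wpM2l (addr_ge0 ler01 dc) (Sc xi))
  (ler_wpM2l (addr_ge0 ler01 cd) (Td xi))).
rewrite !mulr_sumr -big_split /=; apply: ler_sum => i _.
rewrite big_split /=; set a := \sum_j _; set b := \sum_j _.
have := rnormD a b; move/(@lerXn2r _ 2 _ _ (rnorm_ge0 _) (addr_ge0 (rnorm_ge0 _) (rnorm_ge0 _))).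
move=> h; apply: le_trans h _.
have := rnorm_ge0 a; have := rnorm_ge0 b.
move: (rnorm a) (rnorm b) => p q q0 p0.
rewrite -subr_ge0.
have -> : (1 + d / c) * p ^+ 2 + (1 + c / d) * q ^+ 2 - (p + q) ^+ 2 =
  (d * p - c * q) ^+ 2 / (c * d) by field; rewrite !gt_eqF.
by rewrite divr_ge0 ?sqr_ge0// mulr_ge0// ltW.
Qed.

Section Repr.
Context (X : opSpace R) (H K : hilbert R) (u : {linear X -> (H -> K)}).
Hypothesis hu : is_repr (osnorm X) u.

Lemma repr_bounded x : bounded_op (u x).
Proof. by apply: hu.1; exists x. Qed.

Lemma repr_mnorm_le m n (x : 'M[X]_(m, n)) c : 0 <= c ->
  mnorm X x <= c <-> mxbd (fun i j => u (x i j)) c.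
Proof.
move=> c0; rewrite -(hu.2 m n x).
rewrite op_mxnormP//; last by move=> i j; rewrite mxE; exact: repr_bounded.
by split; apply: mxbd_eq => i j z; rewrite mxE.
Qed.

Lemma repr_opbd x c : 0 <= c -> rnorm x <= c <-> opbd (u x) c.
Proof.
move=> c0; rewrite -mnorm1 /vnorm repr_mnorm_le//; split=> [xc y|xc xi].
  have := xc (fun=> y); rewrite !big_ord1 mxE -exprMn.
  by rewrite ler_pXn2r// nnegrE// mulr_ge0.
rewrite !big_ord1 mxE -exprMn ler_pXn2r// ?nnegrE ?mulr_ge0//; exact: xc.
Qed.

Lemma repr_opbd_norm x : opbd (u x) (rnorm x).
Proof. exact/repr_opbd. Qed.

Lemma repr_inj x y : u x = u y -> x = y.
Proof.
move=> uxy; apply/subr0_eq/rnorm0_eq0/eqP; rewrite eq_le rnorm_ge0 andbT.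
by apply/repr_opbd => // z; rewrite linearB /= uxy subrr rnorm0 mul0r.
Qed.

End Repr.

Lemma mnorm_ge0 X m n (x : 'M[X]_(m, n)) : 0 <= mnorm X x.
Proof.
have [H [K [u hu]]] := mnorm_repr X.
rewrite -(hu.2 m n x); apply: op_mxnorm_ge0 => i j; rewrite mxE; exact: (repr_bounded hu).
Qed.
#[local] Hint Resolve mnorm_ge0 : core.

Lemma mnorm11 X (x : 'M[X]_1) : mnorm X x = rnorm (x ord0 ord0).
Proof.
rewrite -mnorm1 /vnorm; congr mnorm; apply/matrixP => i j.
by rewrite mxE !ord1.
Qed.

Lemma mnorm_sub X m n m' n' (x : 'M[X]_(m, n)) (h : 'I_m' -> 'I_m) (g : 'I_n' -> 'I_n) :
  injective h -> injective g -> mnorm X (\matrix_(i, j) x (h i) (g j)) <= mnorm X x.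
Proof.
move=> hi gi; have [H [K [u hu]]] := mnorm_repr X.
apply/(repr_mnorm_le hu) => //.
apply: (@mxbd_eq _ _ _ _ _ (fun i j => u (x (h i) (g j)))).
  by move=> i j z; rewrite mxE.
apply: (@mxbd_sub _ _ _ _ _ _ _ (fun i j => u (x i j))) => //.
  by move=> i j; exact: bounded_lin (repr_bounded hu _).
exact/(repr_mnorm_le hu).
Qed.

(** Rows and columns of the block diagonal matrix with [k] copies of [x], listed by [h] and [g]:
    matrix indices are ordinals, so an enumeration of the pairs has to be chosen. *)
Lemma mnorm_ampl X m n k r c (x : 'M[X]_(m, n)) (h : 'I_r -> 'I_k * 'I_m) (g : 'I_c -> 'I_k * 'I_n) :
  injective h -> injective g ->
  mnorm X (\matrix_(i, j) if (h i).1 == (g j).1 then x (h i).2 (g j).2 else 0) <= mnorm X x.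
Proof.
move=> hi gi; have [H [K [u hu]]] := mnorm_repr X.
apply/(repr_mnorm_le hu) => //.
have h0 : mxbd (fun i j => u (x i j)) (mnorm X x) by exact/(repr_mnorm_le hu).
have h1 := mxbd_ampl (P := 'I_k) h0.
have h2 := mxbd_sub _ hi gi h1.
apply: (mxbd_eq _ (h2 _)) => [i j z|i j]; first by rewrite mxE; case: ifP => // _; rewrite linear0.
by case: ifP => _; [exact: bounded_lin (repr_bounded hu _)|move=> a y z; rewrite scaler0 addr0].
Qed.

Lemma mnorm_entry X m n (x : 'M[X]_(m, n)) i j : rnorm (x i j) <= mnorm X x.
Proof.
have h : injective (fun _ : 'I_1 => i) by move=> a b _; rewrite !ord1.
have g : injective (fun _ : 'I_1 => j) by move=> a b _; rewrite !ord1.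
by have := mnorm_sub x h g; rewrite mnorm11 mxE.
Qed.

Lemma mnormD X m n (x y : 'M[X]_(m, n)) : mnorm X (x + y) <= mnorm X x + mnorm X y.
Proof.
have [H [K [u hu]]] := mnorm_repr X.
apply/ler_addgt0Pl => e e0; rewrite [e](@splitr R) addrACA.
have e2 : 0 < e / 2 by rewrite divr_gt0.
have px : 0 < e / 2 + mnorm X x by rewrite ltr_wpDr.
have py : 0 < e / 2 + mnorm X y by rewrite ltr_wpDr.
apply/(repr_mnorm_le hu); first by rewrite addr_ge0// ltW.
apply: (@mxbd_eq _ _ _ _ _ (fun i j z => u (x i j) z + u (y i j) z)).
  by move=> i j z; rewrite mxE linearD.
by apply: mxbdD => //; (apply/(repr_mnorm_le hu); [exact: ltW|rewrite lerDr ltW]).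
Qed.

Lemma mnormZ X m n (c : R[i]) (x : 'M[X]_(m, n)) :
  mnorm X (map_mx (fun y => c *: y) x) <= complex.Re `|c| * mnorm X x.
Proof.
have [H [K [u hu]]] := mnorm_repr X.
have c0 : 0 <= complex.Re `|c| by exact: Re_norm_ge0.
apply/(repr_mnorm_le hu); first exact: mulr_ge0.
move=> xi; rewrite exprMn -mulrA.
have /(repr_mnorm_le hu) := lexx (mnorm X x); move=> /(_ (mnorm_ge0 _) xi) h.
apply: le_trans (ler_wpM2l (sqr_ge0 _) h); rewrite mulr_sumr; apply: ler_sum => i _.
rewrite -exprMn -rnormZ scaler_sumr le_eqVlt; apply/orP; left; apply/eqP.
by congr (rnorm _ ^+ 2); apply: eq_bigr => j _; rewrite mxE linearZ.
Qed.

Lemma mnorm_entries_le X m n (x : 'M[X]_(m, n)) d : 0 <= d ->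
  (forall i j, rnorm (x i j) <= d) -> mnorm X x <= Num.sqrt m%:R * n%:R * d.
Proof.
move=> d0 xd; have [H [K [u hu]]] := mnorm_repr X.
apply/(repr_mnorm_le hu); first by rewrite !mulr_ge0 ?sqrtr_ge0.
have := @mxbd_entries _ _ _ _ _ (fun i j => u (x i j)) _ d0; rewrite !card_ord.
by apply=> i j; exact/(repr_opbd hu).
Qed.

Lemma mnorm_lim_le X m n (I : Type) (F : set_system I) {FF : ProperFilter F}
    (f : I -> 'M[X]_(m, n)) (l : 'M[X]_(m, n)) (c : R) :
  (forall i j, ncvg F (fun k => f k i j) (l i j)) ->
  (\forall k \near F, mnorm X (f k) <= c) -> mnorm X l <= c.
Proof.
move=> fl fc; apply/ler_addgt0Pl => e e0.
pose C := Num.sqrt m%:R * n%:R + 1 : R.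
have C0 : 0 < C by rewrite ltr_wpDl// mulr_ge0// sqrtr_ge0.
have d0 : 0 < e / C by rewrite divr_gt0.
have : \forall k \near F, forall i j, rnorm (f k i j - l i j) <= e / C.
  apply: filter_forall => i; apply: filter_forall => j; exact: fl.
move=> h; have [k [k1 k2]] := filter_ex (filterI h fc).
have -> : l = (l - f k) + f k by rewrite subrK.
apply: le_trans (mnormD _ _) _; apply: lerD => //.
apply: le_trans (mnorm_entries_le (ltW d0) _) _.
  by move=> i j; rewrite !mxE rnormBC.
rewrite mulrA ler_pdivrMr// mulrC ler_pM2l// lerDl//.
Qed.

Section ColumnBlock.
Context (A : opAlg R) (H K : hilbert R) (a : {linear A -> (H -> K)}).
Hypothesis ha : is_repr (osnorm A) a.

(** [\mxcol] and [\mxblock] number the pairs (block, position) through [tagnat]; [unpack] and [pack]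
    translate between these numbers and the pairs used by [mxbd]. *)
Definition unpack k n (s : 'I_(\sum_(i < k) n)) : 'I_k * 'I_n :=
  (@tagnat.sig1 k (fun=> n) s, @tagnat.sig2 k (fun=> n) s).

Definition pack k n (ir : 'I_k * 'I_n) : 'I_(\sum_(i < k) n) :=
  @tagnat.Rank k (fun=> n) ir.1 ir.2.

Lemma unpackK k n : cancel (@unpack k n) (@pack k n).
Proof. by move=> s; rewrite /pack /= tagnat.sig2K. Qed.

Lemma packK k n : cancel (@pack k n) (@unpack k n).
Proof.
move=> [i r]; rewrite /unpack /pack /=.
have := tagnat.rankK (Tagged (fun=> 'I_n) r : {i : 'I_k & 'I_n}).
rewrite /tagnat.sig1 /tagnat.sig2 => -> //.
Qed.

Lemma col_mxnorm_le n k l (x : 'M['I_n -> A]_(k, l)) c : 0 <= c ->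
  @col_mxnorm R A n k l x <= c <->
  mxbd (fun (ir : 'I_k * 'I_n) (j : 'I_l) => a (x ir.1 j ir.2)) c.
Proof.
move=> c0; rewrite /col_mxnorm (repr_mnorm_le ha)//.
have lin i j r : linear (a (x i j r)) := bounded_lin (repr_bounded ha _).
split=> h.
- have := mxbd_sub _ (can_inj (@packK k n)) (@inj_id 'I_l) h.
  move=> h'; apply: (mxbd_eq _ (h' _)) => [ir j z|i j].
    rewrite !mxE; have := packK ir; rewrite /unpack => {3 4}<- /=.
    by [].
  exact: bounded_lin (repr_bounded ha _).
- have := @mxbd_sub _ _ _ _ _ _ _ (fun (ir : 'I_k * 'I_n) (j : 'I_l) => a (x ir.1 j ir.2))
    _ _ _ _ (can_inj (@unpackK k n)) (@inj_id 'I_l) h.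
  move=> h'; apply: (mxbd_eq _ (h' _)) => [s j z|i j]; last exact: lin.
  by rewrite !mxE.
Qed.

Lemma cb_block_le (V : Type) m n p q (F : 'I_m -> 'I_n -> V -> A) (y : 'M[V]_(p, q)) c : 0 <= c ->
  mnorm A (\mxblock_(k < p, l < q) (\matrix_(i < m, j < n) F i j (y k l))) <= c <->
  mxbd (fun (ki : 'I_p * 'I_m) (lj : 'I_q * 'I_n) => a (F ki.2 lj.2 (y ki.1 lj.1))) c.
Proof.
move=> c0; rewrite (repr_mnorm_le ha)//.
split=> h.
- have := mxbd_sub _ (can_inj (@packK p m)) (can_inj (@packK q n)) h.
  move=> h'; apply: (mxbd_eq _ (h' _)) => [ki lj z|i j].
    rewrite !mxE; have := packK ki; have := packK lj; rewrite /unpack => {3 4}<- {3 4}<- /=.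
    by [].
  exact: bounded_lin (repr_bounded ha _).
- have := @mxbd_sub _ _ _ _ _ _ _
    (fun (ki : 'I_p * 'I_m) (lj : 'I_q * 'I_n) => a (F ki.2 lj.2 (y ki.1 lj.1)))
    _ _ _ _ (can_inj (@unpackK p m)) (can_inj (@unpackK q n)) h.
  move=> h'; apply: (mxbd_eq _ (h' _)) => [s j z|i j]; last exact: bounded_lin (repr_bounded ha _).
  by rewrite !mxE.
Qed.

End ColumnBlock.

End MatrixNorm2.
#[global] Hint Extern 0 (is_true (0 <= mnorm _ _)) => exact: mnorm_ge0 : core.

(** * Hilbert sums *)

Section Summation.
Context {R : realType} {J : choiceType}.
Implicit Types f g h : J -> R.

Definition nsum f : \bar R := \esum_(j in setT) (f j)%:E.

Lemma nsum_le f (M : R) :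
  (forall s : seq J, uniq s -> \sum_(j <- s) f j <= M) -> (nsum f <= M%:E)%E.
Proof.
move=> sM; apply: ge_ereal_sup => _ [A [finA _] <-].
by rewrite fsbig_finite//= sumEFin lee_fin sM.
Qed.

Lemma le_nsum f (s : seq J) : uniq s -> ((\sum_(j <- s) f j)%:E <= nsum f)%E.
Proof.
move=> us; apply: esum_ge; exists [set` s] => //.
by rewrite -fsbig_seq// sumEFin.
Qed.

Lemma nsum_ge0 f : (forall j, 0 <= f j) -> (0 <= nsum f)%E.
Proof. by move=> f0; apply: esum_ge0 => j _; rewrite lee_fin. Qed.

Lemma nsumD f g : (forall j, 0 <= f j) -> (forall j, 0 <= g j) ->
  nsum (fun j => f j + g j) = (nsum f + nsum g)%E.
Proof. by move=> f0 g0; rewrite -esumD// => j _; rewrite lee_fin. Qed.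

Definition summ h : Prop := (nsum (fun j => `|h j|)%R < +oo)%E.

(** Signed sum as a difference of two sums of nonnegative terms; [|h| + h] is twice the positive
    part. *)
Definition tsum h : R := fine (nsum (fun j => `|h j| + h j)) - fine (nsum (fun j => `|h j|)).

Lemma summ_le f h : (forall j, `|h j| <= f j) -> (nsum f < +oo)%E -> summ h.
Proof. by move=> hf; apply: le_lt_trans; apply: le_esum => j _; rewrite lee_fin. Qed.

Lemma summ_bound h (M : R) :
  (forall s : seq J, uniq s -> \sum_(j <- s) `|h j| <= M) -> summ h.
Proof. by move=> /nsum_le; rewrite /summ => /le_lt_trans; apply; rewrite ltry. Qed.

Lemma nsum_fin_num f : (forall j, 0 <= f j) -> summ f -> nsum f \is a fin_num.
Proof.
move=> f0 fs; rewrite ge0_fin_numE ?nsum_ge0//.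
by apply: le_lt_trans fs; apply: le_esum => j _; rewrite lee_fin ler_norm.
Qed.

Lemma nsum_fin f : (forall j, 0 <= f j) -> summ f -> nsum f = (fine (nsum f))%:E.
Proof. by move=> f0 fs; rewrite fineK// nsum_fin_num. Qed.

Lemma summD f g : summ f -> summ g -> summ (fun j => f j + g j).
Proof.
move=> fs gs; apply: (@summ_le (fun j => `|f j| + `|g j|)) => [j|]; first exact: ler_normD.
by rewrite nsumD// lte_add_pinfty.
Qed.

Lemma summ_norm f : summ f -> summ (fun j => `|f j|).
Proof. by rewrite /summ; under [X in _ -> (nsum X < _)%E]funext do rewrite normr_id. Qed.

(** Independence of the decomposition: [(f, g)] and [(|h| + h, |h|)] both write [h] as a difference,
    so the cross sums agree, and they can be cancelled because they are finite. *)
Lemma tsumE f g : (forall j, 0 <= f j) -> (forall j, 0 <= g j) -> summ f -> summ g ->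
  tsum (fun j => f j - g j) = fine (nsum f) - fine (nsum g).
Proof.
move=> f0 g0 fs gs; set h := fun j => f j - g j.
have hs : summ h.
  apply: (@summ_le (fun j => f j + g j)) => [j|].
    by rewrite /h (le_trans (ler_normB _ _))// !ger0_norm.
  by rewrite nsumD// (nsum_fin f0)// (nsum_fin g0)// -EFinD ltry.
have nh0 j : 0 <= `|h j| by [].
have ph0 j : 0 <= `|h j| + h j by rewrite -lerBlDl sub0r lerNl -normrN ler_norm.
have phs : summ (fun j => `|h j| + h j) by apply: summD => //; exact: summ_norm.
have : (nsum (fun j => `|h j| + h j)%R + nsum g = nsum (fun j => `|h j|)%R + nsum f)%E.
  rewrite -!nsumD//; congr nsum; apply/funext => j; rewrite /h; ring.
rewrite (nsum_fin f0)// (nsum_fin g0)// (nsum_fin ph0)// (nsum_fin nh0)//; last exact: summ_norm.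
by rewrite -!EFinD => -[]; rewrite /tsum; lra.
Qed.

Lemma tsum_ge0E f : (forall j, 0 <= f j) -> summ f -> (tsum f)%:E = nsum f.
Proof.
move=> f0 fs; rewrite [RHS]nsum_fin//; congr (_%:E).
have := @tsumE f (fun=> 0) f0 (fun=> lexx 0) fs.
have n0 : nsum (fun=> 0 : R) = 0%:E by rewrite /nsum esum1.
rewrite n0 /= subr0 => <-; last by rewrite /summ normr0 n0 ltry.
by congr tsum; apply/funext => j; rewrite subr0.
Qed.

Lemma tsum_ge0 f : (forall j, 0 <= f j) -> summ f -> 0 <= tsum f.
Proof. by move=> f0 fs; rewrite -lee_fin tsum_ge0E// nsum_ge0. Qed.

Lemma tsum_le f (M : R) : (forall j, 0 <= f j) ->
  (forall s : seq J, uniq s -> \sum_(j <- s) f j <= M) -> summ f /\ tsum f <= M.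
Proof.
move=> f0 fM; have fs : summ f.
  by apply: (@summ_bound _ M) => s us; under eq_bigr do rewrite ger0_norm//; exact: fM.
by split => //; rewrite -lee_fin tsum_ge0E// nsum_le.
Qed.

Lemma le_tsum f (s : seq J) : (forall j, 0 <= f j) -> summ f -> uniq s ->
  \sum_(j <- s) f j <= tsum f.
Proof. by move=> f0 fs us; rewrite -lee_fin tsum_ge0E// le_nsum. Qed.

Lemma tsumD f g : summ f -> summ g -> tsum (fun j => f j + g j) = tsum f + tsum g.
Proof.
move=> fs gs.
have p0 (h : J -> R) j : 0 <= `|h j| + h j by rewrite -lerBlDl sub0r lerNl -normrN ler_norm.
have n0 (h : J -> R) j : 0 <= `|h j| by [].
have ps (h : J -> R) : summ h -> summ (fun j => `|h j| + h j).
  by move=> hs; apply: summD => //; exact: summ_norm.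
have := @tsumE (fun j => (`|f j| + f j) + (`|g j| + g j)) (fun j => `|f j| + `|g j|)
  (fun j => addr_ge0 (p0 f j) (p0 g j)) (fun j => addr_ge0 (n0 f j) (n0 g j))
  (summD (ps _ fs) (ps _ gs)) (summD (summ_norm fs) (summ_norm gs)).
rewrite (nsumD (p0 f) (p0 g)) (nsumD (n0 f) (n0 g)).
have fnp k : summ k -> nsum (fun j => `|k j| + k j) \is a fin_num.
  by move=> ks; apply: nsum_fin_num; [exact: p0|exact: ps].
have fnn k : summ k -> nsum (fun j => `|k j|) \is a fin_num.
  by move=> ks; apply: nsum_fin_num; [exact: n0|exact: summ_norm].
rewrite (fineD (fnp _ fs) (fnp _ gs)) (fineD (fnn _ fs) (fnn _ gs)) => h.
rewrite {2 3}/tsum; transitivity (tsum (fun j => `|f j| + f j + (`|g j| + g j) - (`|f j| + `|g j|))).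
  by congr tsum; apply/funext => j; ring.
rewrite h; ring.
Qed.

Lemma summZ (t : R) f : summ f -> summ (fun j => t * f j).
Proof.
move=> fs; have fs' := nsum_fin (fun j => normr_ge0 (f j)) (summ_norm fs).
apply: (@summ_bound _ (`|t| * fine (nsum (fun j => `|f j|)))) => s us.
under eq_bigr do rewrite normrM.
by rewrite -mulr_sumr ler_wpM2l// -lee_fin -fs' le_nsum.
Qed.

Lemma tsumN f : summ f -> tsum (fun j => - f j) = - tsum f.
Proof.
move=> fs; have nfs : summ (fun j => - f j).
  by rewrite /summ; under [X in (nsum X < _)%E]funext do rewrite normrN.
apply/eqP; rewrite -addr_eq0 -tsumD//.
have -> : (fun j => - f j + f j) = (fun=> 0) by apply/funext => j; rewrite addNr.
rewrite eq_le; apply/andP; split.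
  by apply: (tsum_le _ _).2 => // s _; rewrite big1.
by apply: tsum_ge0 => //; apply: (@summ_bound _ 0) => s _; rewrite big1// => j _; rewrite normr0.
Qed.

Lemma tsumZ_ge0 (t : R) f : 0 <= t -> (forall j, 0 <= f j) -> summ f ->
  tsum (fun j => t * f j) = t * tsum f.
Proof.
have le (u : R) h : 0 <= u -> (forall j, 0 <= h j) -> summ h -> tsum (fun j => u * h j) <= u * tsum h.
  move=> u0 h0 hs; apply: (tsum_le _ _).2 => [j|s us]; first exact: mulr_ge0.
  by rewrite -mulr_sumr ler_wpM2l// le_tsum.
move=> t0 f0 fs; apply/eqP; rewrite eq_le le//=.
have [->|tn0] := eqVneq t 0.
  rewrite mul0r; apply: tsum_ge0 => [j|]; first by rewrite mul0r.
  exact: summZ.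
rewrite mulrC -ler_pdivlMr ?lt_neqAle 1?eq_sym ?tn0// mulrC.
apply: le_trans (le _ _ _ _ _); rewrite ?invr_ge0//.
- by rewrite le_eqVlt; apply/orP; left; apply/eqP; congr tsum; apply/funext => j; rewrite mulKf.
- by move=> j; exact: mulr_ge0.
- exact: summZ.
Qed.

Lemma tsumZ (t : R) f : summ f -> tsum (fun j => t * f j) = t * tsum f.
Proof.
move=> fs.
have p0 j : 0 <= `|f j| + f j by rewrite -lerBlDl sub0r lerNl -normrN ler_norm.
have n0 j : 0 <= `|f j| by [].
have nfs := summ_norm fs.
have pfs := summD nfs fs.
have pos (u : R) : 0 <= u -> tsum (fun j => u * f j) = u * tsum f.
  move=> u0.
  have -> : (fun j => u * f j) = (fun j => u * (`|f j| + f j) + - (u * `|f j|)).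
    by apply/funext => j; ring.
  rewrite tsumD; last 2 first.
  - exact: summZ.
  - have -> : (fun j => - (u * `|f j|)) = (fun j => - u * `|f j|) by apply/funext => j; ring.
    exact: summZ.
  by rewrite tsumN ?tsumZ_ge0 ?tsumD//; [ring|exact: summZ].
have [t0|t0] := leP 0 t; first exact: pos.
have -> : (fun j => t * f j) = (fun j => - (- t * f j)) by apply/funext => j; ring.
by rewrite tsumN ?pos ?oppr_ge0 1?ltW//; [ring|exact: summZ].
Qed.

Lemma tsum_comb3 (a b : R) f g h k : summ f -> summ g -> summ h ->
  (forall j, k j = a * f j + b * g j + h j) -> tsum k = a * tsum f + b * tsum g + tsum h.
Proof.
move=> fs gs hs kE.
have sa := summZ a fs; have sb := summZ b gs.
rewrite -(tsumZ a fs) -(tsumZ b gs) -(tsumD sa sb) -(tsumD (summD sa sb) hs).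
by congr tsum; apply/funext.
Qed.

End Summation.

(** * The Hilbert space of square summable families *)

Section L2.
Context {R : realType} {J : choiceType} (H : hilbert R).

Definition sqs (x : J -> H) : J -> R := fun j => rnorm (x j) ^+ 2.

Lemma sqs_ge0 (x : J -> H) j : 0 <= sqs x j. Proof. exact: sqr_ge0. Qed.

Definition l2pred : {pred J -> H} := fun x => `[< summ (sqs x) >].

Lemma sqs_comb (a : R[i]) (x y : J -> H) j :
  sqs (a *: x + y) j <= 2 * (complex.Re `|a| ^+ 2 * sqs x j + sqs y j).
Proof.
rewrite /sqs lin_combE; have := rnormD (a *: x j) (y j); rewrite rnormZ.
have := rnorm_ge0 (a *: x j + y j); have := Re_norm_ge0 a.
have := rnorm_ge0 (x j); have := rnorm_ge0 (y j).
set p := rnorm (x j); set q := rnorm (y j); set r := rnorm (_ + _).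
set t := complex.Re _ => q0 p0 t0 r0 rtpq.
have h : r ^+ 2 <= (t * p + q) ^+ 2 by apply: lerXn2r; rewrite ?nnegrE ?addr_ge0 ?mulr_ge0.
by apply: (le_trans h); have := sqr_ge0 (t * p - q); nra.
Qed.

Lemma summ_nneg (f g : J -> R) : (forall j, 0 <= f j <= g j) -> summ g -> summ f.
Proof.
move=> fg gs; apply: (summ_le (f := g)) => [j|]; first by have /andP[f0 ?] := fg j; rewrite ger0_norm.
apply: le_lt_trans gs; apply: le_esum => j _; rewrite lee_fin ler_norm//.
Qed.

Lemma l2_submod : submod_closed l2pred.
Proof.
split.
  apply/asboolP; apply: (@summ_bound _ _ _ 0) => s us.
  by rewrite big1// => j _; rewrite /sqs rnorm0 expr0n normr0.
move=> a x y /asboolP xs /asboolP ys; apply/asboolP.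
apply: (@summ_nneg _ (fun j => 2 * (complex.Re `|a| ^+ 2 * sqs x j + sqs y j))).
  by move=> j; rewrite sqs_ge0 sqs_comb.
by apply: summZ; apply: summD => //; exact: summZ.
Qed.

HB.instance Definition _ := GRing.isSubmodClosed.Build R[i] (J -> H) l2pred l2_submod.

(** [J] is an arbitrary choice type: it will be the directed set of a rigging, which may be
    uncountable. *)
Record l2 := L2 { l2f :> J -> H; l2fP : l2f \in l2pred }.

Implicit Types x y : l2.

HB.instance Definition _ := [isSub for l2f].
HB.instance Definition _ := [Choice of l2 by <:].
HB.instance Definition _ := [SubChoice_isSubLmodule of l2 by <:].

Lemma l2P (x : l2) : summ (sqs x). Proof. exact/asboolP/l2fP. Qed.

Lemma l2_eq (x y : l2) : (forall j, x j = y j) -> x = y.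
Proof. by move=> xy; apply/val_inj/funext. Qed.

Definition l2dot (x y : l2) : R[i] :=
  tsum (fun j => complex.Re (dot H (x j) (y j))) +i*
  tsum (fun j => complex.Im (dot H (x j) (y j))).

Lemma abs_rdot (x y : H) : `|rdot x y| <= rnorm x * rnorm y.
Proof.
rewrite ler_norml rdot_le andbT lerNl -rdotNl (le_trans (rdot_le _ _))// rnormN//.
Qed.

Lemma l2_summRe (x y : l2) : summ (fun j => complex.Re (dot H (x j) (y j))).
Proof.
apply: (summ_le (f := fun j => sqs x j + sqs y j)) => [j|].
  apply: le_trans (abs_rdot _ _) _; rewrite /sqs.
  by have := rnorm_ge0 (x j); have := rnorm_ge0 (y j); nra.
rewrite nsumD; [|exact: sqs_ge0|exact: sqs_ge0].
rewrite -!tsum_ge0E; [|exact: sqs_ge0|exact: l2P|exact: sqs_ge0|exact: l2P].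
by rewrite -EFinD ltry.
Qed.

Lemma l2_summIm (x y : l2) : summ (fun j => complex.Im (dot H (x j) (y j))).
Proof.
have := summZ (-1) (l2_summRe ('i *: x) y); congr summ; apply/funext => j.
by rewrite dot_Im mulN1r.
Qed.

Lemma l2dot_comb (a b : R) (x x' y z : l2) :
  (forall j, z j = (a +i* b) *: x j + x' j) ->
  l2dot z y = (a +i* b) * l2dot x y + l2dot x' y.
Proof.
move=> zE.
have E j : dot H (z j) (y j) = (a +i* b) * dot H (x j) (y j) + dot H (x' j) (y j).
  by rewrite zE linearDl linearZl_LR.
have h1 := @tsum_comb3 _ _ a (- b) _ _ _ (fun j => complex.Re (dot H (z j) (y j)))
  (l2_summRe x y) (l2_summIm x y) (l2_summRe x' y).
have h2 := @tsum_comb3 _ _ a b _ _ _ (fun j => complex.Im (dot H (z j) (y j)))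
  (l2_summIm x y) (l2_summRe x y) (l2_summIm x' y).
rewrite /l2dot h1 ?h2.
- by apply/eqP; rewrite eq_complex /=; apply/andP; split; apply/eqP; ring.
- by move=> j; rewrite E; case: (dot H (x j) _) (dot H (x' j) _) => p q [p' q'] /=; ring.
- by move=> j; rewrite E; case: (dot H (x j) _) (dot H (x' j) _) => p q [p' q'] /=; ring.
Qed.

Lemma l2dot_linl (y : l2) : linear_for *%R (l2dot^~ y).
Proof. by move=> [a b] x x'; exact: l2dot_comb. Qed.

Lemma l2dotC : forall (x y : l2), l2dot x y = (-1) ^+ false * Num.conj (l2dot y x).
Proof.
move=> x y; rewrite expr0 mul1r /l2dot.
have -> : tsum (fun j => complex.Re (dot H (x j) (y j))) = tsum (fun j => complex.Re (dot H (y j) (x j))).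
  by congr tsum; apply/funext => j; exact: rdotC.
have -> : tsum (fun j => complex.Im (dot H (x j) (y j))) = - tsum (fun j => complex.Im (dot H (y j) (x j))).
  rewrite -tsumN; last exact: l2_summIm.
  by congr tsum; apply/funext => j; rewrite dotC; case: (dot H (y j) _).
by [].
Qed.

Lemma l2dot_linr (x : l2) : linear_for (Num.conj \; *%R) (l2dot x).
Proof.
move=> a y y'; rewrite l2dotC expr0 mul1r (l2dot_linl x) rmorphD rmorphM /=.
by rewrite (l2dotC x y) (l2dotC x y') !expr0 !mul1r.
Qed.

Definition l2sq (x : l2) : R := tsum (sqs x).

Lemma l2sq_ge0 x : 0 <= l2sq x.
Proof. by apply: tsum_ge0; [exact: sqs_ge0|exact: l2P]. Qed.

Lemma l2dotxx x : l2dot x x = (l2sq x)%:C.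
Proof.
apply/eqP; rewrite eq_complex /=; apply/andP; split; apply/eqP.
  by congr tsum; apply/funext => j; exact: rdotxx.
transitivity (tsum (fun _ : J => 0 * 0 : R)).
  congr tsum; apply/funext => j; rewrite mul0r.
  by rewrite -dot_norm rnormE -rmorphXn.
rewrite tsumZ ?mul0r//; apply: (@summ_bound _ _ _ 0) => s _.
by rewrite big1// => j _; rewrite normr0.
Qed.

Lemma sum_sqs_le (x : l2) (s : seq J) : uniq s -> \sum_(j <- s) rnorm (x j) ^+ 2 <= l2sq x.
Proof. by move=> us; apply: le_tsum => //; [exact: sqs_ge0|exact: l2P]. Qed.

Lemma sqs_le (x : l2) j : rnorm (x j) ^+ 2 <= l2sq x.
Proof. by have := sum_sqs_le x (isT : uniq [:: j]); rewrite big_seq1. Qed.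

Lemma l2sq_le (x : l2) M :
  (forall s : seq J, uniq s -> \sum_(j <- s) rnorm (x j) ^+ 2 <= M) -> l2sq x <= M.
Proof. by move=> xM; apply: (tsum_le _ _).2 => //; exact: sqs_ge0. Qed.

Lemma l2sq_eq0 (x : l2) : l2sq x = 0 -> x = 0.
Proof.
move=> x0; apply: l2_eq => j; apply: rnorm0_eq0; apply/eqP.
by rewrite -sqrf_eq0 eq_le sqr_ge0 andbT -x0 sqs_le.
Qed.

Lemma l2sqZ a (x : l2) : l2sq (a *: x) = complex.Re `|a| ^+ 2 * l2sq x.
Proof.
rewrite /l2sq -tsumZ; last exact: l2P.
by congr tsum; apply/funext => j; rewrite /sqs /= rnormZ exprMn.
Qed.

Definition l2norm (x : l2) : R := Num.sqrt (l2sq x).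

Lemma l2norm_ge0 x : 0 <= l2norm x. Proof. exact: sqrtr_ge0. Qed.

Lemma l2normK x : l2norm x ^+ 2 = l2sq x.
Proof. by rewrite sqr_sqrtr// l2sq_ge0. Qed.

Lemma l2norm_eq0 x : l2norm x = 0 -> x = 0.
Proof. by move=> x0; apply: l2sq_eq0; rewrite -l2normK x0 expr0n. Qed.

(** Minkowski on finite partial sums, with the weights [1 + d / c] and [1 + c / d] fixed by the two
    norms, for which the final bound is exactly [(c + d) ^+ 2]. *)
Lemma l2normD x y : l2norm (x + y) <= l2norm x + l2norm y.
Proof.
have [x0|x0] := eqVneq (l2norm x) 0; first by rewrite (l2norm_eq0 x0) add0r lerDr l2norm_ge0.
have [y0|y0] := eqVneq (l2norm y) 0; first by rewrite (l2norm_eq0 y0) addr0 lerDl l2norm_ge0.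
have {x0}c0 : 0 < l2norm x by rewrite lt_neqAle eq_sym x0 l2norm_ge0.
have {y0}d0 : 0 < l2norm y by rewrite lt_neqAle eq_sym y0 l2norm_ge0.
rewrite -(@ler_pXn2r _ 2)// ?nnegrE ?addr_ge0 ?l2norm_ge0// l2normK.
move: (l2normK x) (l2normK y) c0 d0; set c := l2norm x; set d := l2norm y => cE dE c0 d0.
have dc : 0 <= d / c by rewrite divr_ge0 ?ltW.
have cd : 0 <= c / d by rewrite divr_ge0 ?ltW.
apply: l2sq_le => s us.
apply: (@le_trans _ _ ((1 + d / c) * (\sum_(j <- s) rnorm (x j) ^+ 2) +
   (1 + c / d) * (\sum_(j <- s) rnorm (y j) ^+ 2))); last first.
  apply: le_trans (lerD (ler_wpM2l (addr_ge0 ler01 dc) (sum_sqs_le x us))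
     (ler_wpM2l (addr_ge0 ler01 cd) (sum_sqs_le y us))) _.
  by rewrite -cE -dE le_eqVlt; apply/orP; left; apply/eqP; field; rewrite !gt_eqF.
rewrite !mulr_sumr -big_split /=; apply: ler_sum => j _.
have := @lerXn2r _ 2 _ _ (rnorm_ge0 _) (addr_ge0 (rnorm_ge0 _) (rnorm_ge0 _)) (rnormD (x j) (y j)).
move=> h; apply: le_trans h _.
move: (rnorm (x j)) (rnorm (y j)) => p q.
rewrite -subr_ge0.
have -> : (1 + d / c) * p ^+ 2 + (1 + c / d) * q ^+ 2 - (p + q) ^+ 2 =
  (d * p - c * q) ^+ 2 / (c * d) by field; rewrite !gt_eqF.
by rewrite divr_ge0 ?sqr_ge0// mulr_ge0// ltW.
Qed.

Lemma l2norm_ler_normD (x y : l2) : (l2norm (x + y))%:C <= (l2norm x)%:C + (l2norm y)%:C :> R[i].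
Proof. by rewrite -rmorphD lecR l2normD. Qed.

Lemma l2norm_normrZ (a : R[i]) (x : l2) : (l2norm (a *: x))%:C = `|a| * (l2norm x)%:C.
Proof.
rewrite /l2norm l2sqZ sqrtrM ?sqr_ge0// sqrtr_sqr ger0_norm// rmorphM; congr (_ * _).
Qed.

Lemma l2norm_normr0_eq0 (x : l2) : (l2norm x)%:C = 0 :> R[i] -> x = 0.
Proof. by move=> /eqP; rewrite eq_complex /= eqxx andbT => /eqP/l2norm_eq0. Qed.

HB.instance Definition _ :=
  Lmodule_isNormed.Build R[i] l2 l2norm_ler_normD l2norm_normrZ l2norm_normr0_eq0.

Lemma rnorm_l2 (x : l2) : rnorm x = l2norm x.
Proof. by []. Qed.

Lemma rnorm_l2sq (x : l2) : rnorm x ^+ 2 = l2sq x.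
Proof. by rewrite rnorm_l2 l2normK. Qed.

(** The limit is taken coordinatewise; [zs] makes the estimates uniform over finite sets of
    coordinates. *)
Lemma l2_cauchy_cvg (F : set_system l2) : ProperFilter F -> cauchy F -> cvg F.
Proof.
move=> FF Fc.
have Fe (e : R) : 0 < e -> exists x0 : l2, \forall x \near F, rnorm (x - x0) <= e.
  move=> e0; have eC : 0 < e%:C :> R[i] by rewrite ltcR.
  have [x0 Fx0] := (cauchyP F).1 Fc _ eC; exists x0.
  by apply: filterS Fx0 => x; rewrite /= -ball_normE /= rnormE ltcR rnormBC => /ltW.
have comp (x : l2) j : rnorm (x j) <= rnorm x.
  by rewrite -(@ler_pXn2r _ 2)// ?nnegrE// rnorm_l2sq sqs_le.
have /choice[z zP] : forall j, exists z, ncvg F (fun x : l2 => x j) z.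
  move=> j; apply: ncvg_cauchy => e e0; have [x0 Fx0] := Fe _ e0; exists (x0 j).
  by apply: filterS Fx0 => x; apply: le_trans; exact: comp (x - x0) j.
(* Some [x] is close to [x0] in norm and close to [z] on the finitely many coordinates of [s],
   whence the factor 2. *)
have zs (e : R) (x0 : l2) : 0 < e -> (\forall x \near F, rnorm (x - x0) <= e) ->
    forall s : seq J, uniq s -> \sum_(j <- s) rnorm (z j - x0 j) ^+ 2 <= (2 * e) ^+ 2.
  move=> e0 Fx0 s us.
  (* With this [d] the [size s] terms [d ^+ 2] add up to at most [e ^+ 2]. *)
  pose d := e / (size s).+1%:R; have d0 : 0 < d by rewrite divr_gt0.
  have : \forall x \near F, forall j, j \in s -> rnorm ((x : l2) j - z j) <= d.
    elim: (s) => [|j s' IH]; first by near=> x.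
    have h : \forall x \near F, rnorm ((x : l2) j - z j) <= d by exact: zP.
    apply: filterS2 h IH => x hj hs j'; rewrite inE => /orP[/eqP -> //|]; exact: hs.
  move=> h; have [x [xz xx0]] := filter_ex (filterI h Fx0).
  apply: (@le_trans _ _ (\sum_(j <- s) 2 * (rnorm (x j - z j) ^+ 2 + rnorm ((x - x0) j) ^+ 2))).
    apply: ler_sum => j _; have := rnorm_triangle (x j) (z j) (x0 j).
    rewrite (rnormBC _ (x j)); set p := rnorm (z j - x0 j).
    set q := rnorm (x j - z j); set r := rnorm (x j - x0 j) => pqr.
    have h2 : p ^+ 2 <= (q + r) ^+ 2 by apply: lerXn2r; rewrite ?nnegrE ?addr_ge0 ?rnorm_ge0.
    by apply: (le_trans h2); have := sqr_ge0 (q - r); nra.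
  rewrite -mulr_sumr big_split /=.
  have h1 : \sum_(j <- s) rnorm ((x - x0) j) ^+ 2 <= e ^+ 2.
    apply: le_trans (sum_sqs_le _ us) _; rewrite -rnorm_l2sq.
    by apply: lerXn2r; rewrite ?nnegrE ?(ltW e0).
  have h2 : \sum_(j <- s) rnorm (x j - z j) ^+ 2 <= e ^+ 2.
    apply: (@le_trans _ _ (\sum_(j <- s) d ^+ 2)).
      rewrite big_seq [leRHS]big_seq; apply: ler_sum => j js.
      by apply: lerXn2r; rewrite ?nnegrE ?(ltW d0)//; exact: xz.
    rewrite big_const_seq count_predT iter_addr_0 -mulr_natl /d exprMn mulrCA.
    rewrite ler_piMr ?sqr_ge0// exprVn ler_pdivrMr ?exprn_gt0// mul1r -natrX ler_nat.
    by rewrite (leq_trans (leqnSn _))// -mulnn leq_pmulr.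
  by rewrite exprMn; lra.
have [x1 Fx1] := Fe 1 ltr01.
have zl2 : z \in l2pred.
  have -> : z = (z - x1) + x1 by rewrite subrK.
  rewrite rpredD//; last exact: l2fP.
  apply/asboolP; apply: (@summ_bound _ _ _ ((2 * 1) ^+ 2)) => s us.
  under eq_bigr do rewrite ger0_norm ?sqs_ge0//.
  exact: zs.
apply/cvg_ex; exists (L2 zl2).
apply: (proj2 (@ncvgP R l2 l2 F _ id (L2 zl2))) => e e0.
have e3 : 0 < e / 3 by rewrite divr_gt0.
have [x0 Fx0] := Fe _ e3.
apply: filterS (Fx0) => x xx0; apply: le_trans (rnorm_triangle x0 _ _) _.
have h : rnorm (x0 - L2 zl2) <= 2 * (e / 3).
  rewrite -(@ler_pXn2r _ 2)// ?nnegrE//; last by rewrite mulr_ge0// ltW.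
  rewrite rnormBC rnorm_l2sq; apply: l2sq_le => s us; exact: zs.
by apply: le_trans (lerD xx0 h) _; lra.
Unshelve. all: by end_near. Qed.

HB.instance Definition _ := Uniform_isComplete.Build l2 l2_cauchy_cvg.

Lemma l2dot_bilinear : bilinear_for ( *%R : GRing.Scale.law R[i] R[i])
    (Num.conj \; *%R : GRing.Scale.law R[i] R[i]) l2dot.
Proof. by split; [exact: l2dot_linl|exact: l2dot_linr]. Qed.

HB.instance Definition _ := bilinear_isBilinear.Build R[i] l2 l2 R[i] _ _ l2dot l2dot_bilinear.
HB.instance Definition _ := isHermitianSesquilinear.Build R[i] l2 false Num.conj l2dot l2dotC.

Lemma l2dot_gt0 (x : l2) : x != 0 -> 0 < l2dot x x.
Proof.
move=> x0; rewrite l2dotxx ltcR lt_neqAle l2sq_ge0 andbT eq_sym.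
by apply: contra x0 => /eqP/l2sq_eq0/eqP.
Qed.

HB.instance Definition _ := isDotProduct.Build R[i] l2 l2dot l2dot_gt0.

Lemma l2dot_norm (x : l2) : `|x| ^+ 2 = l2dot x x.
Proof. by rewrite rnormE -rmorphXn rnorm_l2sq l2dotxx. Qed.

Definition l2hilbert : hilbert R := @Hilbert R l2 l2dot l2dot_norm.

End L2.

(** * Closed spaces of operators *)

Section OperatorSpaces.
Context {R : realType}.
Implicit Types H K L : hilbert R.

Definition opcvg H K (I : Type) (F : set_system I) (T : I -> H -> K) (T0 : H -> K) : Prop :=
  unif_cvg (@rnorm R H) (@rnorm R K) F T T0.

Lemma opcvg_pt H K (I : Type) (F : set_system I) {FF : Filter F} (T : I -> H -> K) T0 x :
  opcvg F T T0 -> ncvg F (fun i => T i x) (T0 x).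
Proof.
move=> TT0 e e0; have d0 : 0 < e / (rnorm x + 1) by rewrite divr_gt0// ltr_wpDl.
apply: filterS (TT0 _ d0) => i /(_ x) /le_trans; apply.
rewrite mulrAC ler_pdivrMr ?ltr_wpDl// mulrDr mulr1 lerDl; exact: ltW.
Qed.

(** Completeness in operator norm. Each [e] has its own centre [S], which spares estimates between
    two members of the net. *)
Lemma opcvg_lim H K (I : Type) (F : set_system I) {FF : ProperFilter F} (T : I -> H -> K) :
  (forall e : R, 0 < e -> exists S : H -> K, \forall i \near F, opbd (T i - S) e) ->
  exists T0, opcvg F T T0.
Proof.
move=> TC.
have /choice[T0 T0P] : forall x, exists y, ncvg F (fun i => T i x) y.
  move=> x; apply: ncvg_cauchy => e e0.
  have d0 : 0 < e / (rnorm x + 1) by rewrite divr_gt0// ltr_wpDl.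
  have [S hS] := TC _ d0; exists (S x).
  apply: filterS hS => i /(_ x) /le_trans; apply.
  rewrite mulrAC ler_pdivrMr ?ltr_wpDl// mulrDr mulr1 lerDl; exact: ltW.
exists T0 => e e0; have e2 : 0 < e / 2 by rewrite divr_gt0.
have [S hS] := TC _ e2.
have h x : rnorm (S x - T0 x) <= e / 2 * rnorm x.
  apply: (@rnorm_lim_le _ _ _ F _ (fun i => S x - T i x)).
    by move=> d d0; apply: filterS (T0P x _ d0) => i; rewrite opprB [X in _ -> rnorm X <= _]addrC subrKA rnormBC.
  by apply: filterS hS => i /(_ x); rewrite rnormBC.
apply: filterS hS => i hi x; apply: le_trans (rnorm_triangle (S x) _ _) _.
by apply: le_trans (lerD (hi x) (h x)) _; rewrite -mulrDl -splitr.
Qed.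

Lemma opcvg_linear H K (I : Type) (F : set_system I) {FF : ProperFilter F} (T : I -> H -> K) T0 :
  (forall i, linear (T i)) -> opcvg F T T0 -> linear T0.
Proof.
move=> Tl TT0 a x y; apply: (@ncvg_unique _ _ _ F _ (fun i => T i (a *: x + y))).
  exact: opcvg_pt TT0.
rewrite (_ : (fun i => _) = (fun i => a *: T i x + T i y)); last by apply/funext => i; rewrite Tl.
by apply: ncvgD; [apply: ncvgZ|]; exact: opcvg_pt TT0.
Qed.

Lemma opcvg_bounded H K (I : Type) (F : set_system I) {FF : ProperFilter F} (T : I -> H -> K) T0 :
  (forall i, bounded_op (T i)) -> opcvg F T T0 -> bounded_op T0.
Proof.
move=> Tb TT0; split; first by apply: opcvg_linear TT0 => i; exact: bounded_lin.
have [i hi] := filter_ex (TT0 _ ltr01).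
have /bounded_opP[_ [c c0 Tc]] := Tb i; exists (c + 1) => x.
have -> : T0 x = T i x - (T i x - T0 x) by rewrite opprB addrCA subrr addr0.
by apply: le_trans (rnormD _ _) _; rewrite rnormN mulrDl lerD.
Qed.

Lemma mxbd_inf (I J : finType) H K (T : I -> J -> H -> K) c : 0 <= c ->
  (forall e : R, 0 < e -> mxbd T (c + e)) -> mxbd T c.
Proof.
move=> c0 Tc xi; set s := \sum_j rnorm (xi j) ^+ 2.
have s0 : 0 <= s by exact: sumsq_ge0.
apply/ler_addgt0Pl => d d0.
have k0 : 0 < (2 * c + 1) * s + 1.
  by have := mulr_ge0 c0 s0; nra.
(* For [e] at most 1 the increment [(c + e)^2 - c^2] is at most [e (2 c + 1)]. *)
pose e := Num.min 1 (d / ((2 * c + 1) * s + 1)).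
have e0 : 0 < e by rewrite lt_min ltr01 divr_gt0.
have e1 : e <= 1 by rewrite ge_min lexx.
have e2 : e * ((2 * c + 1) * s + 1) <= d by rewrite -ler_pdivlMr// ge_min lexx orbT.
apply: le_trans (Tc _ e0 xi) _; rewrite -/s.
have -> : (c + e) ^+ 2 * s = c ^+ 2 * s + e * (2 * c + e) * s by ring.
rewrite addrC lerD2r; apply: le_trans e2; rewrite -mulrA ler_wpM2l ?(ltW e0)//.
have : (2 * c + e) * s <= (2 * c + 1) * s by rewrite ler_wpM2r// lerD2l.
lra.
Qed.

Lemma mxbd_opcvg (I J : finType) H K (X : Type) (F : set_system X) {FF : ProperFilter F}
    (T : X -> I -> J -> H -> K) (T0 : I -> J -> H -> K) c : 0 <= c ->
  (forall x, mxbd (T x) c) -> (forall i j, opcvg F (fun x => T x i j) (T0 i j)) -> mxbd T0 c.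
Proof.
move=> c0 Tc TT0; apply: mxbd_inf => // e e0.
pose C := Num.sqrt #|I|%:R * #|J|%:R + 1 : R.
have C0 : 0 < C by rewrite ltr_wpDl// mulr_ge0// sqrtr_ge0.
have d0 : 0 < e / 2 / C by rewrite !divr_gt0.
have [x hx] : exists x, forall i j, opbd (T0 i j - T x i j) (e / 2 / C).
  apply: (@filter_ex _ F); apply: filter_forall => i; apply: filter_forall => j.
  by apply: filterS (TT0 i j _ d0) => x hx h; rewrite rnormBC.
have h1 := mxbd_entries (ltW d0) hx.
have h2 : mxbd (fun i j => T0 i j - T x i j) (e / 2).
  apply: mxbd_le h1; first by rewrite mulr_ge0 ?(ltW d0)// mulr_ge0 ?sqrtr_ge0.
  by rewrite mulrCA ler_piMr ?divr_ge0 ?(ltW e0)// ler_pdivrMr// mul1r lerDl.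
have ce : 0 < c + e / 2 by rewrite ltr_wpDl// divr_gt0//.
have h3 : mxbd (T x) (c + e / 2) by apply: mxbd_le (Tc x) => //; rewrite lerDl divr_ge0// (ltW e0).
have e2 : 0 < e / 2 by rewrite divr_gt0.
have := mxbdD ce e2 h3 h2; rewrite -addrA -splitr.
by apply: mxbd_eq => i j h; rewrite addrC -[RHS](subrK (T x i j h)).
Qed.

(** Closed subspaces serve as induction predicates: by [clspan_min] a property that is linear and
    closed need only be checked on generators. *)
Definition clsub H K (N : set (H -> K)) : Prop :=
  [/\ N 0, forall (c : R[i]) S T, N S -> N T -> N (c *: S + T) & norm_closure N `<=` N].

Lemma sub_norm_closure H K (M : set (H -> K)) : M `<=` norm_closure M.
Proof. by move=> S MS e e0; exists S => // x; rewrite subrr rnorm0 mulr_ge0// ltW. Qed.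

Lemma norm_closureS H K (M N : set (H -> K)) : M `<=` N -> norm_closure M `<=` norm_closure N.
Proof. by move=> MN T MT e /MT[S /MN NS TS]; exists S. Qed.

Lemma norm_closureK H K (M : set (H -> K)) : norm_closure (norm_closure M) `<=` norm_closure M.
Proof.
move=> T MT e e0; have e2 : 0 < e / 2 by rewrite divr_gt0.
have [S MS TS] := MT _ e2; have [S' MS' SS'] := MS _ e2; exists S' => // x.
apply: le_trans (rnorm_triangle (S x) _ _) _.
by apply: le_trans (lerD (TS x) (SS' x)) _; rewrite -mulrDl -splitr.
Qed.

Lemma opcvg_closure H K (I : Type) (F : set_system I) {FF : ProperFilter F} (M : set (H -> K))
    (T : I -> H -> K) T0 :
  (\forall i \near F, M (T i)) -> opcvg F T T0 -> norm_closure M T0.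
Proof.
move=> MT TT0 e e0; have [i [Mi Ti]] := filter_ex (filterI MT (TT0 _ e0)).
by exists (T i) => // x; rewrite rnormBC.
Qed.

Lemma norm_closure_comb H K (M : set (H -> K)) :
  (forall (c : R[i]) S T, M S -> M T -> M (c *: S + T)) ->
  forall (c : R[i]) S T, norm_closure M S -> norm_closure M T -> norm_closure M (c *: S + T).
Proof.
move=> Ml c S T MS MT e e0.
pose n := complex.Re `|c|; have n0 : 0 <= n by exact: Re_norm_ge0.
have d0 : 0 < e / (n + 1) by rewrite divr_gt0// ltr_wpDl.
have [S' MS' hS] := MS _ d0; have [T' MT' hT] := MT _ d0.
exists (c *: S' + T'); first exact: Ml.
move=> x; rewrite !lin_combE opprD addrACA -scalerBr.
apply: le_trans (rnormD _ _) _; rewrite rnormZ.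
apply: le_trans (lerD (ler_wpM2l n0 (hS x)) (hT x)) _.
rewrite -/n le_eqVlt; apply/orP; left; apply/eqP; field.
by rewrite gt_eqF// ltr_wpDl.
Qed.

Lemma lspan_comb H K (M : set (H -> K)) (c : R[i]) S T :
  lspan M S -> lspan M T -> lspan M (c *: S + T).
Proof.
move=> [m [a [P [MP ->]]]] [n [b [Q [MQ ->]]]].
exists (m + n)%N, (fun i => match fintype.split i with inl j => c * a j | inr j => b j end),
  (fun i => match fintype.split i with inl j => P j | inr j => Q j end); split.
  by move=> i; case: fintype.split => j.
rewrite big_split_ord /= scaler_sumr; congr (_ + _); apply: eq_bigr => i _.
  by rewrite (unsplitK (inl i)) scalerA.
by rewrite (unsplitK (inr i)).
Qed.

Lemma sub_lspan H K (M : set (H -> K)) : M `<=` lspan M.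
Proof.
move=> S MS; exists 1%N, (fun=> 1), (fun=> S); split => //.
by rewrite big_ord1 scale1r.
Qed.

Lemma lspan0 H K (M : set (H -> K)) : lspan M 0.
Proof. by exists 0%N, (fun=> 0), (fun=> 0); split; [case|rewrite big_ord0]. Qed.

Lemma lspan_min H K (M N : set (H -> K)) : N 0 ->
  (forall (c : R[i]) S T, N S -> N T -> N (c *: S + T)) -> M `<=` N -> lspan M `<=` N.
Proof.
move=> N0 Nl MN _ [n [c [S [MS ->]]]].
elim: n c S MS => [|n IH] c S MS; first by rewrite big_ord0.
rewrite big_ord_recl; apply: Nl; first exact: MN.
by apply: IH => i; exact: MS.
Qed.

Lemma clspan_clsub H K (M : set (H -> K)) : clsub (clspan M).
Proof.
split; first exact/sub_norm_closure/lspan0.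
  by apply: norm_closure_comb => *; exact: lspan_comb.
exact: norm_closureK.
Qed.

Lemma sub_clspan H K (M : set (H -> K)) : M `<=` clspan M.
Proof. by move=> S /sub_lspan; exact: sub_norm_closure. Qed.

Lemma clspan_min H K (M N : set (H -> K)) : clsub N -> M `<=` N -> clspan M `<=` N.
Proof.
move=> [N0 Nl Nc] MN T MT; apply: Nc; apply: norm_closureS MT.
exact: lspan_min.
Qed.

Lemma clsub_sum H K (N : set (H -> K)) : clsub N ->
  forall n (T : 'I_n -> H -> K), (forall i, N (T i)) -> N (\sum_(i < n) T i).
Proof.
move=> [N0 Nl _]; elim=> [|n IH] T NT; first by rewrite big_ord0.
by rewrite big_ord_recl -[T _]scale1r; apply: Nl; [exact: NT|apply: IH => i; exact: NT].
Qed.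

Lemma clsub_lim H K (N : set (H -> K)) (I : Type) (F : set_system I) {FF : ProperFilter F}
    (T : I -> H -> K) T0 : clsub N -> (\forall i \near F, N (T i)) -> opcvg F T T0 -> N T0.
Proof. by move=> [_ _ Nc] NT TT0; apply: Nc; exact: opcvg_closure TT0. Qed.

Lemma clsub_compr H K L (N : set (H -> L)) (X : H -> K) : bounded_op X ->
  clsub N -> clsub [set S : K -> L | N (S \o X)].
Proof.
move=> /bounded_opP[Xl [d d0 Xd]] [N0 Nl Nc]; split => //=.
  by move=> c S T NS NT; exact: (Nl c _ _ NS NT).
move=> T MT; apply: Nc => e e0.
have d1 : 0 < e / (d + 1) by rewrite divr_gt0// ltr_wpDl.
have [S NS TS] := MT _ d1; exists (S \o X) => // x.
apply: le_trans (TS _) _; apply: le_trans (ler_wpM2l (ltW d1) (Xd x)) _.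
rewrite mulrA ler_wpM2r// mulrAC ler_pdivrMr ?ltr_wpDl//.
by rewrite ler_wpM2l ?(ltW e0)// lerDl.
Qed.

Lemma clsub_compl H K L (N : set (H -> L)) (X : K -> L) : bounded_op X ->
  clsub N -> clsub [set S : H -> K | N (X \o S)].
Proof.
move=> /bounded_opP[Xl [d d0 Xd]] [N0 Nl Nc]; split => /=.
- suff -> : X \o (0 : H -> K) = 0 by [].
  by apply/funext => x; rewrite /= (linf0 Xl).
- move=> c S T NS NT; have := Nl c _ _ NS NT; congr N.
  by apply/funext => x; rewrite /= !lin_combE /= Xl.
move=> T MT; apply: Nc => e e0.
have d1 : 0 < e / (d + 1) by rewrite divr_gt0// ltr_wpDl.
have [S NS TS] := MT _ d1; exists (X \o S) => // x.
rewrite /= -(linfB Xl); apply: le_trans (Xd _) _; apply: le_trans (ler_wpM2l d0 (TS x)) _.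
rewrite mulrA ler_wpM2r// mulrCA ler_piMr ?(ltW e0)//.
by rewrite ler_pdivrMr ?ltr_wpDl// mul1r lerDl.
Qed.

Lemma clsub_bounded H K : clsub (@bounded_op R H K).
Proof.
split; [exact: bounded0|by move=> *; exact: bounded_linear_comb|].
move=> T MT.
have /choice[S SP] : forall n : nat, exists S : H -> K, bounded_op S /\
    forall x, rnorm (T x - S x) <= n.+1%:R^-1 * rnorm x.
  move=> n; have n0 : 0 < n.+1%:R^-1 :> R by rewrite invr_gt0.
  by have [S ? ?] := MT _ n0; exists S.
apply: (@opcvg_bounded _ _ _ \oo _ S) => [n|e e0]; first by case: (SP n).
exists (Num.truncn e^-1) => // n /= Nn x; rewrite rnormBC.
have [_ /(_ x) /le_trans] := SP n; apply; apply: ler_wpM2r => //.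
rewrite invf_ple ?posrE//; apply/ltW/(lt_le_trans (Num.Theory.truncnS_gt _)).
by rewrite ler_nat ltnS.
Qed.

(** The range of a complete isometry is closed since [X] is complete: preimages of an approximating
    sequence are Cauchy. *)
Lemma repr_clsub (X : opSpace R) H K (u : {linear X -> (H -> K)}) :
  is_repr (osnorm X) u -> clsub (range u).
Proof.
move=> hu; split.
- by exists 0 => //; rewrite linear0.
- by move=> c _ _ [x _ <-] [y _ <-]; exists (c *: x + y) => //; rewrite linearP.
move=> T MT.
have /choice[x xP] : forall n : nat, exists x, forall z, rnorm (T z - u x z) <= n.+1%:R^-1 * rnorm z.
  move=> n; have n0 : 0 < n.+1%:R^-1 :> R by rewrite invr_gt0.
  by have [_ [x _ <-] ?] := MT _ n0; exists x.
have small (e : R) : 0 < e -> exists N, forall n, (N <= n)%N -> n.+1%:R^-1 <= e.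
  move=> e0; exists (Num.truncn e^-1) => n Nn.
  rewrite invf_ple ?posrE//; apply/ltW/(lt_le_trans (Num.Theory.truncnS_gt _)).
  by rewrite ler_nat ltnS.
have [l xl] : exists l, ncvg \oo x l.
  apply: ncvg_cauchy => e e0; have e2 : 0 < e / 2 by rewrite divr_gt0.
  have [N NP] := small _ e2; exists (x N); exists N => // n /= Nn.
  apply/(repr_opbd hu); first exact: ltW.
  move=> z; rewrite linearB /=; apply: le_trans (rnorm_triangle (T z) _ _) _.
  rewrite (rnormBC _ (T z)); apply: le_trans (lerD (xP n z) (xP N z)) _.
  rewrite -mulrDl ler_wpM2r// [e]splitr lerD//; exact: NP.
exists l => //; apply/funext => z.
apply: (@ncvg_unique _ _ _ \oo _ (fun n => u (x n) z)).
  apply: (@opcvg_pt _ _ _ _ _ (fun n => u (x n))) => e /xl; apply: filterS => n.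
  move=> h0 w; have e0 : 0 <= e by exact: le_trans (rnorm_ge0 _) h0.
  by have /(repr_opbd hu _ e0)/(_ w) := h0; rewrite linearB.
apply: (@opcvg_pt _ _ _ _ _ (fun n => u (x n))) => e /small[N NP]; exists N => // n /= Nn w.
by rewrite rnormBC; apply: le_trans (xP n w) _; rewrite ler_wpM2r// NP.
Qed.

(** Taking adjoints exchanges the left and the right sequence. *)
Lemma adjs_sigmaTRO H K (M : set (H -> K)) : is_sigmaTRO M -> is_sigmaTRO (adjs M).
Proof.
move=> [[Mb M0 Ml Mm] Mc [m [mM mc m1]] [n [nM nc n1]]].
have bm T : M T -> bounded_op T by exact: Mb.
have bs (k : nat -> H -> K) i : (forall i, M (k i)) -> bounded_op (adj (k i) \o k i).
  by move=> kM; apply: bounded_comp; [apply: bounded_adj|]; exact: bm.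
have bs' (k : nat -> H -> K) i : (forall i, M (k i)) -> bounded_op (k i \o adj (k i)).
  by move=> kM; apply: bounded_comp; [|apply: bounded_adj]; exact: bm.
split.
- split.
  + by move=> _ [T /bm MT <-]; exact: bounded_adj.
  + by exists 0 => //; rewrite adj0.
  + move=> c _ _ [S MS <-] [T MT <-]; exists (Num.conj c *: S + T); first exact: Ml.
    by rewrite adj_linear_comb ?conjCK//; exact: bm.
  + move=> _ [_ [_ [T MT <-] [_ [_ [T' MT' <-] <-] <-]] [_ [T'' MT'' <-] <-]].
    have [bT [bT' bT'']] := (bm _ MT, (bm _ MT', bm _ MT'')).
    exists (T'' \o adj T' \o T).
      by apply: Mm; exists (T'' \o adj T'); [exists T'' => //; exists (adj T') => //; exists T'|exists T].
    rewrite adjK//.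
    rewrite (adj_comp (bounded_comp bT'' (bounded_adj bT')) bT) (adj_comp bT'' (bounded_adj bT')).
    by rewrite adjK.
- move=> T MT; have bT : bounded_op T.
    have [_ _ bc] := clsub_bounded K H; apply: bc; apply: norm_closureS MT.
    by move=> _ [S /bm bS <-]; exact: bounded_adj.
  exists (adj T); last by rewrite adjK.
  apply: Mc => e e0; have [_ [S MS <-] hS] := MT _ e0; exists S => // x.
  have bS := bm _ MS; have := adj_opbd (boundedB bT (bounded_adj bS)) (ltW e0) hS x.
  by rewrite adjB ?adjK//; exact: bounded_adj.
- exists (fun i => adj (n i)); split.
  + by move=> i; exists (n i).
  + move=> _ [T MT <-] e e0; apply: filterS (nc _ MT _ e0) => k hk x.
    have bS : bounded_op (\sum_(i < k) (adj (n i) \o n i)) by apply: bounded_sum => i _; exact: bs.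
    have bT := bm _ MT.
    have := adj_opbd (boundedB (bounded_comp bT bS) bT) (ltW e0) hk x.
    rewrite (adjB (bounded_comp bT bS) bT) (adj_comp bT bS) adj_sum; last by move=> i _; exact: bs.
    have -> // : \sum_(i < k) adj (adj (n i) \o n i) = \sum_(i < k) (adj (n i) \o adj (adj (n i))).
    apply: eq_bigr => i _; have bn := bm _ (nM i).
    by rewrite (adj_comp (bounded_adj bn) bn).
  + move=> k x.
    have -> : \sum_(i < k) (adj (n i) \o adj (adj (n i))) = \sum_(i < k) (adj (n i) \o n i).
      by apply: eq_bigr => i _; rewrite adjK//; exact: bm.
    exact: n1.
exists (fun i => adj (m i)); split.
- by move=> i; exists (m i).
- move=> _ [T MT <-] e e0; apply: filterS (mc _ MT _ e0) => k hk x.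
  have bS : bounded_op (\sum_(i < k) (m i \o adj (m i))) by apply: bounded_sum => i _; exact: bs'.
  have bT := bm _ MT.
  have := adj_opbd (boundedB (bounded_comp bS bT) bT) (ltW e0) hk x.
  rewrite (adjB (bounded_comp bS bT) bT) (adj_comp bS bT) adj_sum; last by move=> i _; exact: bs'.
  have -> // : \sum_(i < k) adj (m i \o adj (m i)) = \sum_(i < k) (adj (adj (m i)) \o adj (m i)).
  apply: eq_bigr => i _; have bn := bm _ (mM i).
  by rewrite (adj_comp bn (bounded_adj bn)).
move=> k x.
have -> : \sum_(i < k) (adj (adj (m i)) \o adj (m i)) = \sum_(i < k) (m i \o adj (m i)).
  by apply: eq_bigr => i _; rewrite adjK//; exact: bm.
exact: m1.
Qed.

Definition scalars H : set (H -> H) := [set T | exists c : R[i], T = c *: (id : H -> H)].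

Lemma adj_scalar H (c : R[i]) : adj (c *: (id : H -> H)) = Num.conj c *: (id : H -> H).
Proof.
rewrite -[LHS](congr1 (@adj R H H) (addr0 _)) adj_linear_comb ?adj0 ?adj_id ?addr0//.
- exact: bounded_id.
- exact: bounded0.
Qed.

Lemma scalars_closed H : norm_closure (@scalars H) `<=` @scalars H.
Proof.
move=> T hT.
have [H0|[x0 x0n]] : (forall x : H, x = 0) \/ exists x : H, x != 0.
  have [h|h] := pselect (exists x : H, x != 0); [by right|left => x].
  by apply/eqP/negPn/negP => xn; apply: h; exists x.
  by exists 0; apply/funext => x; rewrite (H0 (T x)) (H0 (_ x)).
have n0 : 0 < rnorm x0.
  by rewrite lt_neqAle rnorm_ge0 andbT eq_sym; apply: contra x0n => /eqP/rnorm0_eq0/eqP.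
(* The only candidate for the scalar: the coefficient of [T x0] along [x0]. *)
pose t := dot H (T x0) x0 / dot H x0 x0.
have d0 : dot H x0 x0 != 0.
  by apply/eqP => h; move: n0; rewrite -(@ltr_pXn2r _ 2)// ?nnegrE// -rdotxx /rdot h expr0n /= ltxx.
exists t; apply/funext => x; apply/subr0_eq/rnorm0_eq0/eqP; rewrite eq_le rnorm_ge0 andbT.
apply/ler_addgt0Pl => e e0; rewrite addr0.
have k0 : 0 < 2 * rnorm x + 1 by rewrite ltr_wpDl// mulr_ge0.
have [_ [c ->] hc] := hT _ (divr_gt0 e0 k0).
set d := e / _ in hc; have dd : 0 < d by rewrite divr_gt0.
have hct : complex.Re `|c - t| <= d.
  have h1 := hc x0.
  have E1 : (c - t) * dot H x0 x0 = - dot H (T x0 - c *: x0) x0.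
    by rewrite mulrBl /t divfK// linearBl linearZl_LR /= opprB.
  have E2 : complex.Re `|dot H (T x0 - c *: x0) x0| <= rnorm (T x0 - c *: x0) * rnorm x0.
    exact: norm_dot_le.
  have E3 : complex.Re `|c - t| * rnorm x0 ^+ 2 <= d * rnorm x0 ^+ 2.
    have -> : complex.Re `|c - t| * rnorm x0 ^+ 2 = complex.Re `|(c - t) * dot H x0 x0|.
      by rewrite -dot_norm normrM normrX normr_id rnormE -rmorphXn ReM_realr.
    rewrite E1 normrN; apply: le_trans E2 _; rewrite expr2 mulrA ler_wpM2r//.
  by move: E3; rewrite ler_pM2r// exprn_gt0.
have -> : T x - (t *: (id : H -> H)) x = (T x - (c *: (id : H -> H)) x) + (c - t) *: x.
  by rewrite scalerBl addrA subrK.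
apply: le_trans (rnormD _ _) _; rewrite rnormZ.
apply: le_trans (lerD (hc x) (ler_wpM2r (rnorm_ge0 x) hct)) _.
have : d * (2 * rnorm x + 1) = e by rewrite /d mulfVK// gt_eqF.
lra.
Qed.

Lemma scalars_sigmaTRO H : is_sigmaTRO (@scalars H).
Proof.
have b c : bounded_op (c *: (id : H -> H)) by apply: boundedZ; exact: bounded_id.
(* The partial sums of id, 0, 0, ... equal the identity from one term on. *)
pose m (i : nat) : H -> H := if i == 0%N then id else 0.
have ms i : scalars (m i).
  by rewrite /m; case: eqP => _; [exists 1; rewrite scale1r|exists 0; rewrite scale0r].
have am i : adj (m i) = m i by rewrite /m; case: eqP => _; rewrite ?adj_id ?adj0.
have sm n x : (0 < n)%N -> (\sum_(i < n) (m i \o m i)) x = x.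
  case: n => // n _; rewrite sum_fctE big_ord_recl [X in _ + X]big1 ?addr0//.
have sm1 n x : rnorm ((\sum_(i < n) (m i \o m i)) x) <= rnorm x.
  case: n => [|n]; first by rewrite big_ord0 rnorm0.
  by rewrite sm.
split.
- split.
  + by move=> _ [c ->].
  + by exists 0; rewrite scale0r.
  + move=> c _ _ [s ->] [t ->]; exists (c * s + t).
    by rewrite scalerDl scalerA.
  + move=> _ [_ [_ [s ->] [_ [_ [t ->] <-] <-]] [_ [k ->] <-]]; exists (s * (Num.conj t * k)).
    rewrite adj_scalar; apply/funext => x.
    change (s *: (Num.conj t *: (k *: x)) = (s * (Num.conj t * k)) *: x).
    by rewrite !scalerA -!mulrA.
- exact: scalars_closed.
- exists m; split => //.
  + move=> T _ e e0; exists 1%N => // n /= n0 x.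
    under eq_bigr do rewrite am.
    by rewrite /= sm// subrr rnorm0 mulr_ge0// ltW.
  + by move=> n x; under eq_bigr do rewrite am; exact: sm1.
exists m; split => //.
- move=> T _ e e0; exists 1%N => // n /= n0 x.
  under eq_bigr do rewrite am.
  by rewrite /= sm// subrr rnorm0 mulr_ge0// ltW.
- by move=> n x; under eq_bigr do rewrite am; exact: sm1.
Qed.

End OperatorSpaces.

(** * Tails and iterated limits *)

Section Filters.

Lemma tails_filter (D : directed) : ProperFilter (tails D).
Proof.
apply: Build_ProperFilter_ex => [S [i Si]|]; first by exists i; exact/Si/drefl.
split.
- by have [i0] := dinh D; exists i0.
- move=> S T [i Si] [j Tj]; have [k [ik jk]] := ddir i j.
  by exists k => l kl; split; [apply: Si; exact: dtrans kl|apply: Tj; exact: dtrans kl].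
- by move=> S T ST [i Si]; exists i => k /Si /ST.
Qed.

(** The tail in [j] may depend on [i], as in an iterated limit. This fits the approximate identities
    below: first a number of TRO elements, then a stage in the algebra whose choice depends on that
    number. *)
Definition iter_filter (I J : Type) (F : set_system I) (G : set_system J) : set_system (I * J) :=
  [set S | \forall i \near F, \forall j \near G, S (i, j)].

Lemma iter_filter_proper (I J : Type) (F : set_system I) (G : set_system J) :
  ProperFilter F -> ProperFilter G -> ProperFilter (iter_filter F G).
Proof.
move=> FF GG; apply: Build_ProperFilter_ex => [S FS|].
  have [i Gi] := @filter_ex _ F _ _ FS; have [j Sj] := @filter_ex _ G _ _ Gi.
  by exists (i, j).
split.
- by apply: (@filterE _ F) => i; exact: (@filterE _ G).
- move=> S T FS FT; apply: (@filterS2 _ F _ _ _ _ _ FS FT) => i.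
  by apply: (@filterS2 _ G) => j.
- move=> S T ST; apply: (@filterS _ F) => i; apply: (@filterS _ G) => j; exact: ST.
Qed.

End Filters.
#[global] Existing Instance tails_filter.
#[global] Existing Instance iter_filter_proper.

(** * Limits in operator norm and the swap of approximate units *)

Section OpLimits.
Context {R : realType}.
Implicit Types H K L : hilbert R.

Lemma iter_opcvg (I J : Type) (F : set_system I) (G : set_system J)
    {FF : Filter F} {GG : Filter G} H K (T : I * J -> H -> K) (S : I -> H -> K) T0 :
  (forall i, opcvg G (fun j => T (i, j)) (S i)) -> opcvg F S T0 ->
  opcvg (iter_filter F G) T T0.
Proof.
move=> TS ST0 e e0; have e2 : 0 < e / 2 by rewrite divr_gt0.
apply: filterS (ST0 _ e2) => i hi; apply: filterS (TS i _ e2) => j hj x.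
apply: le_trans (rnorm_triangle (S i x) _ _) _.
by apply: le_trans (lerD (hj x) (hi x)) _; rewrite -mulrDl -splitr.
Qed.

Lemma opcvg_sum (I : Type) (F : set_system I) {FF : Filter F} H K n
    (T : 'I_n -> I -> H -> K) (S : 'I_n -> H -> K) :
  (forall k, opcvg F (T k) (S k)) ->
  opcvg F (fun i => \sum_(k < n) T k i) (\sum_(k < n) S k).
Proof.
move=> TS e e0; have d0 : 0 < e / n.+1%:R by rewrite divr_gt0.
have : \forall i \near F, forall k, opbd (T k i - S k) (e / n.+1%:R).
  by apply: filter_forall => k; exact: TS.
apply: filterS => i hi x; rewrite !sum_fctE -sumrB.
apply: le_trans (rnorm_sum _ _ _) _.
apply: (@le_trans _ _ (\sum_(k < n) e / n.+1%:R * rnorm x)).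
  by apply: ler_sum => k _; exact: hi.
rewrite sumr_const card_ord -[leLHS]mulr_natl mulrA ler_wpM2r// mulrCA ler_piMr ?(ltW e0)//.
by rewrite ler_pdivrMr// mul1r ler_nat.
Qed.

Lemma opcvg_compl (I : Type) (F : set_system I) {FF : Filter F} H K L
    (X : K -> L) (T : I -> H -> K) S : bounded_op X ->
  opcvg F T S -> opcvg F (fun i => X \o T i) (X \o S).
Proof.
move=> /bounded_opP[Xl [d d0 Xd]] TS e e0.
have d1 : 0 < e / (d + 1) by rewrite divr_gt0// ltr_wpDl.
apply: filterS (TS _ d1) => i hi x.
rewrite /= -(linfB Xl); apply: le_trans (Xd _) _; apply: le_trans (ler_wpM2l d0 (hi x)) _.
rewrite mulrA ler_wpM2r// mulrCA ler_piMr ?(ltW e0)//.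
by rewrite ler_pdivrMr ?ltr_wpDl// mul1r lerDl.
Qed.

Lemma opcvg_compr (I : Type) (F : set_system I) {FF : Filter F} H K L
    (T : I -> K -> L) S (X : H -> K) : bounded_op X ->
  opcvg F T S -> opcvg F (fun i => T i \o X) (S \o X).
Proof.
move=> /bounded_opP[Xl [d d0 Xd]] TS e e0.
have d1 : 0 < e / (d + 1) by rewrite divr_gt0// ltr_wpDl.
apply: filterS (TS _ d1) => i hi x.
apply: le_trans (hi _) _; apply: le_trans (ler_wpM2l (ltW d1) (Xd x)) _.
rewrite mulrA ler_wpM2r// mulrAC ler_pdivrMr ?ltr_wpDl//.
by rewrite ler_wpM2l ?(ltW e0)// lerDl.
Qed.

Lemma opcvg_repr (X : opSpace R) H K (u : {linear X -> (H -> K)}) (I : Type)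
    (F : set_system I) {FF : Filter F} (x : I -> X) l :
  is_repr (osnorm X) u -> ncvg F x l <-> opcvg F (fun i => u (x i)) (u l).
Proof.
move=> hu; split=> h e e0; apply: filterS (h _ e0) => i.
  by move=> /(repr_opbd hu _ (ltW e0)) h' z; have := h' z; rewrite linearB.
by move=> h'; apply/(repr_opbd hu); [exact: ltW|move=> z; rewrite linearB; exact: h'].
Qed.

(** In the expansion of [|adj P x - x|^2], [adj P x] is no longer than [x], and [Re <P x, x>] is at
    least [|x|^2 - d |x|]. *)
Lemma contraction_adj_fix H (P : H -> H) (x : H) (d : R) :
  bounded_op P -> opbd P 1 -> rnorm (P x - x) <= d ->
  rnorm (adj P x - x) ^+ 2 <= 2 * d * rnorm x.
Proof.
move=> Pb Pc Pd.
have Pac : rnorm (adj P x) <= rnorm x.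
  by have := adj_opbd Pb ler01 Pc x; rewrite mul1r.
rewrite rnorm_sqB rdotC -(rdot_adj Pb).
have -> : rdot (P x) x = rnorm x ^+ 2 + rdot (P x - x) x.
  by rewrite rdotDl rdotNl rdotxx addrCA subrr addr0.
have h : - rdot (P x - x) x <= d * rnorm x.
  rewrite -rdotNl; apply: le_trans (rdot_le _ _) _; rewrite rnormN.
  exact: ler_wpM2r.
have h2 : rnorm (adj P x) ^+ 2 <= rnorm x ^+ 2 by apply: lerXn2r; rewrite ?nnegrE ?rnorm_ge0.
lra.
Qed.

(** With [y = adj X x]: [X X'] close to [X] says that [adj X'] nearly fixes [y], hence so does [X'];
    then [P] nearly fixes [y] because it nearly fixes [X' y]; hence so does [adj P], which is the
    adjoint of the claim. Each passage to an adjoint costs a square root. *)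
Lemma approx_unit_swap H K (X : K -> H) (X' P : K -> K) (C d : R) :
  bounded_op X -> bounded_op X' -> bounded_op P -> 0 <= C -> 0 <= d ->
  opbd X C -> opbd X' 1 -> opbd P 1 ->
  opbd (X \o X' - X) d -> opbd (P \o X' - X') d ->
  opbd (X \o P - X) (Num.sqrt (2 * C * (2 * Num.sqrt (2 * C * d) + d * C))).
Proof.
move=> Xb X'b Pb C0 d0 XC X'c Pc XX' PX'.
set s := Num.sqrt (2 * C * d).
have s0 : 0 <= s := sqrtr_ge0 _.
have t0 : 0 <= 2 * s + d * C by rewrite addr_ge0 ?mulr_ge0.
have Xa x : rnorm (adj X x) <= C * rnorm x := adj_opbd Xb C0 XC x.
have sq_le (p q : R) : 0 <= p -> 0 <= q -> p ^+ 2 <= q ^+ 2 -> p <= q.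
  by move=> p0 q0; rewrite ler_pXn2r.
have bXX' : bounded_op (X \o X' - X) by apply: boundedB => //; exact: bounded_comp.
have h1 x : rnorm (adj X' (adj X x) - adj X x) <= d * rnorm x.
  have := adj_opbd bXX' d0 XX' x.
  by rewrite (adjB (bounded_comp Xb X'b) Xb) (adj_comp Xb X'b).
have h2 x : rnorm (X' (adj X x) - adj X x) <= s * rnorm x.
  apply: sq_le => //; first by rewrite mulr_ge0.
  have := contraction_adj_fix (bounded_adj X'b) (adj_opbd X'b ler01 X'c) (h1 x).
  rewrite adjK// => /le_trans; apply; rewrite exprMn sqr_sqrtr ?mulr_ge0//.
  have -> : 2 * C * d * rnorm x ^+ 2 = 2 * (d * rnorm x) * (C * rnorm x) by ring.
  by apply: ler_wpM2l => //; rewrite !mulr_ge0.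
have h3 x : rnorm (P (adj X x) - adj X x) <= (2 * s + d * C) * rnorm x.
  set y := adj X x; have Pl := bounded_lin Pb.
  have -> : P y - y = (P (y - X' y)) + ((P (X' y) - X' y) + (X' y - y)).
    by rewrite (linfB Pl) subrKA addrA subrK.
  apply: le_trans (rnormD _ _) _; apply: le_trans (lerD (lexx _) (rnormD _ _)) _.
  have := Pc (y - X' y); have := PX' y; have := h2 x; rewrite -/y (rnormBC y) mul1r.
  have -> : (P \o X' - X') y = P (X' y) - X' y by [].
  have := Xa x; rewrite -/y => ? ? h ?; have := ler_wpM2l d0 (Xa x); rewrite -/y.
  by move: h; lra.
have h4 x : rnorm (adj P (adj X x) - adj X x) <= Num.sqrt (2 * C * (2 * s + d * C)) * rnorm x.
  apply: sq_le => //; first by rewrite mulr_ge0// sqrtr_ge0.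
  apply: le_trans (contraction_adj_fix Pb Pc (h3 x)) _.
  rewrite exprMn sqr_sqrtr ?mulr_ge0//.
  set t := 2 * s + d * C in t0 *.
  have -> : 2 * C * t * rnorm x ^+ 2 = 2 * (t * rnorm x) * (C * rnorm x) by ring.
  by apply: ler_wpM2l => //; rewrite !mulr_ge0.
have bXP : bounded_op (X \o P - X) by apply: boundedB => //; exact: bounded_comp.
rewrite -(adjK bXP); apply: adj_opbd; [exact: bounded_adj|exact: sqrtr_ge0|move=> x].
by rewrite (adjB (bounded_comp Xb Pb) Xb) (adj_comp Xb Pb); exact: h4.
Qed.

End OpLimits.

(** * Approximate identities of a rigged module *)

Section Frame.
Context {R : realType}.

Lemma opbd_mxbd (H K : hilbert R) (T : H -> K) c : 0 <= c ->
  opbd T c <-> mxbd (fun _ _ : 'I_1 => T) c.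
Proof.
move=> c0; split=> Tc.
  move=> xi; rewrite !big_ord1 -exprMn; apply: lerXn2r; rewrite ?nnegrE ?rnorm_ge0//.
  by rewrite mulr_ge0.
move=> x; have := Tc (fun=> x); rewrite !big_ord1 -exprMn.
by rewrite ler_pXn2r// nnegrE// mulr_ge0.
Qed.

(* The data in [doubly_sigmaDelta], with the inclusions between closed spans
   stated on generators. *)
Record frame (A : opAlg R) (Y : rmod A) := Frame {
  fH : hilbert R;
  fK : hilbert R;
  fa : {linear A -> (fH -> fH)};
  fM : set (fH -> fK);
  fu : {linear Y -> (fH -> fK)};
  fa_repr : is_repr (osnorm A) fa;
  fa_mul : forall x y, fa (amul x y) = fa x \o fa y;
  fM_tro : is_sigmaTRO fM;
  fu_repr : is_repr (osnorm Y) fu;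
  fu_mod : forall y x, fu (ract y x) = fu y \o fa x;
  f_MMa : forall m m' x, fM m -> fM m' -> range fa (adj m \o m' \o fa x);
  f_aMM : forall x m m', fM m -> fM m' -> range fa (fa x \o adj m \o m');
  f_Ma : forall m x, fM m -> range fu (m \o fa x);
  f_u : forall y, clspan (prods fM (range fa)) (fu y) }.

Record approximants (A : opAlg R) (Y : rmod A) (f : frame Y) := Approximants {
  pD : directed;
  pe : pD -> A;
  pe_bai : is_bai pe 1;
  pm : nat -> fH f -> fK f;
  pm_in : forall i, fM (pm i);
  pm_cvg : forall T, fM T -> opcvg \oo (fun n => (\sum_(i < n) (pm i \o adj (pm i))) \o T) T;
  pm_le : forall n x, rnorm ((\sum_(i < n) (pm i \o adj (pm i))) x) <= rnorm x;
  pw : nat -> pD -> Y;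
  pwE : forall j l, fu f (pw j l) = pm j \o fa f (pe l) }.

Lemma approximants_exist (A : opAlg R) (Y : rmod A) (f : frame Y) :
  approx_unital A -> inhabited (approximants f).
Proof.
move=> [D [e he]]; have [m [mM mcvg mle]] := stro_left (fM_tro f).
have /choice[w wP] : forall jl : nat * D, exists y, fu f y = m jl.1 \o fa f (e jl.2).
  by move=> jl; have [y _ yE] := @f_Ma _ _ f _ (e jl.2) (mM jl.1); exists y.
by constructor; apply: (@Approximants _ _ _ D e he m mM mcvg mle (fun j l => w (j, l))) => j l; exact: wP.
Qed.

Section Approximants.
Context (A : opAlg R) (Y : rmod A) (f : frame Y) (p : approximants f).
Local Notation H := (fH f).
Local Notation K := (fK f).
Local Notation a := (fa f).
Local Notation u := (fu f).
Local Notation M := (@fM _ _ f).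
Local Notation m := (@pm _ _ f p).
Local Notation e := (@pe _ _ f p).
Local Notation w := (@pw _ _ f p).

Lemma fM_bounded T : M T -> bounded_op T.
Proof. exact: (tro_bounded (stro_tro (fM_tro f))). Qed.

Lemma fa_bounded x : bounded_op (a x).
Proof. exact: repr_bounded (fa_repr f) x. Qed.

Lemma fu_bounded y : bounded_op (u y).
Proof. exact: repr_bounded (fu_repr f) y. Qed.

Lemma adjM_bounded T : M T -> bounded_op (adj T).
Proof. by move=> /fM_bounded; exact: bounded_adj. Qed.

Lemma pe_opbd l : opbd (a (e l)) 1.
Proof. by apply/(repr_opbd (fa_repr f)) => //; case: (pe_bai p). Qed.

Definition pP n : K -> K := \sum_(i < n) (m i \o adj (m i)).

Lemma pm_bounded i : bounded_op (m i).
Proof. exact: fM_bounded (pm_in p i). Qed.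

Lemma pP_bounded n : bounded_op (pP n).
Proof.
by apply: bounded_sum => i _; apply: bounded_comp; [|apply: bounded_adj]; exact: pm_bounded.
Qed.

(** The sum is [<P x, x>] for the contraction [P = pP n]. *)
Lemma pm_col n x : \sum_(j < n) rnorm (adj (m j) x) ^+ 2 <= rnorm x ^+ 2.
Proof.
under eq_bigr do rewrite -rdotxx -(rdot_adj (pm_bounded _)).
rewrite -rdot_suml; apply: le_trans (rdot_le _ _) _.
have -> : \sum_(j < n) m j (adj (m j) x) = pP n x by rewrite /pP sum_fctE.
by rewrite expr2 ler_wpM2r// pm_le.
Qed.

(** Dual to [pm_col]: [|z|^2] is the sum of the [<xi j, adj (m j) z>]; after the
    arithmetic-geometric inequality, [pm_col] bounds the part in [z] by half of [|z|^2], which is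
    absorbed on the left. *)
Lemma pm_row n (xi : 'I_n -> H) :
  rnorm (\sum_(j < n) m j (xi j)) ^+ 2 <= \sum_(j < n) rnorm (xi j) ^+ 2.
Proof.
set z := \sum_(j < n) _.
have zE : rnorm z ^+ 2 = \sum_(j < n) rdot (xi j) (adj (m j) z).
  by rewrite -rdotxx {1}/z rdot_suml; apply: eq_bigr => j _; rewrite (rdot_adj (pm_bounded _)).
have : \sum_(j < n) rdot (xi j) (adj (m j) z) <=
    \sum_(j < n) (2^-1 * (rnorm (xi j) ^+ 2) + 2^-1 * rnorm (adj (m j) z) ^+ 2).
  apply: ler_sum => j _; apply: le_trans (rdot_le _ _) _.
  by have := sqr_ge0 (rnorm (xi j) - rnorm (adj (m j) z)); lra.
rewrite -zE big_split /= -!mulr_sumr; have := pm_col n z; lra.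
Qed.

Definition pq j l : K -> H := a (e l) \o adj (m j).

Lemma pq_bounded j l : bounded_op (pq j l).
Proof. by apply: bounded_comp; [exact: fa_bounded|exact/bounded_adj/pm_bounded]. Qed.

Lemma pq_col n l : mxbd (fun (j : 'I_n) (_ : 'I_1) => pq j l) 1.
Proof.
move=> xi; rewrite big_ord1 expr1n mul1r; under eq_bigr do rewrite big_ord1.
apply: le_trans (pm_col n _); apply: ler_sum => j _.
by apply: lerXn2r; rewrite ?nnegrE ?rnorm_ge0//; have := pe_opbd l (adj (m j) (xi ord0)); rewrite mul1r.
Qed.

Lemma pw_row n l : mnorm Y (\row_(j < n) w j l) <= 1.
Proof.
apply/(repr_mnorm_le (fu_repr f)) => // xi; rewrite big_ord1 expr1n mul1r.
have -> : \sum_(j < n) u ((\row_j0 w j0 l) ord0 j) (xi j) = \sum_(j < n) m j (a (e l) (xi j)).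
  by apply: eq_bigr => j _; rewrite mxE pwE.
apply: le_trans (pm_row _) _; apply: ler_sum => j _.
by apply: lerXn2r; rewrite ?nnegrE ?rnorm_ge0//; have := pe_opbd l (xi j); rewrite mul1r.
Qed.

(* If [T = X \o u _] with [X : K -> Q], this is [X] times the operator [RR] below,
   an approximate identity of [Y]. *)
Definition ap (Q : hilbert R) (T : Y -> H -> Q) (mu : nat * pD p) : K -> Q :=
  \sum_(j < mu.1) (T (w j mu.2) \o pq j mu.2).

(** [ap] is the row of the [T (w j l)] times the column of the [pq j l]. The row of the [w j l] and
    that column are both contractive, so [T] only has to be bounded on rows of norm at most 1. *)
Lemma ap_mx (I J : finType) (Q : hilbert R) (T : I -> J -> Y -> H -> Q) mu c :
  (forall i j y, linear (T i j y)) ->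
  (forall n (z : 'I_n -> Y), mnorm Y (\row_k z k) <= 1 ->
     mxbd (fun i (jk : J * 'I_n) => T i jk.1 (z jk.2)) c) ->
  mxbd (fun i j => ap (T i j) mu) c.
Proof.
move=> Tl Tc; case: mu => n l; rewrite -[c]mulr1.
have h1 := Tc n (fun k => w k l) (pw_row n l).
have h2 := mxbd_ampl (P := J) (@pq_col n l).
have h3 := mxbd_comp (fun i jk => Tl i jk.1 _) h1 h2.
have inj2 : injective (fun j : J => (j, ord0 : 'I_1)) by move=> j j' [].
have h4 := mxbd_sub _ (@inj_id I) inj2 h3.
apply: (mxbd_eq _ (h4 _)) => [i j x|i jk].
  rewrite /ap sum_fctE /=.
  transitivity (\sum_j' \sum_(k < n) T i j' (w k l) ((if j' == j then pq k l else 0) x)).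
    by rewrite pair_bigA.
  rewrite (bigD1 j)//= [X in _ + X]big1 ?addr0.
    by apply: eq_bigr => k _; rewrite eqxx.
  by move=> j' /negPf j'j; apply: big1 => k _; rewrite j'j (linf0 (Tl _ _ _)).
move=> c' x y; rewrite scaler_sumr -big_split /=; apply: eq_bigr => k _.
case: ifP => _; first by rewrite (bounded_lin (pq_bounded _ _)) Tl.
by rewrite (linf0 (Tl _ _ _)) scaler0 addr0.
Qed.

Definition rowbd (Q : hilbert R) (T : Y -> H -> Q) (c : R) : Prop :=
  forall n (z : 'I_n -> Y), mnorm Y (\row_k z k) <= 1 ->
    mxbd (fun (_ : 'I_1) (k : 'I_n) => T (z k)) c.

Lemma ap_opbd (Q : hilbert R) (T : Y -> H -> Q) mu c : 0 <= c ->
  (forall y, linear (T y)) -> rowbd T c -> opbd (ap T mu) c.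
Proof.
move=> c0 Tl Tc; apply/opbd_mxbd => //; apply: (@ap_mx _ _ _ (fun _ _ => T)) => // n z z1.
have inj2 : injective (fun jk : 'I_1 * 'I_n => jk.2).
  by move=> [j k] [j' k'] /= ->; rewrite !ord1.
by have := mxbd_sub _ (@inj_id 'I_1) inj2 (Tc n z z1); apply.
Qed.

Lemma ap_bounded (Q : hilbert R) (T : Y -> H -> Q) mu :
  (forall y, bounded_op (T y)) -> bounded_op (ap T mu).
Proof. by move=> Tb; apply: bounded_sum => j _; apply: bounded_comp => //; exact: pq_bounded. Qed.

Lemma mnorm_rowbd (G : opSpace R) (Q Q' : hilbert R) (v : {linear G -> (Q -> Q')})
    n (z : 'I_n -> G) c : is_repr (osnorm G) v -> 0 <= c ->
  mnorm G (\row_k z k) <= c <-> mxbd (fun (_ : 'I_1) (k : 'I_n) => v (z k)) c.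
Proof.
move=> hv c0; rewrite (repr_mnorm_le hv)//.
by split; apply: mxbd_eq => i j x; rewrite mxE.
Qed.

Lemma rowbd_repr (G : opSpace R) (Q : hilbert R) (v : {linear G -> (H -> Q)}) (T : Y -> G) c :
  is_repr (osnorm G) v -> 0 <= c ->
  (forall n (z : 'I_n -> Y), mnorm Y (\row_k z k) <= 1 -> mnorm G (\row_k T (z k)) <= c) ->
  rowbd (v \o T) c.
Proof. by move=> hv c0 Tc n z /Tc; rewrite (mnorm_rowbd _ hv). Qed.

Lemma f_adjMu mm y : M mm -> range a (adj mm \o u y).
Proof.
move=> Mm.
suff h : clspan (prods M (range a)) `<=` [set S : H -> K | range a (adj mm \o S)] by exact: h (f_u f y).
apply: clspan_min.
  by apply: clsub_compl; [exact: adjM_bounded|exact: (repr_clsub (fa_repr f))].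
by move=> _ [S MS] [_ [x _ <-] <-]; exact: f_MMa.
Qed.

(* The functional [y |-> x m^* y] of [Y]; unspecified when [mm] is not in [M]. *)
Lemma fnl_exists : exists fnl : A -> (H -> K) -> Y -> A,
  forall x mm y, M mm -> a (fnl x mm y) = a x \o adj mm \o u y.
Proof.
have /choice[g gP] : forall xmy : A * (H -> K) * Y, exists z,
    M xmy.1.2 -> a z = a xmy.1.1 \o adj xmy.1.2 \o u xmy.2.
  move=> [[x mm] y] /=; have [Mm|] := pselect (M mm); last by exists 0.
  have [z _ zE] := f_adjMu y Mm; exists (amul x z) => _.
  by rewrite fa_mul zE.
by exists (fun x mm y => g (x, mm, y)) => x mm y; exact: (gP (x, mm, y)).
Qed.

Definition fnl := sval (cid fnl_exists).

Lemma fnlE x mm y : M mm -> a (fnl x mm y) = a x \o adj mm \o u y.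
Proof. by move=> Mm; rewrite /fnl; case: cid => g /= ->. Qed.

Lemma fnl_linear x mm : M mm -> linear (fnl x mm).
Proof.
move=> Mm c y z; apply: (repr_inj (fa_repr f)); rewrite linearP /= !fnlE// linearP.
apply/funext => h; rewrite /= !lin_combE /=.
by rewrite (bounded_lin (adjM_bounded Mm)) (bounded_lin (fa_bounded _)).
Qed.

Lemma fnl_mod x mm y b : M mm -> fnl x mm (ract y b) = amul (fnl x mm y) b.
Proof.
by move=> Mm; apply: (repr_inj (fa_repr f)); rewrite fa_mul !fnlE// fu_mod.
Qed.

(** The map on [Y] that left multiplication by the operator [RR] induces through [u] ([RR_u]). *)
Definition rr (mu : nat * pD p) (y : Y) : Y :=
  \sum_(j < mu.1) ract (w j mu.2) (fnl (e mu.2) (m j) y).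

(** [pq j l \o u y] is the image under [a] of the value of [fnl] at [y], and the module property
    moves that value inside [T]. *)
Lemma ap_u (Q : hilbert R) (G : lmodType R[i]) (v : G -> H -> Q) (T : Y -> G) mu y :
  linear v -> linear T -> (forall z x, v (T (ract z x)) = v (T z) \o a x) ->
  ap (fun z => v (T z)) mu \o u y = v (T (rr mu y)).
Proof.
move=> vl Tl vm; rewrite /rr (linf_sum Tl) (linf_sum vl); apply/funext => h.
rewrite /ap /= !sum_fctE; apply: eq_bigr => j _ /=.
by rewrite vm /= fnlE//; exact: pm_in.
Qed.

Definition RR mu := ap u mu.

Lemma RR_u mu y : RR mu \o u y = u (rr mu y).
Proof. by apply: (@ap_u _ _ u id); [exact: linearP|by []|exact: fu_mod]. Qed.

Lemma rr_linear mu : linear (rr mu).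
Proof.
move=> c y z; rewrite /rr scaler_sumr -big_split /=; apply: eq_bigr => j _.
by rewrite fnl_linear ?linearDr ?linearZr_LR//; exact: pm_in.
Qed.

Lemma rr_mod mu y x : rr mu (ract y x) = ract (rr mu y) x.
Proof.
rewrite /rr linear_sumlz; apply: eq_bigr => j _.
by rewrite fnl_mod ?ractA//; exact: pm_in.
Qed.

Lemma RR_bounded mu : bounded_op (RR mu).
Proof. by apply: ap_bounded; exact: fu_bounded. Qed.

Lemma RR_opbd mu : opbd (RR mu) 1.
Proof.
apply: ap_opbd => //; first by move=> y; exact: bounded_lin (fu_bounded y).
by move=> n z; rewrite (mnorm_rowbd _ (fu_repr f)).
Qed.

Definition pF := iter_filter \oo (tails (pD p)).

Lemma pe_cvgl x : opcvg (tails (pD p)) (fun l => a (amul (e l) x)) (a x).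
Proof. by apply/(opcvg_repr _ _ (fa_repr f))/ncvgP; case: (pe_bai p) => _ h _; exact: h. Qed.

Lemma pe_cvgr x : opcvg (tails (pD p)) (fun l => a (amul x (e l))) (a x).
Proof. by apply/(opcvg_repr _ _ (fa_repr f))/ncvgP; case: (pe_bai p) => _ _ h; exact: h. Qed.

End Approximants.
End Frame.

(** * Induction over closed subspaces *)

Section ClosedSubspaces.
Context {R : realType}.

(** The counterpart of [clsub] in a normed module, used for the induction principles on [Y], [A],
    [B], [E] and [F]. *)
Definition nclosed (V : normedModType R[i]) (N : set V) : Prop :=
  [/\ N 0, forall (c : R[i]) x y, N x -> N y -> N (c *: x + y)
    & forall x, (forall e : R, 0 < e -> exists2 y, N y & rnorm (x - y) <= e) -> N x].

Lemma nclosed_sum (V : normedModType R[i]) (N : set V) n (x : 'I_n -> V) :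
  nclosed N -> (forall i, N (x i)) -> N (\sum_(i < n) x i).
Proof.
move=> [N0 Nl _] Nx; elim: n x Nx => [|n IH] x Nx; first by rewrite big_ord0.
by rewrite big_ord_recl -[x _]scale1r; apply: Nl; [exact: Nx|apply: IH => i; exact: Nx].
Qed.

Lemma nclosed_lim (V : normedModType R[i]) (N : set V) (I : Type) (F : set_system I)
    {FF : ProperFilter F} (f : I -> V) l :
  nclosed N -> (forall i, N (f i)) -> ncvg F f l -> N l.
Proof.
move=> [_ _ Nc] Nf fl; apply: Nc => e e0; have [i fi] := filter_ex (fl _ e0).
by exists (f i) => //; rewrite rnormBC.
Qed.

Lemma nclosed_preim (V W : normedModType R[i]) (T : V -> W) (c : R) (N : set W) :
  linear T -> (forall x, rnorm (T x) <= c * rnorm x) -> nclosed N ->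
  nclosed [set x | N (T x)].
Proof.
move=> Tl Tc [N0 Nl Nc]; split => /=.
- by rewrite (linf0 Tl).
- by move=> k x y Nx Ny; rewrite Tl; exact: Nl.
move=> x hx; apply: Nc => e e0.
have c1 : 0 < `|c| + 1 by rewrite ltr_wpDl.
have [y Ny xy] := hx _ (divr_gt0 e0 c1); exists (T y) => //.
rewrite -(linfB Tl); apply: le_trans (Tc _) _.
apply: (@le_trans _ _ ((`|c| + 1) * rnorm (x - y))).
  by rewrite ler_wpM2r// (le_trans (ler_norm c))// lerDl.
by rewrite mulrC -ler_pdivlMr.
Qed.

Lemma nclosed_ops (V : normedModType R[i]) (H K : hilbert R) (T : V -> H -> K) (c : R)
    (N : set (H -> K)) :
  linear T -> (forall x, opbd (T x) (c * rnorm x)) -> clsub N ->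
  nclosed [set x | N (T x)].
Proof.
move=> Tl Tc [N0 Nl Nc]; split => /=.
- by rewrite (linf0 Tl).
- by move=> k x y Nx Ny; rewrite Tl; exact: Nl.
move=> x hx; apply: Nc => e e0.
have c1 : 0 < `|c| + 1 by rewrite ltr_wpDl.
have [y Ny xy] := hx _ (divr_gt0 e0 c1); exists (T y) => // h.
have := Tc (x - y) h; rewrite (linfB Tl) => /le_trans; apply; rewrite ler_wpM2r//.
apply: (@le_trans _ _ ((`|c| + 1) * rnorm (x - y))).
  by rewrite ler_wpM2r// (le_trans (ler_norm c))// lerDl.
by rewrite mulrC -ler_pdivlMr.
Qed.

(** For contractions, strong convergence to the identity passes to norm limits of vectors, so it can
    be checked on generators. *)
Lemma nclosed_cvg (V : normedModType R[i]) (I : Type) (F : set_system I) {FF : Filter F}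
    (T : I -> V -> V) : (forall i, linear (T i)) -> (forall i x, rnorm (T i x) <= rnorm x) ->
  nclosed [set x | ncvg F (fun i => T i x) x].
Proof.
move=> Tl T1; split => /=.
- by move=> d d0; apply: filterE => i; rewrite (linf0 (Tl i)) subrr rnorm0 ltW.
- move=> c x y hx hy; rewrite (_ : (fun i => _) = (fun i => c *: T i x + T i y)).
    by apply: ncvgD => //; exact: ncvgZ.
  by apply/funext => i; rewrite Tl.
move=> x hx d d0; have d3 : 0 < d / 3 by rewrite divr_gt0.
have [y hy xy] := hx _ d3; apply: filterS (hy _ d3) => i hi.
have -> : T i x - x = T i (x - y) + (T i y - y) - (x - y).
  by rewrite (linfB (Tl i)) addrA subrK opprB addrA subrK.
apply: le_trans (rnormD _ _) _; rewrite rnormN.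
apply: le_trans (lerD (rnormD _ _) xy) _.
by have := T1 i (x - y); lra.
Qed.

Lemma clsub_preim (X : opSpace R) (H K : hilbert R) (u : {linear X -> (H -> K)}) (N : set X) :
  is_repr (osnorm X) u -> nclosed N -> clsub (u @` N).
Proof.
move=> hu [N0 Nl Nc]; split.
- by exists 0 => //; rewrite linear0.
- by move=> c _ _ [x Nx <-] [y Ny <-]; exists (c *: x + y); [exact: Nl|rewrite linearP].
have [_ _ rc] := repr_clsub hu.
move=> T MT; have [x _ xT] : range u T.
  by apply: rc => e e0; have [_ [y Ny <-] hy] := MT _ e0; exists (u y) => //; exists y.
exists x => //; apply: Nc => e e0; have [_ [y Ny <-] hy] := MT _ e0; exists y => //.
by apply/(repr_opbd hu) => [|z]; [exact: ltW|rewrite linearB xT; exact: hy].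
Qed.

Lemma approx_unit_swap_exists (H K : hilbert R) (C e : R) : 0 <= C -> 0 < e ->
  exists2 d : R, 0 < d & forall (X : K -> H) (X' P : K -> K),
    bounded_op X -> bounded_op X' -> bounded_op P ->
    opbd X C -> opbd X' 1 -> opbd P 1 ->
    opbd (X \o X' - X) d -> opbd (P \o X' - X') d -> opbd (X \o P - X) e.
Proof.
move=> C0 e0; have C1 : 0 < C + 1 by rewrite ltr_wpDl.
(* [t] will bound both the inner root and [d * C]; the outer root is then at most [e] because
   [2 C * 3 t] is at most [e ^+ 2]. *)
pose t := Num.min 1 (e ^+ 2 / (6 * (C + 1))).
have t0 : 0 < t by rewrite lt_min ltr01 divr_gt0 ?exprn_gt0 ?mulr_gt0.
have t1 : t <= 1 by rewrite ge_min lexx.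
have t2 : 6 * (C + 1) * t <= e ^+ 2.
  by rewrite mulrC -ler_pdivlMr ?mulr_gt0// ge_min lexx orbT.
pose d := t ^+ 2 / (2 * (C + 1)).
have d0 : 0 < d by rewrite divr_gt0 ?exprn_gt0 ?mulr_gt0.
have dE : 2 * (C + 1) * d = t ^+ 2 by rewrite /d; field; rewrite gt_eqF.
exists d => // X X' P Xb X'b Pb XC X'c Pc h1 h2.
apply: opbd_le (approx_unit_swap Xb X'b Pb C0 (ltW d0) XC X'c Pc h1 h2).
rewrite -[leRHS](ger0_norm (ltW e0)) -sqrtr_sqr ler_sqrt ?sqr_ge0//.
have s1 : Num.sqrt (2 * C * d) <= t.
  rewrite -[leRHS](ger0_norm (ltW t0)) -sqrtr_sqr ler_sqrt ?sqr_ge0// -dE.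
  by rewrite ler_wpM2r ?(ltW d0)// ler_wpM2l// lerDl.
have s2 : d * C <= t by nra.
apply: le_trans t2.
have : 2 * C * (2 * Num.sqrt (2 * C * d) + d * C) <= 2 * C * (3 * t).
  by rewrite ler_wpM2l ?mulr_ge0//; lra.
by move=> h; apply: (le_trans h); nra.
Qed.

Lemma opcvg_adj (I : Type) (F : set_system I) {FF : Filter F} (H K : hilbert R)
    (T : I -> H -> K) S : (forall i, bounded_op (T i)) -> bounded_op S ->
  opcvg F T S -> opcvg F (fun i => adj (T i)) (adj S).
Proof.
move=> Tb Sb TS e e0; apply: filterS (TS _ e0) => i hi x.
have bTS := boundedB (Tb i) Sb.
by have := adj_opbd bTS (ltW e0) hi x; rewrite adjB.
Qed.

Lemma clsub_opcvg (I : Type) (F : set_system I) {FF : Filter F} (H K : hilbert R)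
    (P : I -> K -> K) : (forall i, bounded_op (P i)) -> (forall i, opbd (P i) 1) ->
  clsub [set S : H -> K | opcvg F (fun i => P i \o S) S].
Proof.
move=> Pb P1; split => /=.
- move=> e e0; apply: filterE => i x /=; rewrite (linf0 (bounded_lin (Pb i))) subrr rnorm0.
  by rewrite mulr_ge0// ltW.
- move=> c S T hS hT e e0.
  pose n := complex.Re `|c|; have n0 : 0 <= n by exact: Re_norm_ge0.
  have d0 : 0 < e / (n + 1) by rewrite divr_gt0// ltr_wpDl.
  apply: filterS2 (hS _ d0) (hT _ d0) => i hi hj x.
  rewrite /= !lin_combE (bounded_lin (Pb i)) opprD addrACA -scalerBr.
  apply: le_trans (rnormD _ _) _; rewrite rnormZ.
  apply: le_trans (lerD (ler_wpM2l n0 (hi x)) (hj x)) _.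
  rewrite -/n le_eqVlt; apply/orP; left; apply/eqP; field.
  by rewrite gt_eqF// ltr_wpDl.
move=> T MT e e0; have e3 : 0 < e / 3 by rewrite divr_gt0.
have [S hS TS] := MT _ e3; apply: filterS (hS _ e3) => i hi x /=.
have -> : P i (T x) - T x = P i (T x - S x) + (P i (S x) - S x) - (T x - S x).
  by rewrite (linfB (bounded_lin (Pb i))) addrA subrK opprB addrA subrK.
apply: le_trans (rnormD _ _) _; rewrite rnormN.
apply: le_trans (lerD (rnormD _ _) (TS x)) _.
have := P1 i (T x - S x); have := TS x; have := hi x; rewrite mul1r /=; lra.
Qed.

Lemma mxbd_compl (I J : finType) (H K L : hilbert R) (X : K -> L) (T : I -> J -> H -> K) c d :
  linear X -> 0 <= c -> opbd X c -> mxbd T d -> mxbd (fun i j => X \o T i j) (c * d).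
Proof.
move=> Xl c0 Xc Td xi; rewrite exprMn -mulrA.
apply: le_trans (ler_wpM2l (sqr_ge0 c) (Td xi)); rewrite mulr_sumr.
apply: ler_sum => i _; rewrite -(linf_sum Xl) -exprMn.
by apply: lerXn2r; rewrite ?nnegrE ?rnorm_ge0 ?mulr_ge0.
Qed.

End ClosedSubspaces.

(** * Convergence of the approximate identity *)

Section ApproximateIdentity.
Context {R : realType} (A : opAlg R) (Y : rmod A) (f : frame Y) (p : approximants f).
Local Notation H := (fH f).
Local Notation K := (fK f).
Local Notation a := (fa f).
Local Notation u := (fu f).
Local Notation M := (@fM _ _ _ f).
Local Notation m := (@pm _ _ _ f p).
Local Notation e := (@pe _ _ _ f p).
Local Notation w := (@pw _ _ _ f p).

Lemma amul_rnorm (x y : A) : rnorm (amul x y) <= rnorm x * rnorm y.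
Proof.
apply/(repr_opbd (fa_repr f)) => [|h]; first exact: mulr_ge0.
rewrite fa_mul /=; apply: le_trans (repr_opbd_norm (fa_repr f) _ _) _.
by rewrite -mulrA ler_wpM2l// (repr_opbd_norm (fa_repr f)).
Qed.

(** Two factors [e l]: one comes from [w], the other from [pq]. *)
Lemma pe2_cvgl x : opcvg (tails (pD p)) (fun l => a (amul (e l) (amul (e l) x))) (a x).
Proof.
apply/(opcvg_repr _ _ (fa_repr f)) => d d0; have d2 : 0 < d / 2 by rewrite divr_gt0.
have hh : \forall l \near tails (pD p), rnorm (amul (e l) x - x) <= d / 2.
  by exact: ((opcvg_repr _ _ (fa_repr f)).2 (pe_cvgl p x) _ d2).
apply: filterS hh => l hl; apply: le_trans (rnorm_triangle (amul (e l) x) _ _) _.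
rewrite -linearBr [d]splitr; apply: lerD => //.
apply: le_trans (amul_rnorm _ _) _; apply: le_trans hl.
by rewrite ler_piMl//; case: (pe_bai p).
Qed.

Lemma pe2_cvgr x : opcvg (tails (pD p)) (fun l => a (amul (amul x (e l)) (e l))) (a x).
Proof.
apply/(opcvg_repr _ _ (fa_repr f)) => d d0; have d2 : 0 < d / 2 by rewrite divr_gt0.
have hh : \forall l \near tails (pD p), rnorm (amul x (e l) - x) <= d / 2.
  by exact: ((opcvg_repr _ _ (fa_repr f)).2 (pe_cvgr p x) _ d2).
apply: filterS hh => l hl; apply: le_trans (rnorm_triangle (amul x (e l)) _ _) _.
rewrite -linearBl [d]splitr; apply: lerD => //.
apply: le_trans (amul_rnorm _ _) _; apply: le_trans hl.
by rewrite ler_piMr//; case: (pe_bai p).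
Qed.

Lemma pP_opbd n : opbd (pP p n) 1.
Proof. by move=> x; rewrite mul1r; exact: (pm_le p). Qed.

Lemma pP_cvg y : opcvg \oo (fun n => pP p n \o u y) (u y).
Proof.
suff h : clspan (prods M (range a)) `<=` [set S : H -> K | opcvg \oo (fun n => pP p n \o S) S].
  exact: h (f_u f y).
apply: clspan_min; first by apply: clsub_opcvg; [exact: pP_bounded|exact: pP_opbd].
move=> _ [S MS] [_ [x _ <-] <-] /=.
have := opcvg_compr (fa_bounded f x) (pm_cvg p MS); apply.
Qed.

(** For fixed [n] the limit in the algebra replaces [RR] by [pP n], since [adj (m j) \o u y] lies in
    [a(A)]; then [n] tends to infinity. *)
Lemma rr_cvg y : ncvg (@pF _ _ _ f p) (fun mu => rr mu y) y.
Proof.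
apply/(opcvg_repr _ _ (fu_repr f)).
have -> : (fun mu : nat * pD p => u (rr mu y)) = (fun mu => RR mu \o u y).
  by apply/funext => mu; rewrite RR_u.
apply: (iter_opcvg _ (pP_cvg y)) => n.
have -> : (fun l => RR (n, l) \o u y) =
    (fun l => \sum_(j < n) (u (w j l) \o pq j l \o u y)).
  by apply/funext => l; apply/funext => h; rewrite /RR /ap /= !sum_fctE.
have -> : pP p n \o u y = \sum_(j < n) (m j \o adj (m j) \o u y).
  by apply/funext => h; rewrite /pP /= !sum_fctE.
apply: opcvg_sum => j.
have [x _ xE] := f_adjMu y (pm_in p j).
have -> : m j \o adj (m j) \o u y = m j \o a x by rewrite xE.
have -> : (fun l => u (w j l) \o pq j l \o u y) = (fun l => m j \o a (amul (e l) (amul (e l) x))).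
  by apply/funext => l; rewrite pwE !fa_mul xE.
by apply: opcvg_compl; [exact: pm_bounded|exact: pe2_cvgl].
Qed.

Lemma adj_pP n : adj (pP p n) = pP p n.
Proof.
rewrite /pP adj_sum => [|i _].
  apply: eq_bigr => i _; rewrite adj_comp ?adjK//; try exact: pm_bounded.
  exact/bounded_adj/pm_bounded.
by apply: bounded_comp; [|apply: bounded_adj]; exact: pm_bounded.
Qed.

Lemma ap_comp (Q Q' : hilbert R) (X : Q -> Q') (T : Y -> H -> Q) (mu : nat * pD p) :
  linear X -> X \o ap T mu = ap (fun y => X \o T y) mu.
Proof.
move=> Xl; apply/funext => h; rewrite /ap /= !sum_fctE (linf_sum Xl).
by apply: eq_bigr.
Qed.

Lemma apB (Q : hilbert R) (S T : Y -> H -> Q) (mu : nat * pD p) :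
  ap S mu - ap T mu = ap (fun y => S y - T y) mu.
Proof.
rewrite /ap -sumrB; apply: eq_bigr => j _.
by apply/funext.
Qed.

Lemma ap_repr_opbd (G : opSpace R) (Q : hilbert R) (v : {linear G -> (H -> Q)}) (T : Y -> G)
    (mu : nat * pD p) c : is_repr (osnorm G) v -> 0 <= c ->
  (forall n (z : 'I_n -> Y), mnorm G (\row_k T (z k)) <= c * mnorm Y (\row_k z k)) ->
  opbd (ap (fun y => v (T y)) mu) c.
Proof.
move=> hv c0 hT; apply: ap_opbd => // [y|]; first exact: bounded_lin (repr_bounded hv _).
apply: (rowbd_repr hv) => // n z z1; apply: le_trans (hT n z) _.
by rewrite ler_piMr.
Qed.

Lemma ap_repr_bounded (G : opSpace R) (Q : hilbert R) (v : {linear G -> (H -> Q)}) (T : Y -> G)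
    (mu : nat * pD p) : is_repr (osnorm G) v -> bounded_op (ap (fun y => v (T y)) mu).
Proof. by move=> hv; apply: ap_bounded => y; exact: (repr_bounded hv). Qed.

Lemma rr_contr mu n k (y : 'M[Y]_(n, k)) : mnorm Y (map_mx (rr (p := p) mu) y) <= mnorm Y y.
Proof.
apply/(repr_mnorm_le (fu_repr f)) => //; rewrite -[mnorm Y y]mul1r.
apply: (mxbd_eq _ (@mxbd_compl _ _ _ _ _ _ _ (fun i j => u (y i j)) 1 (mnorm Y y)
  (bounded_lin (RR_bounded mu)) ler01 (RR_opbd mu) _)) => [i j h|].
  by rewrite mxE -RR_u.
exact/(repr_mnorm_le (fu_repr f)).
Qed.

(** Here [RR] multiplies on the right, where strong convergence on [K] would not do. Instead
    [a x \o adj mm \o m j] lies in [a(A)] by [f_aMM], and [adj mm \o pP n] is the adjoint of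
    [pP n \o mm], which converges in norm. *)
Lemma aM_RR x mm : M mm -> opcvg (@pF _ _ _ f p) (fun mu => a x \o adj mm \o RR mu) (a x \o adj mm).
Proof.
move=> Mm; have mb := fM_bounded Mm.
apply: (@iter_opcvg _ _ _ _ _ _ _ _ _ _ (fun n => a x \o adj mm \o pP p n)) => [n|].
  have -> : (fun l => a x \o adj mm \o RR (n, l)) =
      (fun l => \sum_(j < n) (a x \o adj mm \o u (w j l) \o pq j l)).
    apply/funext => l; apply/funext => h; rewrite /RR /ap /= !sum_fctE.
    by rewrite (linf_sum (bounded_lin (bounded_adj mb))) (linf_sum (bounded_lin (fa_bounded f _))).
  have -> : a x \o adj mm \o pP p n = \sum_(j < n) (a x \o adj mm \o m j \o adj (m j)).
    apply/funext => h; rewrite /pP /= !sum_fctE.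
    by rewrite (linf_sum (bounded_lin (bounded_adj mb))) (linf_sum (bounded_lin (fa_bounded f _))).
  apply: opcvg_sum => j; have [x' _ x'E] := f_aMM x Mm (pm_in p j).
  rewrite -x'E.
  have -> : (fun l => a x \o adj mm \o u (w j l) \o pq j l) =
      (fun l => a (amul (amul x' (e l)) (e l)) \o adj (m j)).
    by apply/funext => l; rewrite pwE !fa_mul x'E.
  by apply: opcvg_compr; [exact/bounded_adj/pm_bounded|exact: pe2_cvgr].
have -> : (fun n => a x \o adj mm \o pP p n) = (fun n => a x \o adj (pP p n \o mm)).
  by apply/funext => n; rewrite adj_comp ?adj_pP//; exact: pP_bounded.
apply: opcvg_compl; first exact: fa_bounded.
apply: opcvg_adj => // [n|]; first by apply: bounded_comp => //; exact: pP_bounded.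
exact: (pm_cvg p Mm).
Qed.

Lemma ap_opcvg (I : Type) (F : set_system I) {FF : Filter F} (Q : hilbert R)
    (T : I -> Y -> H -> Q) T0 mu :
  (forall j, opcvg F (fun i => T i (w j mu.2)) (T0 (w j mu.2))) ->
  opcvg F (fun i => ap (T i) mu) (ap T0 mu).
Proof. by move=> hT; apply: opcvg_sum => j; apply: opcvg_compr => //; exact: pq_bounded. Qed.

Lemma fnl_rnorm x mm : M mm -> exists2 c, 0 <= c & forall n k (y : 'M[Y]_(n, k)),
  mnorm A (map_mx (@fnl _ _ _ f x mm) y) <= c * mnorm Y y.
Proof.
move=> Mm; have /bounded_opP[Xl [c c0 Xc]] := bounded_comp (fa_bounded f x) (adjM_bounded Mm).
exists c => // n k y; apply/(repr_mnorm_le (fa_repr f)); first exact: mulr_ge0.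
apply: (mxbd_eq _ (@mxbd_compl _ _ _ _ _ _ _ (fun i j => u (y i j)) _ (mnorm Y y) Xl c0 Xc _)) => [i j h|].
  by rewrite mxE fnlE.
exact/(repr_mnorm_le (fu_repr f)).
Qed.

Section FnlTilde.
Context (r : rigging Y).

Definition rE b (y : Y) : Y := rPsi b (rPhi (r := r) b y).

Lemma rE_linear b : linear (rE b).
Proof. by move=> c y z; rewrite /rE !linearP. Qed.

Lemma rE_mod b y x : rE b (ract y x) = ract (rE b y) x.
Proof.
rewrite /rE -rPsi_mod; congr (rPsi _ _); apply/funext => k; exact: rPhi_mod.
Qed.

Lemma rE_act b z x : u (rE b (ract z x)) = u (rE b z) \o a x.
Proof. by rewrite rE_mod fu_mod. Qed.

Lemma rE_contr b n k (y : 'M[Y]_(n, k)) : mnorm Y (map_mx (rE b) y) <= mnorm Y y.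
Proof.
have h1 := @rPhi_contr _ _ _ r b _ _ y; have h2 := @rPsi_contr _ _ _ r b _ _ (map_mx (rPhi b) y).
rewrite !mul1r in h1 h2; apply: le_trans h1; apply: le_trans h2.
by rewrite le_eqVlt; apply/orP; left; apply/eqP; congr mnorm; apply/matrixP => i j; rewrite !mxE.
Qed.

Lemma rE_rnorm b y : rnorm (rE b y) <= rnorm y.
Proof.
have := rE_contr b (const_mx y : 'M[Y]_(1, 1)).
by rewrite !mnorm11 !mxE.
Qed.

(** The functional has to converge uniformly along the rigging, although [rE b] converges only
    pointwise. The swap of approximate units is applied to [X = a x \o adj mm], [X' = RR mu'] and
    [P = ap (u \o rE b) nu], an operator on [K] that acts on [u y] as [rE b] after [rr nu]. *)
Lemma fnl_tilde x mm : M mm -> tilde_set r (@fnl _ _ _ f x mm).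
Proof.
move=> Mm; split.
- exact: fnl_linear.
- by move=> y b; exact: fnl_mod.
- by have [c _ hc] := fnl_rnorm x Mm; exists c.
move=> eps e0.
have /bounded_opP[Xl [C C0 XC]] := bounded_comp (fa_bounded f x) (adjM_bounded Mm).
have Xb : bounded_op (a x \o adj mm) by apply: bounded_comp; [exact: fa_bounded|exact: adjM_bounded].
have [d d0 hd] := @approx_unit_swap_exists _ H K _ _ C0 e0.
(* [mu'] is fixed before [b]: it makes [X X'] close to [X], and only the finitely many elements
   [w j mu'.2] then have to be nearly fixed by [rE b]. *)
have [mu' hmu'] := filter_ex (aM_RR x Mm d0).
have d2 : 0 < d / 2 by rewrite divr_gt0.
have hb : opcvg (tails (rdir r)) (fun b => ap (u \o rE b) mu') (RR mu').
  apply: ap_opcvg => j; apply/(opcvg_repr _ _ (fu_repr f))/ncvgP; exact: r_cvg.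
apply: filterS (hb _ d2) => b hbb y.
have hnu : opcvg (@pF _ _ _ f p) (fun nu => ap (u \o rE b \o rr nu) mu') (ap (u \o rE b) mu').
  apply: ap_opcvg => j; apply/(opcvg_repr _ _ (fu_repr f)) => t t0.
  apply: filterS (rr_cvg _ t0) => nu; apply: le_trans.
  by rewrite -(linfB (rE_linear b)); exact: rE_rnorm.
have [c0 c00 hc0] := fnl_rnorm x Mm.
have hP (nu : nat * pD p) : ap (u \o rE b) nu \o RR mu' = ap (u \o rE b \o rr nu) mu'.
  rewrite /RR {2 3}/ap; apply/funext => h; rewrite /= !sum_fctE.
  rewrite (linf_sum (bounded_lin (ap_bounded _ _))) => [|z]; last exact: fu_bounded.
  apply: eq_bigr => j _ /=.
  have /(congr1 (fun T => T (pq j mu'.2 h))) := @ap_u _ _ _ f p _ _ u (rE b) nu (w j mu'.2)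
     (linearP _) (rE_linear b) (rE_act b).
  by [].
(* The bound obtained for [rr nu y] passes to [y] in the limit along [nu]. *)
apply: (@rnorm_lim_le _ _ _ (@pF _ _ _ f p) _ (fun nu => @fnl _ _ _ f x mm (rE b (rr nu y)) - @fnl _ _ _ f x mm y)).
  have c1 : 0 < c0 + 1 by rewrite ltr_wpDl.
  move=> t t0; apply: filterS (rr_cvg y (divr_gt0 t0 c1)) => nu hn.
  rewrite opprB addrA subrK -(linfB (fnl_linear x Mm)) -(linfB (rE_linear b)).
  have := hc0 _ _ (const_mx (rE b (rr nu y - y)) : 'M[Y]_(1, 1)).
  rewrite !mnorm11 !mxE => /le_trans; apply.
  apply: le_trans (ler_wpM2l c00 (rE_rnorm _ _)) _.
  apply: le_trans (ler_wpM2l c00 hn) _; rewrite mulrCA ler_piMr ?(ltW t0)//.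
  by rewrite ler_pdivrMr// mul1r lerDl.
apply: filterS (hnu _ d2) => nu hn.
have key : opbd ((a x \o adj mm \o ap (u \o rE b) nu) - (a x \o adj mm)) eps.
  apply: (hd _ (RR mu')) => //.
  - exact: RR_bounded.
  - by apply: ap_bounded => z; exact: fu_bounded.
  - exact: RR_opbd.
  - apply: ap_opbd => // [z|]; first exact: bounded_lin (fu_bounded f _).
    apply: (rowbd_repr (fu_repr f)) => // n z; apply: le_trans.
    apply: le_trans (rE_contr b _); rewrite le_eqVlt; apply/orP; left; apply/eqP.
    by congr mnorm; apply/matrixP => i j; rewrite !mxE.
  - move=> h; rewrite hP; apply: le_trans (rnorm_triangle (ap (u \o rE b) mu' h) _ _) _.
    by rewrite [d]splitr mulrDl; exact: lerD.
apply/(repr_opbd (fa_repr f)); first by rewrite mulr_ge0// ltW.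
move=> h; rewrite linearB !fnlE//.
have <- := @ap_u _ _ _ f p _ _ u (rE b) nu y
     (linearP _) (rE_linear b) (rE_act b).
apply: le_trans (key _) _.
by rewrite -mulrA ler_wpM2l ?(ltW e0)// (repr_opbd_norm (fu_repr f)).
Qed.

End FnlTilde.
End ApproximateIdentity.

(** * The Haagerup tensor product *)

Section BilinearMaps.
Context {R : realType} (U V W : lmodType R[i]) (t : U -> V -> W).
Hypothesis tl : (forall y, linear (t^~ y)) * (forall x, linear (t x)).

(** The linearity proof is an argument so that the instance below has a term, [bil_fun tl], to
    attach to. *)
Definition bil_fun of ((forall y, linear (t^~ y)) * (forall x, linear (t x)))%type := t.

HB.instance Definition _ := bilinear_isBilinear.Build R[i] U V W _ _ (bil_fun tl) tl.

Definition bil : {bilinear U -> V -> W} := bil_fun tl.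

End BilinearMaps.

Section Haagerup.
Context {R : realType} (X Y Z : opSpace R) (B : Type).
Context (rB : X -> B -> X) (lB : B -> Y -> Y) (t : {bilinear X -> Y -> Z}).
Hypothesis ht : is_haagerup rB lB t.

Let hset m n p (x : 'M[X]_(m, p)) (y : 'M[Y]_(p, n)) : set R :=
  [set c : R | exists q (x' : 'M[X]_(m, q)) (y' : 'M[Y]_(q, n)),
         bal_tens_eq rB lB x y x' y' /\ c = mnorm X x' * mnorm Y y'].

Lemma hset_inf m n p (x : 'M[X]_(m, p)) (y : 'M[Y]_(p, n)) : has_inf (hset x y).
Proof.
split; first by exists (mnorm X x * mnorm Y y), p, x, y.
by exists 0 => _ [q [x' [y' [_ ->]]]]; rewrite mulr_ge0.
Qed.

Lemma haag_le m n p (x : 'M[X]_(m, p)) (y : 'M[Y]_(p, n)) :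
  mnorm Z (mxmul t x y) <= mnorm X x * mnorm Y y.
Proof.
rewrite (haag_norm ht); apply: ge_inf; first by case: (hset_inf x y).
by exists p, x, y.
Qed.

Lemma haag_approx m n p (x : 'M[X]_(m, p)) (y : 'M[Y]_(p, n)) (e : R) : 0 < e ->
  exists q (x' : 'M[X]_(m, q)) (y' : 'M[Y]_(q, n)),
    bal_tens_eq rB lB x y x' y' /\ mnorm X x' * mnorm Y y' <= mnorm Z (mxmul t x y) + e.
Proof.
move=> e0; have [c [q [x' [y' [h ->]]]] /ltW hc] := inf_adherent e0 (hset_inf x y).
by exists q, x', y'; split => //; rewrite (haag_norm ht).
Qed.

Lemma haag_ind (N : set Z) : nclosed N -> (forall x y, N (t x y)) -> forall z, N z.
Proof.
move=> Nn Nt z; have [_ _ Nc] := Nn; apply: Nc => e e0.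
have eC : 0 < e%:C :> R[i] by rewrite ltcR.
have [z' [zz' [n [x [y z'E]]]]] := haag_dense ht (ex_intro _ z (ballxx z eC)) (ball_open z e%:C).
exists z'; first by rewrite z'E; exact: nclosed_sum.
have : ball_ Num.norm z e%:C z' by rewrite ball_normE.
by rewrite /ball_ /= rnormE ltcR; exact: ltW.
Qed.

Lemma haag_tens_eq (V : lmodType R[i]) (s : X -> Y -> V) m n p q
    (x : 'M[X]_(m, p)) (y : 'M[Y]_(p, n)) (x' : 'M[X]_(m, q)) (y' : 'M[Y]_(q, n)) :
  (forall y, linear (s^~ y)) -> (forall x, linear (s x)) -> balanced rB lB s ->
  bal_tens_eq rB lB x y x' y' -> mxmul s x y = mxmul s x' y'.
Proof.
by move=> sl sr sb h; have := h V (bil (t := s) (sl, sr)) sb.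
Qed.

Lemma haag_rnorm x y : rnorm (t x y) <= rnorm x * rnorm y.
Proof.
have := haag_le (const_mx x : 'M[X]_(1, 1)) (const_mx y : 'M[Y]_(1, 1)).
by rewrite !mnorm11 !mxE big_ord1 !mxE.
Qed.

End Haagerup.

(** * The dual module *)

Section Dual.
Context {R : realType} (A : opAlg R) (Y : rmod A) (r : rigging Y) (Yt : tilde r).
Local Notation ev := (tev Yt).

Lemma tev_tilde g : tilde_set r (ev g).
Proof. by rewrite -(tev_range Yt); exists g. Qed.

Lemma tev_linear g : linear (ev g).
Proof. by case: (tev_tilde g). Qed.

Lemma tev_mod g y x : ev g (ract y x) = amul (ev g y) x.
Proof. by case: (tev_tilde g). Qed.

Lemma tev_linear_in y : linear (fun g => ev g y).
Proof. by move=> c g h; rewrite linearP. Qed.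

Lemma tev_surj g : tilde_set r g -> exists h, ev h = g.
Proof. by rewrite -(tev_range Yt) => -[h _ <-]; exists h. Qed.

Lemma tev_block m n k q (h : 'M[Yt]_(m, n)) (z : 'M[Y]_(k, q)) :
  mnorm A (\mxblock_(i < k, j < q) (\matrix_(i' < m, j' < n) ev (h i' j') (z i j)))
    <= mnorm Yt h * mnorm Y z.
Proof.
have hE := tev_isom h; rewrite /cb_mxnorm in hE.
set S := [set c | _] in hE.
have [S0|S0] := pselect (S !=set0).
  apply/ler_addgt0Pl => e e0.
  have z1 : 0 < mnorm Y z + 1 by rewrite ltr_wpDl.
  have hS : has_inf S by split => //; exists 0 => c [].
  have [c [c0 hc] cinf] := inf_adherent (divr_gt0 e0 z1) hS.
  have := hc k q z.
  rewrite (_ : \mxblock_(i, j) _ = \mxblock_(i < k, j < q) (\matrix_(i' < m, j' < n) ev (h i' j') (z i j))); last first.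
    by apply/matrixP => i j; rewrite !mxE.
  move=> /le_trans; apply; apply: le_trans (ler_wpM2r _ (ltW cinf)) _ => //.
  rewrite hE mulrDl addrC lerD2r mulrAC ler_pdivrMr// ler_wpM2l ?(ltW e0)// lerDl//.
(* The infimum of an empty set is 0, so in the absence of any bound [c] the isometry [hE] forces
   [h = 0]. *)
have h0 i j : h i j = 0.
  apply: rnorm0_eq0; apply/eqP; rewrite eq_le rnorm_ge0 andbT.
  apply: le_trans (mnorm_entry h i j) _.
  by rewrite -hE (_ : S = set0) ?inf0//; apply/eqP/negPn/negP => /set0P.
have -> : \mxblock_(i < k, j < q) (\matrix_(i' < m, j' < n) ev (h i' j') (z i j)) = 0.
  by apply/matrixP => i j; rewrite !mxE h0 linear0.
apply: (@le_trans _ _ 0); last exact: mulr_ge0.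
apply: le_trans (mnorm_entries_le (lexx 0) _) _; last by rewrite mulr0.
by move=> i j; rewrite mxE rnorm0.
Qed.

End Dual.

(** * The representation of [E] *)

Section Morita.
Context {R : realType} (A B : opAlg R) (Y : rmod A) (r : rigging Y) (Yt : tilde r).
Context (l : {bilinear B -> Y -> Y}) (lt : {bilinear A -> Yt -> Yt}) (rt : {bilinear Yt -> B -> Yt}).
Context (tB : {bilinear Y -> Yt -> B}).
Local Notation ev := (tev Yt).
Hypothesis l_act : is_left_action l.
Hypothesis ltE : forall x g y, ev (lt x g) y = amul x (ev g y).
Hypothesis rtE : forall g b y, ev (rt g b) y = ev g (l b y).
Hypothesis tB_haag : is_haagerup (@ract R A Y) lt tB.
Hypothesis tB_l : forall b y g, tB (l b y) g = amul b (tB y g).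
Hypothesis tB_r : forall y g b, tB y (rt g b) = amul (tB y g) b.

Lemma tB_ract y x g : tB (ract y x) g = tB y (lt x g).
Proof. exact: (haag_balanced tB_haag). Qed.

Lemma ract_linear1 x : linear (fun y : Y => ract y x).
Proof. by move=> c y z; rewrite linearDl linearZl_LR. Qed.

Lemma ract_linear2 (y : Y) : linear (ract y).
Proof. by move=> c x z; rewrite linearDr linearZr_LR. Qed.

(** For fixed [z], [(y, g) |-> ract y (ev g z)] is balanced, so the sum depends only on the tensor;
    a nearly optimal Haagerup factorization then bounds the row by the norm of the tensor in [B]. *)
Lemma rank_one_row n (y : 'I_n -> Y) (h : 'I_n -> Yt) k (z : 'I_k -> Y) :
  mnorm Y (\row_j \sum_i ract (y i) (ev (h i) (z j))) <=
  rnorm (\sum_i tB (y i) (h i)) * mnorm Y (\row_j z j).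
Proof.
have nz0 : 0 <= mnorm Y (\row_j z j) by [].
apply/ler_addgt0Pl => e e0.
have d0 : 0 < e / (mnorm Y (\row_j z j) + 1) by rewrite divr_gt0// ltr_wpDl.
have [q [y' [h' [tens le]]]] := haag_approx tB_haag (\row_i y i) (\col_i h i) d0.
have tE j : \sum_i ract (y i) (ev (h i) (z j)) = \sum_i ract (y' ord0 i) (ev (h' i ord0) (z j)).
  have : mxmul (fun y g => ract y (ev g (z j))) (\row_i y i) (\col_i h i) =
      mxmul (fun y g => ract y (ev g (z j))) y' h'.
    apply: (haag_tens_eq _ _ _ tens) => [g|x c g g'|y0 x g].
    - exact: ract_linear1.
    - by rewrite tev_linear_in ract_linear2.
    - by rewrite ractA ltE.
  move=> /matrixP/(_ ord0 ord0); rewrite !mxE => <-.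
  by apply: eq_bigr => i _; rewrite !mxE.
have -> : \row_j (\sum_i ract (y i) (ev (h i) (z j))) =
    mxmul ract y' (\matrix_(i, j) ev (h' i ord0) (z j)).
  apply/matrixP => i j; rewrite (ord1 i) !mxE tE; apply: eq_bigr => s _.
  by rewrite mxE.
apply: le_trans (ract_contr _ _) _.
have hA : mnorm A (\matrix_(i, j) ev (h' i ord0) (z j)) <= mnorm Yt h' * mnorm Y (\row_j z j).
  have [HA [KA [a [ha _]]]] : exists (H K : hilbert R) (a : {linear A -> (H -> K)}), is_repr (osnorm A) a /\ True.
    by have [H [K [a ha]]] := mnorm_repr A; exists H, K, a.
  have h1 := tev_block h' (\row_j z j).
  move/(cb_block_le ha (fun i' j' => ev (h' i' j'))) : h1.
  move/(_ (mulr_ge0 (mnorm_ge0 _) (mnorm_ge0 _))) => h1.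
  apply/(repr_mnorm_le ha); first exact: mulr_ge0.
  have i1 : injective (fun i : 'I_q => (ord0 : 'I_1, i)) by move=> i i' [].
  have i2 : injective (fun i : 'I_k => (i, ord0 : 'I_1)) by move=> i i' [].
  have := mxbd_sub _ i1 i2 h1; move=> h2.
  apply: (mxbd_eq _ (h2 _)) => [i j x|i j]; first by rewrite !mxE.
  exact: bounded_lin (repr_bounded ha _).
apply: le_trans (ler_wpM2l (mnorm_ge0 _) hA) _; rewrite mulrA.
apply: le_trans (ler_wpM2r nz0 le) _.
rewrite mnorm11 mxE mulrDl addrC.
have -> : \sum_j tB ((\row_i y i) ord0 j) ((\col_i h i) j ord0) = \sum_i tB (y i) (h i).
  by apply: eq_bigr => i _; rewrite !mxE.
rewrite lerD2r mulrAC ler_pdivrMr ?ltr_wpDl// ler_wpM2l ?(ltW e0)// lerDl//.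
Qed.

Lemma rank_one_rnorm y h z : rnorm (ract y (ev h z)) <= rnorm (tB y h) * rnorm z.
Proof.
have := rank_one_row (fun _ : 'I_1 => y) (fun _ : 'I_1 => h) (fun _ : 'I_1 => z).
by rewrite !mnorm11 !mxE !big_ord1.
Qed.

(* Nothing says that [tB y g] acts on [Y] as the rank one map [z |-> y g(z)]
   (an automorphism of [B] may intervene); this weaker symmetry follows from the
   norm estimate alone. *)
Lemma tB_swap y g y' g' z :
  ract (l (tB y g) y') (ev g' z) = ract y (ev g (l (tB y' g') z)).
Proof.
apply/subr0_eq/rnorm0_eq0/eqP; rewrite eq_le rnorm_ge0 andbT.
(* The two terms cancel in [B]: [tB_l] and [tB_r] turn both into [amul (tB y g) (tB y' g')] up to
   sign, so [rank_one_row] gives the bound 0. *)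
pose yy (i : 'I_2) := if i == ord0 then l (tB y g) y' else - y.
pose gg (i : 'I_2) := if i == ord0 then g' else rt g (tB y' g').
have := rank_one_row yy gg (fun _ : 'I_1 => z).
rewrite !mnorm11 !mxE !big_ord_recl !big_ord0 !addr0 /yy /gg /=.
rewrite linearNl linearNl tB_l tB_r subrr rnorm0 mul0r rtE.
by [].
Qed.

Context (f : frame Y) (p : approximants f).
Local Notation H := (fH f).
Local Notation K := (fK f).
Local Notation a := (fa f).
Local Notation u := (fu f).
Local Notation M := (@fM _ _ _ f).
Local Notation m := (@pm _ _ _ f p).
Local Notation e := (@pe _ _ _ f p).
Local Notation w := (@pw _ _ _ f p).

(** [rr mu z] is a sum of terms [ract y (ev g z)] because the functionals [fnl] belong to the dual
    module. *)
Lemma Y_ind (N : set Y) : nclosed N -> (forall y g z, N (ract y (ev g z))) -> forall z, N z.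
Proof.
move=> Nn Nr z; apply: (nclosed_lim Nn _ (rr_cvg p z)) => mu.
apply: nclosed_sum => // j.
have [g gE] := tev_surj Yt (fnl_tilde p r (e mu.2) (pm_in p j)).
by rewrite -gE; exact: Nr.
Qed.

Lemma l_rnorm b y : rnorm (l b y) <= rnorm b * rnorm y.
Proof.
have := lact_contr l_act (const_mx b : 'M[B]_(1, 1)) (const_mx y : 'M[Y]_(1, 1)).
by rewrite !mnorm11 !mxE big_ord1 !mxE.
Qed.

Lemma ract_rnorm (G : rmod A) (y : G) x : rnorm (ract y x) <= rnorm y * rnorm x.
Proof.
have := ract_contr (const_mx y : 'M[G]_(1, 1)) (const_mx x : 'M[A]_(1, 1)).
by rewrite !mnorm11 !mxE big_ord1 !mxE.
Qed.

Lemma ev_rnorm g z : rnorm (ev g z) <= rnorm g * rnorm z.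
Proof.
have h1 := tev_block (const_mx g : 'M[Yt]_(1, 1)) (const_mx z : 'M[Y]_(1, 1)).
rewrite !mnorm11 !mxE in h1.
apply: le_trans h1; apply: le_trans (mnorm_entry _ (pack (ord0, ord0)) (pack (ord0, ord0))).
by rewrite !mxE.
Qed.

(** Elements of [B] of this form act as rank one maps, with [y0 g0(y1)] replaced by [tB y0 g0]
    acting on [y1]. This takes the place of the rank one formula for [tB]. *)
Lemma tB_twist y0 g0 y1 g1 z :
  l (tB (ract y0 (ev g0 y1)) g1) z = ract (l (tB y0 g0) y1) (ev g1 z).
Proof.
apply/subr0_eq.
pose T z := l (tB (ract y0 (ev g0 y1)) g1) z - ract (l (tB y0 g0) y1) (ev g1 z).
have Tl : linear T.
  move=> c x x'; rewrite /T linearPr (tev_linear g1) ract_linear2 scalerBr opprD.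
  by rewrite addrACA.
have N0 : nclosed [set z | [set 0 : Y] (T z)].
  pose c := rnorm (tB (ract y0 (ev g0 y1)) g1) + rnorm (l (tB y0 g0) y1) * rnorm g1.
  apply: (@nclosed_preim _ _ _ T c) => // [x|].
    rewrite /T; apply: le_trans (rnormD _ _) _; rewrite rnormN mulrDl lerD ?l_rnorm//.
    by apply: le_trans (ract_rnorm _ _) _; rewrite -mulrA ler_wpM2l// ev_rnorm.
  split => [//|k x y -> ->|x hx] /=; first by rewrite scaler0 addr0.
  apply: rnorm0_eq0; apply/eqP; rewrite eq_le rnorm_ge0 andbT.
  by apply/ler_addgt0Pl => d d0; have [y ->] := hx _ d0; rewrite subr0 addr0.
apply: (Y_ind N0) z => y3 g3 y4 /=; rewrite /T.
(* By swaps, both sides become [y0 g0(y1 g1(b y4))] with [b = tB y3 g3]. *)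
rewrite (lact_ract l_act) tB_swap ractA (tev_mod g1) -(ractA (l (tB y0 g0) y1)).
have -> : ract (ract (l (tB y0 g0) y1) (ev g1 y3)) (ev g3 y4) =
  ract y0 (ev g0 (ract y1 (ev g1 (l (tB y3 g3) y4)))).
  by rewrite tB_swap ractA -tev_mod tB_swap.
by rewrite tev_mod subrr.
Qed.

Lemma ev_row g k (z : 'I_k -> Y) :
  mnorm A (\row_j ev g (z j)) <= rnorm g * mnorm Y (\row_j z j).
Proof.
have := tev_block (const_mx g : 'M[Yt]_(1, 1)) (\row_j z j).
rewrite mnorm11 mxE; apply: le_trans.
pose h1 (i : 'I_1) := pack (i, ord0 : 'I_1).
pose h2 (j : 'I_k) := pack (j, ord0 : 'I_1).
have i1 : injective h1 by move=> i i' /(can_inj (@packK 1 1)) [].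
have i2 : injective h2 by move=> i i' /(can_inj (@packK k 1)) [].
apply: le_trans (mnorm_sub _ i1 i2).
rewrite le_eqVlt; apply/orP; left; apply/eqP; congr mnorm; apply/matrixP => i j.
rewrite !mxE /h2; have := packK (j, ord0 : 'I_1); rewrite /unpack => -[-> _].
by [].
Qed.

Lemma l_row b k (z : 'I_k -> Y) :
  mnorm Y (\row_j l b (z j)) <= rnorm b * mnorm Y (\row_j z j).
Proof.
have := lact_contr l_act (const_mx b : 'M[B]_(1, 1)) (\row_j z j).
rewrite mnorm11 mxE; apply: le_trans; rewrite le_eqVlt; apply/orP; left; apply/eqP.
by congr mnorm; apply/matrixP => i j; rewrite !mxE big_ord1 !mxE.
Qed.

Lemma ract_row y k (x : 'I_k -> A) :
  mnorm Y (\row_j ract y (x j)) <= rnorm y * mnorm A (\row_j x j).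
Proof.
have := ract_contr (const_mx y : 'M[Y]_(1, 1)) (\row_j x j).
rewrite mnorm11 mxE; apply: le_trans; rewrite le_eqVlt; apply/orP; left; apply/eqP.
by congr mnorm; apply/matrixP => i j; rewrite !mxE big_ord1 !mxE.
Qed.

Lemma rr_row mu k (z : 'I_k -> Y) :
  mnorm Y (\row_j rr (p := p) mu (z j)) <= mnorm Y (\row_j z j).
Proof.
apply: le_trans (rr_contr mu _); rewrite le_eqVlt; apply/orP; left; apply/eqP.
by congr mnorm; apply/matrixP => i j; rewrite !mxE.
Qed.

Context (DB : directed) (eB : DB -> B).
Hypothesis eB_bai : is_bai eB 1.

Lemma eB_cvgl b : ncvg (tails DB) (fun i => amul (eB i) b) b.
Proof. by apply/ncvgP; case: eB_bai => _ h _; exact: h. Qed.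

Lemma eB_cvgr b : ncvg (tails DB) (fun i => amul b (eB i)) b.
Proof. by apply/ncvgP; case: eB_bai => _ _ h; exact: h. Qed.

Lemma eB_le1 i : rnorm (eB i) <= 1.
Proof. by case: eB_bai. Qed.

Lemma l_linear b : linear (l b).
Proof. by move=> c x y; rewrite linearPr. Qed.

(** On [y g(z)] the error is bounded, through [rank_one_rnorm], by the error of the approximate
    identity at [tB y g] in [B]. *)
Lemma l_bai y : ncvg (tails DB) (fun i => l (eB i) y) y.
Proof.
move: y; apply: Y_ind => [|y g z].
  apply: nclosed_cvg => [i|i x]; first exact: l_linear.
  by apply: le_trans (l_rnorm _ _) _; rewrite ler_piMl ?eB_le1.
move=> d d0; have z1 : 0 < rnorm z + 1 by rewrite ltr_wpDl.
apply: filterS (eB_cvgl (tB y g) (divr_gt0 d0 z1)) => i hi.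
rewrite (lact_ract l_act) -(linfB (ract_linear1 (ev g z))).
apply: le_trans (rank_one_rnorm _ _ _) _.
rewrite linearBl tB_l; apply: le_trans (ler_wpM2r _ hi) _ => //.
by rewrite mulrAC ler_pdivrMr// ler_wpM2l ?(ltW d0)// lerDl.
Qed.

Lemma B_ind (N : set B) : nclosed N ->
  (forall y0 g0 y1 g1, N (tB (ract y0 (ev g0 y1)) g1)) -> forall b, N b.
Proof.
move=> Nn Nt; apply: (haag_ind tB_haag) => // y g; move: y.
apply: (Y_ind (N := [set y | N (tB y g)])) => [|y0 g0 y1]; last exact: Nt.
apply: (@nclosed_preim _ _ _ (tB^~ g) (rnorm g)) => // [c x y|x]; first by rewrite linearPl.
by rewrite mulrC; exact: haag_rnorm tB_haag _ _.
Qed.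

(** The factor [g'(y')], moved from the left leg to the right one by balancing, is what [dual_lim]
    requires of the functional. *)
Lemma B_ind2 (N : set B) : nclosed N ->
  (forall y0 g0 y1 g' y' g, N (tB (ract y0 (ev g0 y1)) (lt (ev g' y') g))) -> forall b, N b.
Proof.
move=> Nn Nt; apply: (B_ind Nn) => y0 g' y' g; rewrite tB_ract; move: y0.
apply: (Y_ind (N := [set y | N (tB y (lt (ev g' y') g))])) => [|y0 g0 y1]; last exact: Nt.
apply: (@nclosed_preim _ _ _ (tB^~ _) (rnorm (lt (ev g' y') g))) => // [c x y|x].
  by rewrite linearPl.
by rewrite mulrC; exact: haag_rnorm tB_haag _ _.
Qed.

(** [rr nu] converges pointwise on [Y], but uniformly after the action of a fixed [b]: on the
    generators of [B_ind], [tB_twist] makes that action rank one, so the error is governed by that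
    of [rr nu] at a single element. *)
Lemma rr_l_cvg b (d : R) : 0 < d -> \forall nu \near @pF _ _ _ f p,
  forall k (z : 'I_k -> Y), mnorm Y (\row_j (rr nu (l b (z j)) - l b (z j))) <= d * mnorm Y (\row_j z j).
Proof.
move=> d0; move: b d d0.
pose D := [set b | forall d, 0 < d -> \forall nu \near @pF _ _ _ f p,
  forall k (z : 'I_k -> Y), mnorm Y (\row_j (rr nu (l b (z j)) - l b (z j))) <= d * mnorm Y (\row_j z j)].
apply: (B_ind (N := D)).
  split.
  - move=> d d0; apply: filterE => nu k z.
    apply: le_trans (mnorm_entries_le (lexx 0) _) _; last by rewrite mulr0 mulr_ge0// ltW.
    by move=> i j; rewrite mxE !linear0l (linf0 (rr_linear nu)) subrr rnorm0.
  - move=> c b b' hb hb' d d0.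
    pose n := complex.Re `|c|; have n0 : 0 <= n by exact: Re_norm_ge0.
    have d1 : 0 < d / (n + 1) by rewrite divr_gt0// ltr_wpDl.
    apply: filterS2 (hb _ d1) (hb' _ d1) => nu h1 h2 k z.
    have -> : \row_j (rr nu (l (c *: b + b') (z j)) - l (c *: b + b') (z j)) =
       map_mx (fun y => c *: y) (\row_j (rr nu (l b (z j)) - l b (z j))) +
       \row_j (rr nu (l b' (z j)) - l b' (z j)).
      apply/matrixP => i j; rewrite !mxE linearPl rr_linear opprD addrACA -scalerBr//.
    apply: le_trans (mnormD _ _) _.
    apply: le_trans (lerD (mnormZ _ _) (h2 k z)) _.
    apply: le_trans (lerD (ler_wpM2l n0 (h1 k z)) (lexx _)) _.
    rewrite -/n le_eqVlt; apply/orP; left; apply/eqP; field.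
    by rewrite gt_eqF// ltr_wpDl.
  move=> b hb d d0; have d3 : 0 < d / 3 by rewrite divr_gt0.
  have [b' hb' bb'] := hb _ d3; apply: filterS (hb' _ d3) => nu h1 k z.
  have -> : \row_j (rr nu (l b (z j)) - l b (z j)) =
     \row_j rr nu (l (b - b') (z j)) +
     (\row_j (rr nu (l b' (z j)) - l b' (z j)) + \row_j l (b' - b) (z j)).
    apply/matrixP => i j; rewrite !mxE !linearBl (linfB (rr_linear nu)).
    by rewrite [X in _ = _ + X]subrKA subrKA.
  set nz := mnorm Y (\row_j z j).
  have nz0 : 0 <= nz by exact: mnorm_ge0.
  have e1 : mnorm Y (\row_j rr nu (l (b - b') (z j))) <= d / 3 * nz.
    apply: le_trans (rr_row _ _) _; apply: le_trans (l_row _ _) _.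
    by rewrite ler_wpM2r.
  have e2 : mnorm Y (\row_j l (b' - b) (z j)) <= d / 3 * nz.
    by apply: le_trans (l_row _ _) _; rewrite ler_wpM2r// rnormBC.
  apply: le_trans (mnormD _ _) _; apply: le_trans (lerD e1 (mnormD _ _)) _.
  by have := h1 k z; rewrite -/nz; lra.
move=> y0 g0 y1 g1 d d0.
have g11 : 0 < rnorm g1 + 1 by rewrite ltr_wpDl.
apply: filterS (rr_cvg p (l (tB y0 g0) y1) (divr_gt0 d0 g11)) => nu h k z.
have -> : \row_j (rr nu (l (tB (ract y0 (ev g0 y1)) g1) (z j)) - l (tB (ract y0 (ev g0 y1)) g1) (z j)) =
    \row_j ract (rr nu (l (tB y0 g0) y1) - l (tB y0 g0) y1) (ev g1 (z j)).
  by apply/matrixP => i j; rewrite !mxE tB_twist rr_mod linearBl.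
apply: le_trans (ract_row _ _) _.
apply: le_trans (ler_wpM2l (rnorm_ge0 _) (ev_row _ _)) _.
rewrite mulrA ler_wpM2r//.
apply: le_trans (ler_wpM2r _ h) _ => //.
by rewrite mulrAC ler_pdivrMr// ler_wpM2l ?(ltW d0)// lerDl.
Qed.

(** The difference is [g'(y' (g b - g)(z))]; by [rank_one_row] its inner part is bounded by the norm
    of [tB y' (g b - g)], which [tB_r] computes. *)
Lemma dual_bai_row g' y' g b k (z : 'I_k -> Y) :
  mnorm A (\row_j (ev (lt (ev g' y') g) (l b (z j)) - ev (lt (ev g' y') g) (z j))) <=
  rnorm g' * rnorm (amul (tB y' g) b - tB y' g) * mnorm Y (\row_j z j).
Proof.
have -> : \row_j (ev (lt (ev g' y') g) (l b (z j)) - ev (lt (ev g' y') g) (z j)) =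
    \row_j ev g' (ract y' (ev (rt g b - g) (z j))).
  apply/matrixP => i j; rewrite !mxE !ltE tev_mod -linearBr; congr (amul _ _).
  by rewrite linearB /= -rtE.
apply: le_trans (ev_row _ _) _; rewrite -mulrA ler_wpM2l//.
have := rank_one_row (fun _ : 'I_1 => y') (fun _ : 'I_1 => rt g b - g) z.
rewrite big_ord1 linearBr tB_r; apply: le_trans; rewrite le_eqVlt; apply/orP; left.
by apply/eqP; congr mnorm; apply/matrixP => i j; rewrite !mxE big_ord1.
Qed.

(** Cauchy argument by the swap of approximate units, with [X] the approximant at [nu], [X'] the
    operator at [nu] built from the action of [eB i], and [P = RR mu0]. It gives [X] close to
    [X \o P], which converges along [nu] because [mu0] is fixed and involves finitely many elements
    of [Y]. *)
Lemma dual_lim g' y' g : exists v,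
  opcvg (@pF _ _ _ f p) (fun nu => ap (fun y => a (ev (lt (ev g' y') g) y)) nu) v.
Proof.
set g1 := lt (ev g' y') g; set b := tB y' g.
have gl := tev_linear g1.
apply: opcvg_lim => d d0; have d2 : 0 < d / 2 by rewrite divr_gt0.
have [t t0 ht] := @approx_unit_swap_exists _ H K _ _ (rnorm_ge0 g1) d2.
have g'1 : 0 < 2 * (rnorm g' + 1) by rewrite mulr_gt0// ltr_wpDl.
(* The order of choices is [eB i], [mu0], [nu]: the unit must nearly fix [g1], then [rr mu0] must be
   uniformly close to the identity after the action of that unit. *)
have [i hi] := filter_ex (eB_cvgr b (divr_gt0 t0 g'1)).
set be := eB i in hi.
have g11 : 0 < 2 * (rnorm g1 + 1) by rewrite mulr_gt0// ltr_wpDl.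
have [mu0 hmu0] := filter_ex (rr_l_cvg be t0).
exists (ap (fun y => a (ev g1 y)) mu0).
have hlim : opcvg (@pF _ _ _ f p) (fun nu => ap (fun y => a (ev g1 (rr nu y))) mu0)
    (ap (fun y => a (ev g1 y)) mu0).
  apply: ap_opcvg => j; apply/(opcvg_repr _ _ (fa_repr f)) => s s0.
  have g12 : 0 < rnorm g1 + 1 by rewrite ltr_wpDl.
  apply: filterS (rr_cvg p (w j mu0.2) (divr_gt0 s0 g12)) => nu hn.
  rewrite -(linfB gl); apply: le_trans (ev_rnorm _ _) _.
  apply: le_trans (ler_wpM2l (rnorm_ge0 _) hn) _.
  by rewrite mulrCA ler_piMr ?(ltW s0)// ler_pdivrMr// mul1r lerDl.
have apu nu y : ap (fun y => a (ev g1 y)) nu \o u y = a (ev g1 (rr (p := p) nu y)).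
  apply: (@ap_u _ _ _ f p _ A a (ev g1)) => // [|z x]; first exact: linearP.
  by rewrite tev_mod fa_mul.
apply: filterS2 (rr_l_cvg be (divr_gt0 t0 g11)) (hlim _ d2) => nu h1 h2 x.
have key : opbd (ap (fun y => a (ev g1 y)) nu \o RR mu0 - ap (fun y => a (ev g1 y)) nu) (d / 2).
  apply: (ht _ (ap (fun y => u (l be y)) nu)).
  - exact: ap_repr_bounded (fa_repr f).
  - exact: ap_repr_bounded (fu_repr f).
  - exact: RR_bounded.
  - by apply: (ap_repr_opbd _ (fa_repr f)) => // n z; exact: ev_row.
  - apply: (ap_repr_opbd _ (fu_repr f)) => // n z; apply: le_trans (l_row _ _) _.
    by rewrite ler_wpM2r// eB_le1.
  - exact: RR_opbd.
  (* [X X'] is close to [X]: [rr nu] hardly moves [l be y], and [be] hardly moves [g1] by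
     [dual_bai_row]. *)
  - rewrite ap_comp; last exact: bounded_lin (ap_repr_bounded _ _ (fa_repr f)).
    rewrite apB.
    have -> : (fun y => ap (fun y => a (ev g1 y)) nu \o u (l be y) - a (ev g1 y)) =
        (fun y => a (ev g1 (rr nu (l be y)) - ev g1 y)).
      by apply/funext => y; rewrite apu linearB.
    apply: (ap_repr_opbd _ (fa_repr f)); first exact: ltW.
    move=> n z.
    have -> : \row_k (ev g1 (rr nu (l be (z k))) - ev g1 (z k)) =
       \row_k ev g1 (rr nu (l be (z k)) - l be (z k)) + \row_k (ev g1 (l be (z k)) - ev g1 (z k)).
      by apply/matrixP => i' j'; rewrite !mxE (linfB gl) subrKA.
    apply: le_trans (mnormD _ _) _.
    apply: le_trans (lerD (ev_row _ _) (dual_bai_row _ _ _ _ _)) _.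
    apply: le_trans (lerD (ler_wpM2l (rnorm_ge0 _) (h1 _ z)) (ler_wpM2r _ (ler_wpM2l (rnorm_ge0 _) hi))) _ => //.
    set nz := mnorm Y _; have nz0 : 0 <= nz by exact: mnorm_ge0.
    have e1 : rnorm g1 * (t / (2 * (rnorm g1 + 1))) <= t / 2.
      rewrite mulrA ler_pdivrMr//; have := rnorm_ge0 g1; have := t0; nra.
    have e2 : rnorm g' * (t / (2 * (rnorm g' + 1))) <= t / 2.
      rewrite mulrA ler_pdivrMr//; have := rnorm_ge0 g'; have := t0; nra.
    have := ler_wpM2r nz0 e1; have := ler_wpM2r nz0 e2; lra.
  - rewrite ap_comp; last exact: bounded_lin (RR_bounded _).
    rewrite apB.
    have -> : (fun y => RR mu0 \o u (l be y) - u (l be y)) =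
        (fun y => u (rr mu0 (l be y) - l be y)).
      by apply/funext => y; rewrite RR_u linearB.
    by apply: (ap_repr_opbd _ (fu_repr f)); first exact: ltW.
apply: le_trans (rnorm_triangle ((ap (fun y => a (ev g1 y)) nu \o RR mu0) x) _ _) _.
rewrite [d]splitr mulrDl; apply: lerD.
  by rewrite rnormBC; exact: key.
have -> : ap (fun y => a (ev g1 y)) nu \o RR mu0 = ap (fun y => a (ev g1 (rr nu y))) mu0.
  rewrite /RR ap_comp; last exact: bounded_lin (ap_repr_bounded _ _ (fa_repr f)).
  by congr ap; apply/funext => y; rewrite apu.
exact: h2.
Qed.

(** The hypothesis [a_full] below is a genuine fullness condition: in a frame, [M] may be zero. *)
Definition aMM : set (H -> H) :=
  [set S | exists x T T', [/\ M T, M T' & S = a x \o adj T \o T']].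
Hypothesis a_full : forall x, clspan aMM (a x).

(** Multiplying [a x \o adj T \o T'] by [a (e k)] on the right makes [T' \o a (e k)] an element
    [u y], and the product becomes [a] of a value of the functional [fnl x T]. *)
Lemma A_ind (N : set A) : nclosed N -> (forall g y, N (ev g y)) -> forall x, N x.
Proof.
move=> Nn Nev x.
suff h : clspan aMM `<=` a @` N.
  by have [z Nz /(repr_inj (fa_repr f)) <-] := h _ (a_full x).
have Ncl := clsub_preim (fa_repr f) Nn.
apply: (clspan_min Ncl) => _ [{}x [T [T' [MT MT' ->]]]].
have [z _ zE] := f_aMM x MT MT'.
have := pe_cvgr p z; rewrite zE; apply: (clsub_lim Ncl); apply: filterE => k.
have [y _ yE] := @f_Ma _ _ _ f _ (e k) MT'.
have [g gE] := tev_surj Yt (fnl_tilde p r x MT).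
exists (ev g y); first exact: Nev.
by rewrite gE fnlE// yE fa_mul zE.
Qed.

Lemma A_ind2 (N : set A) : nclosed N -> (forall g y x, N (amul (ev g y) x)) -> forall x, N x.
Proof.
move=> Nn Nev x.
have hx : ncvg (tails (pD p)) (fun k => amul x (e k)) x.
  exact: (opcvg_repr _ _ (fa_repr f)).2 (pe_cvgr p x).
apply: (nclosed_lim Nn _ hx) => k; move: x {hx}.
apply: (A_ind (N := [set x | N (amul x (e k))])); last by move=> g y; exact: Nev.
apply: (@nclosed_preim _ _ _ (fun x => amul x (e k)) (rnorm (e k))) => // [c x y|x].
  by rewrite linearPl.
by rewrite mulrC; exact: (amul_rnorm f).
Qed.

Context (E : rmod B) (F : rmod A) (tF : {bilinear E -> Y -> F}).
Hypothesis tF_haag : is_haagerup (@ract R B E) l tF.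
Hypothesis tF_r : forall x y b, tF x (ract y b) = ract (tF x y) b.
Hypothesis E_bai : forall x : E, ncvg (tails DB) (fun i => ract x (eB i)) x.
Context (Q : hilbert R) (psi : {linear F -> (H -> Q)}).
Hypothesis psi_repr : is_repr (osnorm F) psi.
Hypothesis psi_mod : forall g x, psi (ract g x) = psi g \o a x.

Lemma psi_bounded g : bounded_op (psi g).
Proof. exact: repr_bounded psi_repr g. Qed.

Lemma tF_ract x b y : tF (ract x b) y = tF x (l b y).
Proof. exact: (haag_balanced tF_haag). Qed.

Definition phimu (x : E) (mu : nat * pD p) : K -> Q := ap (fun y => psi (tF x y)) mu.

Lemma phimu_linear mu : linear (phimu^~ mu).
Proof.
move=> c x y; rewrite /phimu /ap scaler_sumr -big_split /=; apply: eq_bigr => j _.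
by rewrite linearPl linearP.
Qed.

Lemma tF_row_mxbd n k (x : 'M[E]_(n, k)) q (z : 'I_q -> Y) :
  mxbd (fun (i : 'I_n) (jk : 'I_k * 'I_q) => psi (tF (x i jk.1) (z jk.2)))
    (mnorm E x * mnorm Y (\row_j z j)).
Proof.
pose h0 (i : 'I_k) := (i, ord0 : 'I_1).
have hi : injective h0 by move=> i i' [].
have gi := can_inj (@unpackK k q).
(* Block diagonal with [k] copies of the row [z], so that the entries of the product with [x] are
   all the [tF (x i j) (z s)]. *)
pose Z : 'M[Y]_(k, \sum_(i < k) q) := \matrix_(i, j)
  if (h0 i).1 == (unpack j).1 then (\row_j z j) (h0 i).2 (unpack j).2 else 0.
have Zn : mnorm Y Z <= mnorm Y (\row_j z j) := mnorm_ampl (\row_j z j) hi gi.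
have h1 := le_trans (haag_le tF_haag x Z) (ler_wpM2l (mnorm_ge0 x) Zn).
have /(repr_mnorm_le psi_repr _ (mulr_ge0 (mnorm_ge0 _) (mnorm_ge0 _))) h2 := h1.
have gp := can_inj (@packK k q).
have := mxbd_sub _ (@inj_id 'I_n) gp h2; move=> h3.
apply: (mxbd_eq _ (h3 _)) => [i j h|i j]; last exact: bounded_lin (psi_bounded _).
rewrite mxE; congr (psi _ h).
rewrite (bigD1 j.1)//= !mxE packK eqxx [X in _ + X]big1 ?addr0// => s sj.
by rewrite !mxE packK /= (negPf sj) linear0r.
Qed.

Lemma phimu_mxbd n k (x : 'M[E]_(n, k)) mu : mxbd (fun i j => phimu (x i j) mu) (mnorm E x).
Proof.
apply: (@ap_mx _ _ _ f p _ _ _ (fun i j y => psi (tF (x i j) y))) => [i j y|q z z1].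
  exact: bounded_lin (psi_bounded _).
by apply: mxbd_le (tF_row_mxbd _ _); rewrite ?mulr_ge0// ler_piMr.
Qed.

Lemma phimu_opbd x mu : opbd (phimu x mu) (rnorm x).
Proof.
apply/opbd_mxbd => //; have := phimu_mxbd (const_mx x : 'M[E]_(1, 1)) mu.
by rewrite mnorm11 mxE; apply: mxbd_eq => i j h; rewrite mxE.
Qed.

Lemma E_ind (N : set E) : nclosed N ->
  (forall x y0 g0 y1 g' y' g, N (ract x (tB (ract y0 (ev g0 y1)) (lt (ev g' y') g)))) ->
  forall x, N x.
Proof.
move=> Nn Nr x; apply: (nclosed_lim Nn _ (E_bai x)) => i.
apply: (B_ind2 (N := [set b | N (ract x b)])) => // [|*]; last exact: Nr.
apply: (@nclosed_preim _ _ _ (ract x) (rnorm x)) => // [c b b'|b].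
  by rewrite linearPr.
have := ract_contr (const_mx x : 'M[E]_(1, 1)) (const_mx b : 'M[B]_(1, 1)).
by rewrite !mnorm11 !mxE big_ord1 !mxE.
Qed.

(** By [tB_twist] the variable [y] survives only inside [ev g1 y], so convergence at such elements
    of [E] reduces to that of the approximants of a functional. *)
Lemma phimu_ract x y0 g0 y1 g1 mu :
  phimu (ract x (tB (ract y0 (ev g0 y1)) g1)) mu =
  psi (tF x (l (tB y0 g0) y1)) \o ap (fun y => a (ev g1 y)) mu.
Proof.
rewrite ap_comp; last exact: bounded_lin (psi_bounded _).
by congr ap; apply/funext => y; rewrite tF_ract tB_twist tF_r psi_mod.
Qed.

(** Closedness under limits uses the uniform bound [phimu_opbd]; the generators are settled by
    [dual_lim]. *)
Lemma phi_exists x : exists v, opcvg (@pF _ _ _ f p) (phimu x) v.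
Proof.
move: x; apply: (E_ind (N := [set x | exists v, opcvg (@pF _ _ _ f p) (phimu x) v])) => /=.
  split=> /=.
  - exists 0 => d d0; apply: filterE => mu h.
    by rewrite (linf0 (phimu_linear mu)) subrr rnorm0 mulr_ge0// ltW.
  - move=> c x y [v hv] [v' hv']; exists (c *: v + v') => d d0.
    pose n := complex.Re `|c|; have n0 : 0 <= n by exact: Re_norm_ge0.
    have d1 : 0 < d / (n + 1) by rewrite divr_gt0// ltr_wpDl.
    apply: filterS2 (hv _ d1) (hv' _ d1) => mu h1 h2 h.
    rewrite (phimu_linear mu) !lin_combE opprD addrACA -scalerBr.
    apply: le_trans (rnormD _ _) _; rewrite rnormZ.
    apply: le_trans (lerD (ler_wpM2l n0 (h1 h)) (h2 h)) _.
    rewrite -/n le_eqVlt; apply/orP; left; apply/eqP; field.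
    by rewrite gt_eqF// ltr_wpDl.
  move=> x hx; apply: opcvg_lim => d d0; have d2 : 0 < d / 2 by rewrite divr_gt0.
  have [y [v hv] xy] := hx _ d2; exists v.
  apply: filterS (hv _ d2) => mu hmu h.
  apply: le_trans (rnorm_triangle (phimu y mu h) _ _) _; rewrite [d]splitr mulrDl.
  apply: lerD => //; have := phimu_opbd (x - y) mu h.
  rewrite (linfB (phimu_linear mu)) => /le_trans; apply; exact: ler_wpM2r.
move=> x y0 g0 y1 g' y' g; have [v hv] := dual_lim g' y' g.
exists (psi (tF x (l (tB y0 g0) y1)) \o v).
have -> : phimu (ract x (tB (ract y0 (ev g0 y1)) (lt (ev g' y') g))) =
  (fun mu => psi (tF x (l (tB y0 g0) y1)) \o ap (fun y => a (ev (lt (ev g' y') g) y)) mu).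
  by apply/funext => mu; rewrite phimu_ract.
by apply: opcvg_compl => //; exact: psi_bounded.
Qed.

Definition phi_fun (x : E) : K -> Q := sval (cid (phi_exists x)).

Lemma phi_cvg x : opcvg (@pF _ _ _ f p) (phimu x) (phi_fun x).
Proof. by rewrite /phi_fun; case: cid. Qed.

Lemma phi_unique x v : opcvg (@pF _ _ _ f p) (phimu x) v -> phi_fun x = v.
Proof.
move=> hv; apply/funext => h.
exact: (ncvg_unique (opcvg_pt h (phi_cvg x)) (opcvg_pt h hv)).
Qed.

Lemma phi_linear : linear phi_fun.
Proof.
move=> c x y; apply/funext => h.
apply: (ncvg_unique (opcvg_pt h (phi_cvg _))).
rewrite (_ : (fun mu => _) = (fun mu => c *: phimu x mu h + phimu y mu h)).
  by apply: ncvgD; [apply: ncvgZ|]; exact: (opcvg_pt h (phi_cvg _)).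
by apply/funext => mu; rewrite (phimu_linear mu).
Qed.

HB.instance Definition _ := GRing.isLinear.Build R[i] E (K -> Q) *:%R phi_fun phi_linear.

Definition phi : {linear E -> (K -> Q)} := phi_fun.

Lemma phimu_bounded x mu : bounded_op (phimu x mu).
Proof. exact: (ap_repr_bounded _ _ psi_repr). Qed.

Lemma phi_bounded x : bounded_op (phi x).
Proof. by apply: (opcvg_bounded _ (phi_cvg x)) => mu; exact: phimu_bounded. Qed.

Lemma phi_mxbd n k (x : 'M[E]_(n, k)) : mxbd (fun i j => phi (x i j)) (mnorm E x).
Proof.
apply: (@mxbd_opcvg _ _ _ _ _ _ (@pF _ _ _ f p) _ (fun mu i j => phimu (x i j) mu)) => //.
  by move=> mu; exact: phimu_mxbd.
by move=> i j; exact: phi_cvg.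
Qed.

Lemma phi_u x y : phi x \o u y = psi (tF x y).
Proof.
apply/funext => h.
apply: (ncvg_unique (opcvg_pt (u y h) (phi_cvg x))).
have -> : (fun mu => phimu x mu (u y h)) = (fun mu => psi (tF x (rr (p := p) mu y)) h).
  apply/funext => mu.
  suff <- : ap (fun y => psi (tF x y)) mu \o u y = psi (tF x (rr mu y)) by [].
  apply: (@ap_u _ _ _ f p _ F psi (tF x)) => [|c z z'|z b]; first exact: linearP.
    by rewrite linearPr.
  by rewrite tF_r psi_mod.
apply: (@opcvg_pt _ _ _ _ _ _ (fun mu => psi (tF x (rr (p := p) mu y)))).
apply/(opcvg_repr _ _ psi_repr) => d d0.
have x1 : 0 < rnorm x + 1 by rewrite ltr_wpDl.
apply: filterS (rr_cvg p y (divr_gt0 d0 x1)) => mu hmu.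
rewrite -linearBr; apply: le_trans (haag_rnorm tF_haag _ _) _.
apply: le_trans (ler_wpM2l (rnorm_ge0 _) hmu) _.
by rewrite mulrCA ler_piMr ?(ltW d0)// ler_pdivrMr// mul1r lerDl.
Qed.

(** [phi x] times the row of the [u (y s)] is [psi] of a matrix over [F], the product of [x] and [y]
    under [tF], whose norm is therefore at most [c] times that of the row. A nearly optimal
    factorization of this matrix, followed by the column [h], is a factorization of the matrix of
    the [x b], with [b] the sum of the [tB (y s) (h s)]. *)
Lemma phi_factor_le k n (x : 'M[E]_(k, n)) c N (y : 'I_N -> Y) (h : 'I_N -> Yt) :
  0 <= c -> mxbd (fun i j => phi (x i j)) c ->
  mnorm E (map_mx (fun z => ract z (\sum_s tB (y s) (h s))) x) <=
    c * mnorm Y (\row_s y s) * mnorm Yt (\col_s h s).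
Proof.
move=> c0 hc; set ny := mnorm Y _; set nh := mnorm Yt _.
have ny0 : 0 <= ny by exact: mnorm_ge0.
have nh0 : 0 <= nh by exact: mnorm_ge0.
pose h0 (i : 'I_n) := (i, ord0 : 'I_1).
have hi : injective h0 by move=> i i' [].
have gi := can_inj (@unpackK n N).
(* One copy of the row [y], and in [W] of the column [h], for each column of [x]. *)
pose Z : 'M[Y]_(n, \sum_(i < n) N) := \matrix_(i, j)
  if (h0 i).1 == (unpack j).1 then (\row_j y j) (h0 i).2 (unpack j).2 else 0.
pose W : 'M[Yt]_(\sum_(i < n) N, n) := \matrix_(j, i)
  if (unpack j).1 == (h0 i).1 then (\col_j h j) (unpack j).2 (h0 i).2 else 0.
have Wn : mnorm Yt W <= nh := mnorm_ampl (\col_j h j) gi hi.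
have Gn : mnorm F (mxmul tF x Z) <= c * ny.
  apply/(repr_mnorm_le psi_repr); first exact: mulr_ge0.
  have hu : mxbd (fun (i : 'I_1) (j : 'I_N) => u (y j)) ny.
    by apply/(mnorm_rowbd _ (fu_repr f)).
  have h1 := mxbd_ampl (P := 'I_n) hu.
  have h2 := mxbd_sub _ hi gi h1.
  have h3 := mxbd_comp (fun i j => bounded_lin (phi_bounded (x i j))) hc (h2 _).
  apply: (mxbd_eq _ (h3 _)) => [i j z|i j].
    rewrite mxE (bigD1 (unpack j).1)//= eqxx [X in _ + X]big1 ?addr0; last first.
      by move=> s /negPf ->; rewrite (linf0 (bounded_lin (phi_bounded _))).
    have -> : \sum_k0 tF (x i k0) (Z k0 j) = tF (x i (unpack j).1) (y (unpack j).2).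
      rewrite (bigD1 (unpack j).1)//= mxE eqxx mxE [X in _ + X]big1 ?addr0// => s /negPf sj.
      by rewrite mxE sj linear0r.
    by rewrite -phi_u.
  by case: ifP => _; [exact: bounded_lin (fu_bounded f _)|move=> c' z z'; rewrite scaler0 addr0].
apply/ler_addgt0Pl => d d0; have nh1 : 0 < nh + 1 by rewrite ltr_wpDl.
have [q [x' [Z' [tens le]]]] := haag_approx tF_haag x Z (divr_gt0 d0 nh1).
(* For fixed [h s], [(x, y) |-> ract x (tB y (h s))] is balanced over [B], so the factorization
   found in [F] can be read in [E]. *)
have key s i j : ract (x i j) (tB (y s) (h s)) =
    \sum_t ract (x' i t) (tB (Z' t (pack (j, s))) (h s)).
  have : mxmul (fun x y => ract x (tB y (h s))) x Z = mxmul (fun x y => ract x (tB y (h s))) x' Z'.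
    apply: (haag_tens_eq _ _ _ tens) => [y0|x0|x0 b y0].
    - by move=> c' z z'; rewrite linearPl.
    - by move=> c' z z'; rewrite linearPl linearPr.
    - by rewrite ractA tB_l.
  move=> /matrixP/(_ i (pack (j, s))); rewrite !mxE => <-.
  rewrite (bigD1 j)//= mxE packK eqxx mxE [X in _ + X]big1 ?addr0// => t tj.
  by rewrite mxE packK /= (negPf tj) linear0l linear0r.
have -> : map_mx (fun z => ract z (\sum_s tB (y s) (h s))) x = mxmul ract x' (mxmul tB Z' W).
  apply/matrixP => i j; rewrite !mxE linear_sumr.
  under eq_bigr do rewrite key.
  rewrite exchange_big /=; apply: eq_bigr => t _; rewrite mxE -linear_sumr; congr (ract _ _).
  rewrite [RHS](reindex (@pack n N))/=; last first.
    by exists (@unpack n N) => z _; [exact: packK|exact: unpackK].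
  transitivity (\sum_(j' < n) \sum_(s < N) tB (Z' t (pack (j', s))) (W (pack (j', s)) j)).
    rewrite [RHS](bigD1 j)//= [X in _ + X]big1 ?addr0 => [|j' j'j].
      by apply: eq_bigr => s _; rewrite mxE packK eqxx mxE.
    by apply: big1 => s _; rewrite mxE packK /= (negPf j'j) linear0r.
  by rewrite pair_bigA; apply: eq_bigr => -[].
apply: le_trans (ract_contr _ _) _.
apply: le_trans (ler_wpM2l (mnorm_ge0 _) (haag_le tB_haag Z' W)) _; rewrite mulrA.
apply: le_trans (ler_wpM2l (mulr_ge0 (mnorm_ge0 _) (mnorm_ge0 _)) Wn) _.
apply: le_trans (ler_wpM2r nh0 (le_trans le (lerD Gn (lexx _)))) _.
by rewrite mulrDl addrC lerD2r mulrAC ler_pdivrMr// ler_wpM2l ?(ltW d0)// lerDl.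
Qed.

(** Density, then a nearly optimal factorization of the approximant: each contributes one [d] to the
    excess [2 * d]. *)
Lemma B_approx b (d : R) : 0 < d -> exists N (y : 'I_N -> Y) (h : 'I_N -> Yt),
  rnorm (b - \sum_s tB (y s) (h s)) <= d /\
  mnorm Y (\row_s y s) * mnorm Yt (\col_s h s) <= rnorm b + 2 * d.
Proof.
move=> d0; have eC : 0 < d%:C :> R[i] by rewrite ltcR.
have [b' [bb' [n [y [h b'E]]]]] := haag_dense tB_haag (ex_intro _ b (ballxx b eC)) (ball_open b d%:C).
have {}bb' : rnorm (b - b') <= d.
  have : ball_ Num.norm b d%:C b' by rewrite ball_normE.
  by rewrite /ball_ /= rnormE ltcR; exact: ltW.
have [q [y' [h' [tens le]]]] := haag_approx tB_haag (\row_i y i) (\col_i h i) d0.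
exists q, (fun s => y' ord0 s), (fun s => h' s ord0).
have b'E2 : b' = \sum_s tB (y' ord0 s) (h' s ord0).
  have : mxmul tB (\row_i y i) (\col_i h i) = mxmul tB y' h'.
    apply: (haag_tens_eq _ _ _ tens) => [g|x|].
    - by move=> c z z'; rewrite linearPl.
    - by move=> c z z'; rewrite linearPr.
    - exact: haag_balanced tB_haag.
  move=> /matrixP/(_ ord0 ord0); rewrite !mxE => <-; rewrite b'E.
  by apply: eq_bigr => s _; rewrite !mxE.
split; first by rewrite -b'E2.
have -> : \row_s y' ord0 s = y' by apply/matrixP => i j; rewrite mxE (ord1 i).
have -> : \col_s h' s ord0 = h' by apply/matrixP => i j; rewrite mxE (ord1 j).
apply: le_trans le _; rewrite mnorm11 mxE.
have -> : \sum_j tB ((\row_i y i) ord0 j) ((\col_i h i) j ord0) = b'.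
  by rewrite b'E; apply: eq_bigr => s _; rewrite !mxE.
have := rnormD b (b' - b); rewrite addrCA subrr addr0 (rnormBC b'); lra.
Qed.

(** [x] is the limit of [x b] along the approximate identity, and [b] is nearly a sum of tensors
    whose factors have norm product at most [1 + 2 t], so [phi_factor_le] gives [c] in the limit. *)
Lemma phi_lower k n (x : 'M[E]_(k, n)) c : 0 <= c ->
  mxbd (fun i j => phi (x i j)) c -> mnorm E x <= c.
Proof.
move=> c0 hc.
apply: (@mnorm_lim_le _ _ _ _ _ (tails DB) _ (fun i => map_mx (fun z => ract z (eB i)) x)).
  move=> i j d d0; apply: filterS (E_bai (x i j) d0) => s; by rewrite mxE.
apply: filterE => s; set b := eB s.
apply/ler_addgt0Pl => d d0.
pose D := \sum_i \sum_j rnorm (x i j).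
have D0 : 0 <= D by apply: sumr_ge0 => i _; apply: sumr_ge0.
(* With [t = d / C], the error of replacing [b] by [b'] and the excess [2 c t] add up to at most
   [d]. *)
pose C := Num.sqrt k%:R * n%:R * D + 2 * c + 1 : R.
have C0 : 0 < C by rewrite ltr_wpDl// addr_ge0 ?mulr_ge0// sqrtr_ge0.
have t0 : 0 < d / C by rewrite divr_gt0.
have [N [y [h [hb hyh]]]] := B_approx b t0.
set b' := \sum_s _ in hb.
have -> : map_mx (fun z => ract z b) x = map_mx (fun z => ract z (b - b')) x + map_mx (fun z => ract z b') x.
  by apply/matrixP => i j; rewrite !mxE linearBr subrK.
apply: le_trans (mnormD _ _) _.
have h1 : mnorm E (map_mx (fun z => ract z (b - b')) x) <= Num.sqrt k%:R * n%:R * (D * (d / C)).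
  apply: mnorm_entries_le; first by rewrite mulr_ge0 ?(ltW t0).
  move=> i j; rewrite mxE.
  have := ract_contr (const_mx (x i j) : 'M[E]_(1, 1)) (const_mx (b - b') : 'M[B]_(1, 1)).
  rewrite !mnorm11 !mxE big_ord1 !mxE => /le_trans; apply.
  apply: ler_pM => //.
  rewrite /D (bigD1 i)//= (bigD1 j)//= -addrA lerDl addr_ge0//; first exact: sumr_ge0.
  by apply: sumr_ge0 => *; apply: sumr_ge0.
have h2 := phi_factor_le y h c0 hc.
have h3 : c * mnorm Y (\row_s y s) * mnorm Yt (\col_s h s) <= c * (1 + 2 * (d / C)).
  rewrite -mulrA ler_wpM2l//; apply: le_trans hyh _.
  by rewrite lerD2r; exact: eB_le1.
apply: le_trans (lerD h1 (le_trans h2 h3)) _.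
have e1 : C * (d / C) = d by rewrite mulrCA divff ?mulr1// gt_eqF.
move: e1; set t := d / C in t0 *; rewrite /C.
move: (Num.sqrt k%:R * n%:R) => v e1; have : v * (D * t) + c * (1 + 2 * t) <= d + c.
  by rewrite -e1; nra.
by [].
Qed.

Lemma phi_repr : is_repr (osnorm E) phi.
Proof.
split; first by move=> _ [x _ <-]; exact: phi_bounded.
move=> k n x; apply/eqP; rewrite eq_le; apply/andP; split.
  apply/op_mxnormP => //; first by move=> i j; rewrite mxE; exact: phi_bounded.
  by apply: mxbd_eq (phi_mxbd x) => i j h; rewrite mxE.
have bd i j : bounded_op (map_mx phi x i j) by rewrite mxE; exact: phi_bounded.
apply: phi_lower; first exact: op_mxnorm_ge0.
have /(op_mxnormP bd (op_mxnorm_ge0 bd)) := lexx (op_mxnorm (map_mx phi x)).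
by apply: mxbd_eq => i j h; rewrite mxE.
Qed.

(** Generators of the form that [phimu_ract] produces, times an element of [A]. *)
Lemma F_ind (N : set F) : nclosed N ->
  (forall x y0 g0 y c, N (ract (tF x (l (tB y0 g0) y)) c)) -> forall z, N z.
Proof.
move=> Nn Nt; apply: (haag_ind tF_haag) => // x y.
have tFx : nclosed [set y | N (tF x y)].
  apply: (@nclosed_preim _ _ _ (tF x) (rnorm x)) => // [c z z'|z]; first by rewrite linearPr.
  exact: haag_rnorm tF_haag _ _.
apply: (nclosed_lim tFx _ (l_bai y)) => i; move: (eB i).
apply: (haag_ind tB_haag (N := [set b | N (tF x (l b y))])) => // [|y0 g0].
  apply: (@nclosed_preim _ _ _ (fun b => l b y) (rnorm y) [set z | N (tF x z)]) => // [c b b'|b].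
    by rewrite linearPl.
  by rewrite mulrC l_rnorm.
move: y; apply: (Y_ind (N := [set y | N (tF x (l (tB y0 g0) y))])).
  apply: (@nclosed_preim _ _ _ (l (tB y0 g0)) (rnorm (tB y0 g0)) [set z | N (tF x z)]) => // [c y y'|y].
    by rewrite linearPr.
  exact: l_rnorm.
by move=> y g c /=; rewrite (lact_ract l_act) tF_r.
Qed.

Lemma psi_nclosed (N : set (H -> Q)) : clsub N -> nclosed [set g | N (psi g)].
Proof.
apply: (@nclosed_ops _ _ _ _ psi 1) => [|x]; first exact: linearP.
by rewrite mul1r; exact: (repr_opbd_norm psi_repr).
Qed.

Lemma a_nclosed (N : set (H -> H)) : clsub N -> nclosed [set x | N (a x)].
Proof.
apply: (@nclosed_ops _ _ _ _ a 1) => [|x]; first exact: linearP.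
by rewrite mul1r; exact: (repr_opbd_norm (fa_repr f)).
Qed.

Lemma ap_dual g' y' g x T mu : M T -> ev g = fnl x T ->
  ap (fun y => a (ev (lt (ev g' y') g) y)) mu = a (amul (ev g' y') x) \o adj T \o RR (p := p) mu.
Proof.
move=> MT gE; rewrite /RR (ap_comp _ _ (X := a (amul (ev g' y') x) \o adj T)).
  by congr ap; apply/funext => y; rewrite ltE gE !fa_mul fnlE.
by apply: bounded_lin; apply: bounded_comp; [exact: fa_bounded|exact: adjM_bounded].
Qed.

(** The preimage is explicit on generators: with [g1] the functional [fnl x T], [phimu] of the
    element chosen is a fixed operator times [a _ \o adj T \o RR mu], and the latter converges by
    [aM_RR]. *)
Lemma psi_adj_range g T : M T -> range phi (psi g \o adj T).
Proof.
move=> MT.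
have rc := repr_clsub phi_repr.
have bT := adjM_bounded MT.
have rT : clsub [set S : H -> Q | range phi (S \o adj T)] := clsub_compr bT rc.
have key z y0 g0 y1 x : range phi (psi (tF z (l (tB y0 g0) y1)) \o a x \o adj T).
  move: x; have psib := psi_bounded (tF z (l (tB y0 g0) y1)).
  apply: (A_ind2 (N := [set x | range phi (psi (tF z (l (tB y0 g0) y1)) \o a x \o adj T)])).
    by apply: (a_nclosed (N := [set S : H -> H | range phi (psi _ \o S \o adj T)])); exact: clsub_compl psib rT.
  move=> g' y' x /=.
  have [g1 g1E] := tev_surj Yt (fnl_tilde p r x MT).
  exists (ract z (tB (ract y0 (ev g0 y1)) (lt (ev g' y') g1))) => //.
  apply: phi_unique.
  have -> : phimu (ract z (tB (ract y0 (ev g0 y1)) (lt (ev g' y') g1))) =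
      (fun mu => psi (tF z (l (tB y0 g0) y1)) \o (a (amul (ev g' y') x) \o adj T \o RR (p := p) mu)).
    by apply/funext => mu; rewrite phimu_ract (ap_dual g' y' mu MT g1E).
  exact: opcvg_compl psib (aM_RR p _ MT).
move: g; apply: (F_ind (N := [set g | range phi (psi g \o adj T)])); first exact: psi_nclosed rT.
by move=> z y0 g0 y c /=; rewrite psi_mod; exact: key.
Qed.

Lemma phi_range_sub x : clspan (prods (prods (adjs (@scalars R Q)) (range psi)) (adjs M)) (phi x).
Proof.
apply: (clsub_lim (clspan_clsub _) _ (phi_cvg x)); apply: filterE => mu.
rewrite /phimu /ap; apply: (clsub_sum (clspan_clsub _)) => j.
apply: sub_clspan; exists (psi (ract (tF x (w j mu.2)) (e mu.2))).
  exists id; first by exists id; [exists 1; rewrite scale1r|rewrite adj_id].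
  by exists (psi (ract (tF x (w j mu.2)) (e mu.2))); [exists (ract (tF x (w j mu.2)) (e mu.2))|].
by exists (adj (m j)); [exists (m j); [exact: pm_in|]|rewrite psi_mod].
Qed.

(** Each term of [phimu x mu \o T] ends in [a (e _) \o adj (m j) \o T], which lies in [a(A)] and is
    absorbed by [psi]. *)
Lemma psi_M_range x T : M T -> range psi (phi x \o T).
Proof.
move=> MT; apply: (clsub_lim (repr_clsub psi_repr) _ (opcvg_compr (fM_bounded MT) (phi_cvg x))).
apply: filterE => mu.
have -> : phimu x mu \o T = \sum_(j < mu.1) (psi (tF x (w j mu.2)) \o (a (e mu.2) \o adj (m j) \o T)).
  by apply/funext => h; rewrite /phimu /ap /= !sum_fctE.
apply: (clsub_sum (repr_clsub psi_repr)) => j.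
have [z _ <-] := f_aMM (e mu.2) (pm_in p j) MT.
by exists (ract (tF x (w j mu.2)) z); rewrite // psi_mod.
Qed.

(** [a_full] approximates [psi g' \o a x] by combinations of [psi g' \o a x' \o adj T \o T'], and
    [psi_adj_range] turns all but the last factor into some [phi e']. *)
Lemma psi_range_sub g : clspan (prods (prods (@scalars R Q) (range phi)) (adjs (adjs M))) (psi g).
Proof.
set C := clspan _; have Cc : clsub C := clspan_clsub _.
have key g' x : C (psi g' \o a x).
  suff : clspan aMM `<=` [set S : H -> H | C (psi g' \o S)] by apply.
  apply: clspan_min; first exact: clsub_compl (psi_bounded g') Cc.
  move=> _ [x' [T [T' [MT MT' ->]]]]; apply: sub_clspan.
  have [e' _ e'E] := psi_adj_range (ract g' x') MT.
  exists (phi e'); first by exists id; [exists 1; rewrite scale1r|exists (phi e'); [exists e'|]].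
  exists T'; first by exists (adj T'); [exists T'|exact: adjK (fM_bounded MT')].
  by rewrite e'E psi_mod.
move: g; apply: (F_ind (N := [set g | C (psi g)])); first exact: psi_nclosed Cc.
by move=> z y0 g0 y c /=; rewrite psi_mod; exact: key.
Qed.

Lemma morita_sigmaDelta : sigmaDelta E F.
Proof.
exists K, Q, H, Q, phi, psi, (adjs M), (@scalars R Q).
have MTRO := fM_tro f.
split; [exact: phi_repr|exact: psi_repr| | |].
- by split; [exact: adjs_sigmaTRO|exact: scalars_sigmaTRO].
- apply/seteqP; split=> [_ [x _ <-]|]; first exact: phi_range_sub.
  have rc := repr_clsub phi_repr; apply: (clspan_min rc).
  move=> _ [_ [_ [_ [c ->] <-] [_ [g _ <-] <-]] [_ [T MT <-] <-]].
  have [x _ xE] := psi_adj_range g MT; exists (Num.conj c *: x) => //.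
  by rewrite linearZ /= xE adj_scalar.
- apply/seteqP; split=> [_ [g _ <-]|]; first exact: psi_range_sub.
  have rc := repr_clsub psi_repr; apply: (clspan_min rc).
  move=> _ [_ [_ [c ->] [_ [x _ <-] <-]] [_ [_ [T MT <-] <-] <-]].
  rewrite (adjK (fM_bounded MT)).
  have [g _ gE] := psi_M_range x MT; exists (c *: g) => //.
  by rewrite linearZ /= gE.
Qed.

End Morita.

(** * Amplification *)

Section Amplification.
Context {R : realType}.
Implicit Types H K L : hilbert R.

Lemma l2_sumE (J : choiceType) H (I : Type) (s : seq I) (P : pred I) (x : I -> @l2 R J H) j :
  (\sum_(i <- s | P i) x i) j = \sum_(i <- s | P i) x i j.
Proof. by elim/big_rec2: _ => // i y1 y2 _ <-. Qed.

Lemma l2_combE (J : choiceType) H (c : R[i]) (x y : @l2 R J H) j :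
  (c *: x + y) j = c *: x j + y j.
Proof. by []. Qed.

Lemma l2_subE (J : choiceType) H (x y : @l2 R J H) j : (x - y) j = x j - y j.
Proof. by []. Qed.

Lemma sum_l2sq_le (J : choiceType) H (I : finType) (x : I -> @l2 R J H) M :
  (forall s : seq J, uniq s -> \sum_(j <- s) \sum_i rnorm (x i j) ^+ 2 <= M) ->
  \sum_i l2sq (x i) <= M.
Proof.
move=> xM.
have [sE sS] : tsum (fun j => \sum_i sqs (x i) j) = \sum_i l2sq (x i) /\
    summ (fun j => \sum_i sqs (x i) j).
  have z : summ (fun _ : J => 0 : R).
    by apply: (@summ_bound _ _ _ 0) => s _; rewrite big1// => j _; rewrite normr0.
  elim: (index_enum I) => [|i r [IH1 IH2]].
    under [fun j : J => _]funext do rewrite big_nil; rewrite big_nil; split => //.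
    have h : (fun _ : J => 0 : R) = (fun _ => 0 * 0) by apply/funext => j; rewrite mul0r.
    by rewrite h tsumZ// mul0r.
  under [fun j : J => _]funext do rewrite big_cons; rewrite big_cons; split.
    by rewrite tsumD// ?IH1//; exact: l2P.
  by apply: summD => //; exact: l2P.
rewrite -sE; apply: (tsum_le _ xM).2 => j.
by apply: sumr_ge0 => i _; exact: sqs_ge0.
Qed.

Section Amp.
Context (J : choiceType).
Local Notation l2 H := (@l2hilbert R J H).

(** [insubd] returns 0 when the image is not square summable, which does not occur for bounded [T]
    ([ampE]). *)
Definition amp H K (T : H -> K) (x : l2 H) : l2 K := insubd (0 : l2 K) (fun j => T (x j)).

Lemma ampE H K (T : H -> K) x j : bounded_op T -> amp T x j = T (x j).
Proof.
move=> /bounded_opP[_ [c c0 Tc]].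
suff h : (fun j => T (x j)) \in (@l2pred R J K).
  exact: (congr1 (fun y : J -> K => y j) (insubdK (0 : l2 K) h)).
apply/asboolP/(@summ_nneg _ _ _ (fun j => c ^+ 2 * sqs x j)); last exact: summZ (l2P x).
move=> i; rewrite sqs_ge0 /sqs -exprMn lerXn2r ?nnegrE ?rnorm_ge0//.
by rewrite mulr_ge0.
Qed.

Lemma amp_comb H K (c : R[i]) (S T : H -> K) : bounded_op S -> bounded_op T ->
  amp (c *: S + T) = c *: amp S + amp T.
Proof.
move=> Sb Tb; apply/funext => x; apply: l2_eq => j.
rewrite ampE; last exact: bounded_linear_comb.
by rewrite !lin_combE l2_combE !ampE.
Qed.

Lemma amp_comp H K L (S : K -> L) (T : H -> K) : bounded_op S -> bounded_op T ->
  amp (S \o T) = amp S \o amp T.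
Proof.
move=> Sb Tb; apply/funext => x; apply: l2_eq => j.
rewrite ampE; last exact: bounded_comp.
by rewrite /= !ampE.
Qed.

Lemma amp0 H K : amp (0 : H -> K) = 0.
Proof. by apply/funext => x; apply: l2_eq => j; rewrite ampE//; exact: bounded0. Qed.

Lemma ampB H K (S T : H -> K) : bounded_op S -> bounded_op T -> amp (S - T) = amp S - amp T.
Proof. by move=> Sb Tb; rewrite addrC -scaleN1r amp_comb// scaleN1r addrC. Qed.

Lemma amp_sum H K n (T : 'I_n -> H -> K) : (forall i, bounded_op (T i)) ->
  amp (\sum_(i < n) T i) = \sum_(i < n) amp (T i).
Proof.
elim: n T => [|n IH] T Tb; first by rewrite !big_ord0 amp0.
rewrite !big_ord_recr /= -IH// -[\sum_(i < n) T _]scale1r amp_comb ?scale1r//.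
by apply: bounded_sum.
Qed.

Lemma amp_linear H K (T : H -> K) : bounded_op T -> linear (amp T).
Proof.
by move=> Tb c x y; apply: l2_eq => j; rewrite l2_combE !ampE// l2_combE (bounded_lin Tb).
Qed.

Lemma amp_mxbd (I I' : finType) H K (T : I -> I' -> H -> K) c :
  (forall i i', bounded_op (T i i')) -> mxbd T c -> mxbd (fun i i' => amp (T i i')) c.
Proof.
move=> Tb Tc xi; under eq_bigr do rewrite rnorm_l2sq.
apply: sum_l2sq_le => s us.
apply: (@le_trans _ _ (\sum_(j <- s) c ^+ 2 * \sum_i' rnorm (xi i' j) ^+ 2)).
  apply: ler_sum => j _; have := Tc (fun i' => xi i' j); apply: le_trans.
  apply: ler_sum => i _; rewrite l2_sumE le_eqVlt; apply/orP; left; apply/eqP.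
  by congr (rnorm _ ^+ 2); apply: eq_bigr => i' _; rewrite ampE.
rewrite -mulr_sumr ler_wpM2l ?sqr_ge0// exchange_big /=; apply: ler_sum => i' _.
by rewrite rnorm_l2sq sum_sqs_le.
Qed.

Lemma amp_opbd H K (T : H -> K) c : bounded_op T -> 0 <= c -> opbd T c -> opbd (amp T) c.
Proof. by move=> Tb c0 /(opbd_mxbd _ c0) Tc; apply/opbd_mxbd => //; exact: amp_mxbd. Qed.

Lemma amp_bounded H K (T : H -> K) : bounded_op T -> bounded_op (amp T).
Proof.
move=> Tb; have /bounded_opP[_ [c c0 Tc]] := Tb; apply/bounded_opP; split; first exact: amp_linear.
by exists c => //; exact: amp_opbd.
Qed.

Lemma amp_adj H K (T : H -> K) : bounded_op T -> adj (amp T) = amp (adj T).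
Proof.
move=> Tb; apply: adj_unique => x y.
have e j : dot K (amp T x j) (y j) = dot H (x j) (amp (adj T) y j).
  by rewrite !ampE ?(adjP Tb)//; exact: bounded_adj.
suff : l2dot (amp T x) y = l2dot x (amp (adj T) y) by [].
by rewrite /l2dot; congr Complex; congr tsum; apply/funext => j; rewrite e.
Qed.

Lemma amp_opcvg (I : Type) (F : set_system I) {FF : Filter F} H K (T : I -> H -> K) S :
  (forall i, bounded_op (T i)) -> bounded_op S -> opcvg F T S ->
  opcvg F (fun i => amp (T i)) (amp S).
Proof.
move=> Tb Sb TS e e0; apply: filterS (TS e e0) => i hi x.
have -> : amp (T i) x - amp S x = amp (T i - S) x by rewrite ampB.
by apply: amp_opbd; [exact: boundedB|exact: ltW|].
Qed.

Section Single.
Variable j0 : J.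

Lemma single_subproof H (h : H) : (fun j => if j == j0 then h else 0) \in (@l2pred R J H).
Proof.
apply/asboolP; apply: (@summ_bound _ _ _ (rnorm h ^+ 2)) => s us.
have [js|js] := boolP (j0 \in s); last first.
  rewrite big_seq big1 ?sqr_ge0// => j js'; rewrite /sqs; case: eqP => [jj|]; first by rewrite -jj js' in js.
  by rewrite rnorm0 expr0n normr0.
rewrite (bigD1_seq j0)//= /sqs eqxx ger0_norm ?sqr_ge0// big1 ?addr0// => j /negPf ->.
by rewrite rnorm0 expr0n normr0.
Qed.

(** A vector in one coordinate suffices to recover the norm of [T] from [amp T], which is why [J]
    must have an element [j0]. *)
Definition single H (h : H) : l2 H := L2 (single_subproof h).

Lemma rnorm_single H (h : H) : rnorm (single h) = rnorm h.
Proof.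
apply/eqP; rewrite -(@eqrXn2 _ 2)// rnorm_l2sq eq_le; apply/andP; split; last first.
  by have := sqs_le (single h) j0; rewrite /= eqxx.
apply: l2sq_le => s us.
have [js|js] := boolP (j0 \in s); last first.
  rewrite big_seq big1 ?sqr_ge0// => j js' /=; case: eqP => [jj|]; first by rewrite -jj js' in js.
  by rewrite rnorm0 expr0n.
rewrite (bigD1_seq j0)//= eqxx big1 ?addr0// => j /negPf ->.
by rewrite rnorm0 expr0n.
Qed.

Lemma rnorm_coord_le H (x : l2 H) j : rnorm (x j) <= rnorm x.
Proof. by rewrite -(@ler_pXn2r _ 2)// ?nnegrE ?rnorm_ge0// rnorm_l2sq sqs_le. Qed.

Lemma mxbd_amp (I I' : finType) H K (T : I -> I' -> H -> K) c :
  (forall i i', bounded_op (T i i')) -> mxbd (fun i i' => amp (T i i')) c -> mxbd T c.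
Proof.
move=> Tb Tc xi; have := Tc (fun i' => single (xi i')).
under [X in _ <= _ * X -> _]eq_bigr do rewrite rnorm_single.
apply: le_trans; apply: ler_sum => i _.
apply: lerXn2r; rewrite ?nnegrE ?rnorm_ge0//.
apply: le_trans (rnorm_coord_le _ j0); rewrite l2_sumE.
rewrite le_eqVlt; apply/orP; left; apply/eqP; congr rnorm; apply: eq_bigr => i' _.
by rewrite ampE//= eqxx.
Qed.

Lemma amp_repr (X : opSpace R) H K (u : {linear X -> (H -> K)})
    (v : {linear X -> (l2 H -> l2 K)}) : is_repr (osnorm X) u ->
  (forall x, v x = @amp H K (u x)) -> is_repr (osnorm X) v.
Proof.
move=> hu vE; have ub := repr_bounded hu.
have vb x : bounded_op (v x) by rewrite vE; exact: amp_bounded.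
split=> [_ [x _ <-] //|m n x].
have vxb i j : bounded_op (map_mx v x i j) by rewrite mxE.
apply/eqP; rewrite eq_le; apply/andP; split.
  apply/op_mxnormP => //.
  have /(repr_mnorm_le hu _ (mnorm_ge0 x)) := lexx (mnorm X x).
  move=> /(amp_mxbd (fun i j => ub (x i j))); apply: mxbd_eq => i j h.
  by rewrite mxE vE.
have c0 := op_mxnorm_ge0 vxb.
apply/(repr_mnorm_le hu) => //.
apply: (mxbd_amp (fun i j => ub (x i j))).
have /(op_mxnormP vxb c0) := lexx (op_mxnorm (map_mx v x)).
by apply: mxbd_eq => i j h; rewrite mxE vE.
Qed.

Lemma amp_closed H K (M : set (H -> K)) : M `<=` @bounded_op R H K ->
  norm_closure M `<=` M -> norm_closure (@amp H K @` M) `<=` @amp H K @` M.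
Proof.
(* Compression of [S] to the coordinate [j0], the only possible preimage. *)
move=> Mb Mc S hS; pose T0 h := S (single h) j0.
have T0e (e : R) : 0 < e -> exists2 T, M T & opbd (T - T0) e /\ opbd (amp T - S) e.
  move=> e0; have [_ [T MT <-] TS] := hS e e0; exists T => //; split=> h; last by rewrite rnormBC; exact: TS.
  rewrite -[X in _ <= _ * X]rnorm_single; apply: le_trans (TS _).
  suff -> : (T - T0) h = (amp T (single h) - S (single h)) j0.
    by rewrite [leRHS]rnormBC; exact: rnorm_coord_le.
  by rewrite l2_subE (ampE _ _ (Mb _ MT)) /= eqxx.
have MT0 : M T0.
  apply: Mc => e e0; have [T MT [h _]] := T0e e e0; exists T => // x.
  by rewrite rnormBC; exact: h.
exists T0 => //; apply/funext => x; apply/subr0_eq/rnorm0_eq0/eqP.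
rewrite eq_le rnorm_ge0 andbT; apply/ler_addgt0Pl => e e0; rewrite addr0.
have x1 : 0 < 2 * (rnorm x + 1) by rewrite mulr_gt0// ltr_wpDl.
have d0 : 0 < e / (2 * (rnorm x + 1)) by rewrite divr_gt0.
have [T MT [h1 h2]] := T0e _ d0.
apply: le_trans (rnorm_triangle (amp T x) _ _) _.
apply: le_trans (lerD _ (h2 x)) _.
  rewrite rnormBC; have -> : amp T x - amp T0 x = amp (T - T0) x by rewrite ampB//; exact: Mb.
  by apply: (amp_opbd _ (ltW d0) h1); apply: boundedB; exact: Mb.
have aux (d n : R) : d * (2 * (n + 1)) = e -> 0 < d -> d * n + d * n <= e by move=> <-; lra.
exact: aux (divfK (lt0r_neq0 x1) e) d0.
Qed.

Lemma amp_sigmaTRO H K (M : set (H -> K)) : is_sigmaTRO M -> is_sigmaTRO (@amp H K @` M).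
Proof.
move=> [[Mb M0 Ml Mm] Mc [m [mM mc m1]] [n [nM nc n1]]].
have bd T : M T -> bounded_op T by exact: Mb.
have bda T : M T -> bounded_op (adj T) by move=> /bd; exact: bounded_adj.
have mmb T : M T -> bounded_op (T \o adj T) by move=> MT; apply: bounded_comp; [exact: bd|exact: bda].
have nnb T : M T -> bounded_op (adj T \o T) by move=> MT; apply: bounded_comp; [exact: bda|exact: bd].
have mE k : \sum_(i < k) (amp (m i) \o adj (amp (m i))) = amp (\sum_(i < k) (m i \o adj (m i))).
  rewrite amp_sum => [|i]; last exact: mmb.
  by apply: eq_bigr => i _; rewrite (amp_adj (bd _ (mM i))) -(amp_comp (bd _ (mM i)) (bda _ (mM i))).
have nE k : \sum_(i < k) (adj (amp (n i)) \o amp (n i)) = amp (\sum_(i < k) (adj (n i) \o n i)).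
  rewrite amp_sum => [|i]; last exact: nnb.
  by apply: eq_bigr => i _; rewrite (amp_adj (bd _ (nM i))) -(amp_comp (bda _ (nM i)) (bd _ (nM i))).
have mb k : bounded_op (\sum_(i < k) (m i \o adj (m i))) by apply: bounded_sum => i _; exact: mmb.
have nb k : bounded_op (\sum_(i < k) (adj (n i) \o n i)) by apply: bounded_sum => i _; exact: nnb.
split.
- split.
  + by move=> _ [T MT <-]; apply: amp_bounded; exact: bd.
  + by exists 0 => //; exact: amp0.
  + move=> c _ _ [S MS <-] [T MT <-]; exists (c *: S + T); first exact: Ml.
    by apply: amp_comb; exact: bd.
  + move=> _ [_ [_ [S MS <-] [_ [_ [T MT <-] <-] <-]] [_ [U MU <-] <-]].
    exists (S \o adj T \o U).
      by apply: Mm; exists (S \o adj T); [exists S => //; exists (adj T) => //; exists T|exists U].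
    have bST : bounded_op (S \o adj T) by apply: bounded_comp; [exact: bd|exact: bda].
    by rewrite (amp_comp bST (bd _ MU)) (amp_comp (bd _ MS) (bda _ MT)) (amp_adj (bd _ MT)).
- exact: amp_closed.
- exists (fun i => amp (m i)); split=> [i|_ [T MT <-]|k x]; first by exists (m i).
    have -> : (fun k => (\sum_(i < k) (amp (m i) \o adj (amp (m i)))) \o amp T) =
        (fun k => amp ((\sum_(i < k) (m i \o adj (m i))) \o T)).
      by apply/funext => k; rewrite mE (amp_comp (mb k) (bd _ MT)).
    apply: amp_opcvg => [k||]; [|exact: bd|exact: mc].
    by apply: bounded_comp => //; exact: bd.
  rewrite mE -[leRHS]mul1r; apply: amp_opbd => // y; rewrite mul1r; exact: m1.
- exists (fun i => amp (n i)); split=> [i|_ [T MT <-]|k x]; first by exists (n i).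
    have -> : (fun k => amp T \o (\sum_(i < k) (adj (amp (n i)) \o amp (n i)))) =
        (fun k => amp (T \o (\sum_(i < k) (adj (n i) \o n i)))).
      by apply/funext => k; rewrite nE (amp_comp (bd _ MT) (nb k)).
    apply: amp_opcvg => [k||]; [|exact: bd|exact: nc].
    by apply: bounded_comp => //; exact: bd.
  rewrite nE -[leRHS]mul1r; apply: amp_opbd => // y; rewrite mul1r; exact: n1.
Qed.

(** Boundedness is part of the predicate because [amp_comb] asks for it. *)
Lemma clsub_amp H K (N : set (l2 H -> l2 K)) : clsub N ->
  clsub [set S : H -> K | bounded_op S /\ N (amp S)].
Proof.
move=> [N0 Nl Nc]; split=> /=.
- by split; [exact: bounded0|rewrite amp0].
- move=> c S T [Sb NS] [Tb NT]; split; first exact: bounded_linear_comb.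
  by rewrite amp_comb//; exact: Nl.
- move=> T hT.
  have Tb : bounded_op T.
    by have [_ _ h] := clsub_bounded H K; apply: h; apply: norm_closureS hT => S [].
  split=> //; apply: Nc => e e0; have [S [Sb NS] TS] := hT e e0.
  exists (amp S) => // x; have -> : amp T x - amp S x = amp (T - S) x by rewrite ampB.
  by apply: amp_opbd => //; [exact: boundedB|exact: ltW].
Qed.

End Single.
End Amp.

Section AmpFrame.
Context (A : opAlg R) (Y : rmod A) (f : frame Y) (J : choiceType) (j0 : J).
Local Notation H := (fH f).
Local Notation K := (fK f).
Local Notation M := (@fM _ _ _ f).
Local Notation amp := (@amp J _ _).

Definition ampa x := amp (fa f x).
Definition ampu y := amp (fu f y).

Lemma ampa_linear : linear ampa.
Proof. by move=> c x y; rewrite /ampa linearP amp_comb//; exact: fa_bounded. Qed.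

Lemma ampu_linear : linear ampu.
Proof. by move=> c x y; rewrite /ampu linearP amp_comb//; exact: fu_bounded. Qed.

HB.instance Definition _ := GRing.isLinear.Build R[i] A _ *:%R ampa ampa_linear.
HB.instance Definition _ := GRing.isLinear.Build R[i] Y _ *:%R ampu ampu_linear.

Lemma ampaM x y : ampa (amul x y) = ampa x \o ampa y.
Proof. by rewrite /ampa fa_mul amp_comp//; exact: fa_bounded. Qed.

Lemma ampu_mod y x : ampu (ract y x) = ampu y \o ampa x.
Proof. by rewrite /ampu fu_mod amp_comp//; [exact: fu_bounded|exact: fa_bounded]. Qed.

Lemma ampa_MMa T T' x : (amp @` M) T -> (amp @` M) T' -> range ampa (adj T \o T' \o ampa x).
Proof.
move=> [S MS <-] [S' MS' <-]; have [z _ zE] := f_MMa x MS MS'.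
have aS := adjM_bounded MS; have bS := fM_bounded MS; have bS' := fM_bounded MS'.
exists z => //; rewrite /ampa zE (amp_comp J (bounded_comp aS bS') (fa_bounded f x)).
by rewrite (amp_comp J aS bS') (amp_adj _ bS).
Qed.

Lemma ampa_aMM x T T' : (amp @` M) T -> (amp @` M) T' -> range ampa (ampa x \o adj T \o T').
Proof.
move=> [S MS <-] [S' MS' <-]; have [z _ zE] := f_aMM x MS MS'.
have aS := adjM_bounded MS; have bS := fM_bounded MS; have bS' := fM_bounded MS'.
exists z => //; rewrite /ampa zE (amp_comp J (bounded_comp (fa_bounded f x) aS) bS').
by rewrite (amp_comp J (fa_bounded f x) aS) (amp_adj _ bS).
Qed.

Lemma ampu_M T x : (amp @` M) T -> range ampu (T \o ampa x).
Proof.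
move=> [S MS <-]; have [z _ zE] := f_Ma x MS; exists z => //.
by rewrite /ampu zE (amp_comp J (fM_bounded MS) (fa_bounded f x)).
Qed.

Lemma ampu_span y : clspan (prods (amp @` M) (range ampa)) (ampu y).
Proof.
suff : clspan (prods M (range (fa f))) `<=`
    [set S | bounded_op S /\ clspan (prods (amp @` M) (range ampa)) (amp S)].
  by move=> h; have [] := h _ (f_u f y).
apply: clspan_min; first by apply: clsub_amp; exact: clspan_clsub.
move=> _ [S MS [_ [x _ <-] <-]]; split.
  by apply: bounded_comp; [exact: fM_bounded|exact: fa_bounded].
apply: sub_clspan; exists (amp S); first by exists S.
by exists (ampa x); [exists x|rewrite -amp_comp//; [exact: fM_bounded|exact: fa_bounded]].
Qed.

Lemma ampa_repr : is_repr (osnorm A) (ampa : {linear A -> _}).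
Proof. by apply: (amp_repr j0 (fa_repr f)). Qed.

Lemma ampu_repr : is_repr (osnorm Y) (ampu : {linear Y -> _}).
Proof. by apply: (amp_repr j0 (fu_repr f)). Qed.

(** Its [fH] is the Hilbert sum on which [rig_repr] is defined, so that [rig_repr_mod] can serve as
    [psi_mod]. *)
Definition amp_frame : frame Y :=
  @Frame _ _ _ _ _ (ampa : {linear A -> _}) (amp @` M) (ampu : {linear Y -> _})
    ampa_repr ampaM (amp_sigmaTRO j0 (fM_tro f))
    ampu_repr ampu_mod ampa_MMa ampa_aMM ampu_M ampu_span.

Lemma amp_full : (forall x, clspan (@aMM _ _ _ f) (fa f x)) ->
  forall x, clspan (@aMM _ _ _ amp_frame) (fa amp_frame x).
Proof.
move=> af x.
suff : clspan (@aMM _ _ _ f) `<=` [set S | bounded_op S /\ clspan (@aMM _ _ _ amp_frame) (amp S)].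
  by move=> h; have [] := h _ (af x).
apply: clspan_min; first by apply: clsub_amp; exact: clspan_clsub.
move=> _ [{}x [T [T' [MT MT' ->]]]].
have aT := adjM_bounded MT; have bT := fM_bounded MT; have bT' := fM_bounded MT'.
have axT := bounded_comp (fa_bounded f x) aT.
split; first exact: bounded_comp.
apply: sub_clspan; exists x, (amp T), (amp T'); split; [by exists T|by exists T'|].
by rewrite (amp_comp J axT bT') (amp_comp J (fa_bounded f x) aT) (amp_adj _ bT).
Qed.

End AmpFrame.
End Amplification.

(** The list [S] completes each fibre that [s] meets; the added terms are nonnegative. *)
Lemma sum_fibers_le (R : realType) (J : choiceType) (n : J -> nat)
    (f : {b : J & 'I_(n b)} -> R) (s : seq {b : J & 'I_(n b)}) :
  uniq s -> (forall t, 0 <= f t) ->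
  exists2 s' : seq J, uniq s' & \sum_(t <- s) f t <= \sum_(b <- s') \sum_(k < n b) f (existT _ b k).
Proof.
move=> us f0; exists (undup (map tag s)); first exact: undup_uniq.
pose S := [seq existT (fun b => 'I_(n b)) b k | b <- undup (map tag s), k <- enum 'I_(n b)].
have -> : \sum_(b <- undup (map tag s)) \sum_(k < n b) f (existT _ b k) = \sum_(t <- S) f t.
  by rewrite big_allpairs_dep; apply: eq_bigr => b _; rewrite big_enum.
have uS : uniq S.
  apply: allpairs_uniq_dep => [|b _|[b k] [b' k'] _ _ /= h]; rewrite ?undup_uniq ?enum_uniq//.
have sS : {subset s <= S}.
  move=> [b k] ts; apply/allpairsPdep; exists b, k; split=> //; last by rewrite mem_enum.
  by rewrite mem_undup; apply/mapP; exists (existT _ b k).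
have ps : perm_eq s [seq t <- S | t \in s].
  apply: uniq_perm; rewrite ?filter_uniq// => t; rewrite mem_filter.
  by case: (boolP (t \in s)) => // /sS ->.
by rewrite (perm_big _ ps) big_filter [leRHS](bigID (mem s)) /= lerDl sumr_ge0.
Qed.

(** * Representing a rigged module over a given representation of the algebra *)

Section RiggedRepr.
Context {R : realType} (A : opAlg R) (F : rmod A) (r : rigging F).
Context (H : hilbert R) (a : {linear A -> (H -> H)}).
Hypothesis a_repr : is_repr (osnorm A) a.
Hypothesis a_mul : forall x y, a (amul x y) = a x \o a y.
Local Notation J := {classic dcar (rdir r)}.
(** One coordinate for each entry of each column [rPhi b]; [{classic _}] gives the directed set the
    choice structure that [l2] requires. *)
Definition rig_index := {b : J & 'I_(rn (r := r) b)}.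
Local Notation l2J := (@l2hilbert R J H).
Local Notation l2I := (@l2hilbert R rig_index H).

(* Each [rPhi b] is contractive but their column is not, so every index [b] gets
   its own copy of [H]. *)
Definition rig_op (g : F) (x : J -> H) (t : rig_index) : H :=
  a (rPhi (tag t) g (tagged t)) (x (tag t)).

Lemma a_bounded x : bounded_op (a x).
Proof. exact: repr_bounded a_repr x. Qed.

(** Finite sets of indices are enlarged to whole fibres, on which [rPhi b] is contractive; distinct
    fibres see distinct coordinates of [x], so the bounds add up. *)
Lemma rig_op_sum m n (g : 'M[F]_(m, n)) (x : 'I_n -> l2J) (s : seq rig_index) : uniq s ->
  \sum_(t <- s) \sum_i rnorm (\sum_j rig_op (g i j) (x j) t) ^+ 2 <=
  mnorm F g ^+ 2 * \sum_j rnorm (x j) ^+ 2.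
Proof.
move=> us.
have [|s' us' le] := sum_fibers_le (f := fun t => \sum_i rnorm (\sum_j rig_op (g i j) (x j) t) ^+ 2) us.
  by move=> t; apply: sumr_ge0 => i _; exact: sqr_ge0.
apply: le_trans le _.
apply: (@le_trans _ _ (\sum_(b <- s') mnorm F g ^+ 2 * \sum_j rnorm (x j b) ^+ 2)).
  apply: ler_sum => b _; rewrite exchange_big /=.
  have hb : @col_mxnorm R A (rn (r := r) b) m n (map_mx (rPhi b) g) <= mnorm F g.
    by have := @rPhi_contr _ _ _ r b _ _ g; rewrite mul1r.
  have /(col_mxnorm_le a_repr _ (mnorm_ge0 g)) h := hb.
  have := h (fun j => x j b); apply: le_trans.
  rewrite -(pair_bigA _ (fun i k => rnorm (\sum_j a ((map_mx (rPhi b) g) i j k) (x j b)) ^+ 2)) /=.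
  apply: ler_sum => i _; apply: ler_sum => k _.
  by under [X in _ <= rnorm X ^+ 2]eq_bigr do rewrite mxE.
rewrite -mulr_sumr ler_wpM2l ?sqr_ge0// exchange_big /=; apply: ler_sum => j _.
by rewrite rnorm_l2sq sum_sqs_le.
Qed.

Lemma rig_op_l2 g (x : l2J) : rig_op g x \in (@l2pred R rig_index H).
Proof.
apply/asboolP; apply: (@summ_bound _ _ _ (rnorm g ^+ 2 * rnorm x ^+ 2)) => s us.
have := rig_op_sum (const_mx g : 'M[F]_(1, 1)) (fun=> x) us.
rewrite mnorm11 mxE big_ord1; apply: le_trans; apply: ler_sum => t _.
by rewrite ger0_norm ?sqs_ge0// !big_ord1 mxE.
Qed.

Definition rig_fun (g : F) (x : l2J) : l2I := L2 (rig_op_l2 g x).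

Lemma rig_fun_linear : linear rig_fun.
Proof.
move=> c g g'; apply/funext => x; apply: l2_eq => t; rewrite lin_combE l2_combE /=.
by rewrite /rig_op linearP lin_combE linearP.
Qed.

HB.instance Definition _ := GRing.isLinear.Build R[i] F (l2J -> l2I) *:%R rig_fun rig_fun_linear.

Definition rig_repr : {linear F -> (l2J -> l2I)} := rig_fun.

Lemma rig_reprE g x t : rig_repr g x t = rig_op g x t.
Proof. by []. Qed.

Lemma rig_repr_mxbd m n (g : 'M[F]_(m, n)) : mxbd (fun i j => rig_repr (g i j)) (mnorm F g).
Proof.
move=> x; under eq_bigr do rewrite rnorm_l2sq.
apply: sum_l2sq_le => s us; apply: le_trans (rig_op_sum g x us).
apply: ler_sum => t _; apply: ler_sum => i _.
by rewrite l2_sumE.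
Qed.

Lemma rig_repr_bounded g : bounded_op (rig_repr g).
Proof.
apply/bounded_opP; split.
  move=> c x y; apply: l2_eq => t; rewrite l2_combE !rig_reprE /rig_op.
  by rewrite l2_combE (bounded_lin (a_bounded _)).
exists (rnorm g) => //; apply/opbd_mxbd => //.
have := rig_repr_mxbd (const_mx g : 'M[F]_(1, 1)); rewrite mnorm11 mxE.
by apply: mxbd_eq => i j x; rewrite mxE.
Qed.

(** Vectors supported at the single index [b] recover the norm of [rPhi b g], which dominates that
    of [rPsi b (rPhi b g)]; the latter tends to [g]. *)
Lemma rig_repr_lower m n (g : 'M[F]_(m, n)) c : 0 <= c ->
  mxbd (fun i j => rig_repr (g i j)) c -> mnorm F g <= c.
Proof.
move=> c0 hc.
apply: (@mnorm_lim_le _ _ _ _ _ (tails (rdir r)) _ (fun b => map_mx (fun y => rPsi b (rPhi (r := r) b y)) g)).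
  move=> i j; have h : ncvg (tails (rdir r)) (fun b => rPsi b (rPhi (r := r) b (g i j))) (g i j).
    by apply/ncvgP; exact: r_cvg.
  by move=> d d0; apply: filterS (h d d0) => b; rewrite mxE.
apply: filterE => b.
have := @rPsi_contr _ _ _ r b _ _ (map_mx (rPhi b) g); rewrite mul1r.
rewrite -map_mx_comp; move=> h; apply: le_trans h _.
apply/(col_mxnorm_le a_repr) => // xi.
have := hc (fun j => single (b : J) (xi j)).
under [X in _ <= _ * X -> _]eq_bigr do rewrite rnorm_single.
apply: le_trans.
rewrite -(pair_bigA _ (fun i k => rnorm (\sum_j a ((map_mx (rPhi b) g) i j k) (xi j)) ^+ 2)) /=.
apply: ler_sum => i _; rewrite rnorm_l2sq.
pose s := [seq (existT (fun b : J => 'I_(rn (r := r) b)) b k : rig_index) | k <- enum 'I_(rn (r := r) b)].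
have us : uniq s.
  rewrite map_inj_uniq ?enum_uniq// => k k' h.
  exact: val_inj (congr1 (fun t : rig_index => nat_of_ord (tagged t)) h).
apply: le_trans (sum_sqs_le _ us); rewrite big_map big_enum /=.
apply: ler_sum => k _; rewrite l2_sumE le_eqVlt; apply/orP; left; apply/eqP.
congr (rnorm _ ^+ 2); apply: eq_bigr => j _.
by rewrite rig_reprE /rig_op /= eqxx mxE.
Qed.

Lemma rig_repr_isom : is_repr (osnorm F) rig_repr.
Proof.
split; first by move=> _ [x _ <-]; exact: rig_repr_bounded.
move=> m n x; apply/eqP; rewrite eq_le; apply/andP; split.
  apply/op_mxnormP => //; first by move=> i j; rewrite mxE; exact: rig_repr_bounded.
  by apply: mxbd_eq (rig_repr_mxbd x) => i j h; rewrite mxE.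
have bd i j : bounded_op (map_mx rig_repr x i j) by rewrite mxE; exact: rig_repr_bounded.
apply: rig_repr_lower; first exact: op_mxnorm_ge0.
have /(op_mxnormP bd (op_mxnorm_ge0 bd)) := lexx (op_mxnorm (map_mx rig_repr x)).
by apply: mxbd_eq => i j h; rewrite mxE.
Qed.

Lemma rig_repr_mod g x : rig_repr (ract g x) = rig_repr g \o amp (J := J) (a x).
Proof.
apply/funext => y; apply: l2_eq => t.
suff : rig_op (ract g x) y t = rig_op g (amp (J := J) (a x) y) t by [].
by rewrite /rig_op rPhi_mod a_mul (ampE _ _ (a_bounded x)).
Qed.

End RiggedRepr.

(** * The approximate identity acting on a rigged module *)

Section RiggedUnit.
Context {R : realType} (B : opAlg R) (E : rmod B) (r : rigging E).
Context (D : directed) (e : D -> B).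
Hypothesis e_bai : is_bai e 1.

(** On the image of [rPsi b] the action is entrywise multiplication of a column, and for each [b]
    only finitely many entries have to converge. *)
Lemma rigged_bai (x : E) : ncvg (tails D) (fun i => ract x (e i)) x.
Proof.
have [H [a [ha _]]] := oa_repr B; have [e1 _ er] := e_bai.
have contr i (y : E) : rnorm (ract y (e i)) <= rnorm y.
  have := ract_contr (const_mx y : 'M[E]_(1, 1)) (const_mx (e i) : 'M[B]_(1, 1)).
  rewrite !mnorm11 !mxE big_ord1 !mxE => /le_trans; apply.
  by rewrite ler_piMr// e1.
have Nn : nclosed [set y : E | ncvg (tails D) (fun i => ract y (e i)) y].
  by apply: nclosed_cvg => // i; exact: ract_linear1.
have hx : ncvg (tails (rdir r)) (fun b => rPsi b (rPhi (r := r) b x)) x.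
  by apply/ncvgP; exact: r_cvg.
apply: (nclosed_lim Nn _ hx) => b /=; move: (rPhi b x) => z d d0.
pose C := Num.sqrt #|{: 'I_1 * 'I_(rn (r := r) b)}|%:R * #|'I_1|%:R + 1 : R.
have C0 : 0 < C by rewrite ltr_wpDl// mulr_ge0// sqrtr_ge0.
have dC : 0 < d / C by rewrite divr_gt0.
have : \forall i \near tails D, forall k, rnorm (amul (z k) (e i) - z k) <= d / C.
  apply: filter_forall => k; have h : ncvg (tails D) (fun i => amul (z k) (e i)) (z k).
    by apply/ncvgP; exact: er.
  exact: h.
apply: filterS => i hi; rewrite -rPsi_mod -linearB.
have := @rPsi_contr _ _ _ r b 1%N 1%N (const_mx ((fun k => amul (z k) (e i)) - z)).
rewrite mul1r mnorm11 !mxE => /le_trans; apply.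
apply/(col_mxnorm_le ha); first exact: ltW.
apply: (@mxbd_le _ _ _ _ _ _ (Num.sqrt #|{: 'I_1 * 'I_(rn (r := r) b)}|%:R * #|'I_1|%:R * (d / C))).
- by apply: mulr_ge0; [apply: mulr_ge0; rewrite ?sqrtr_ge0|exact: ltW].
- move: dC; rewrite /C; set v := Num.sqrt _ * _ => dC.
  by rewrite mulrCA ler_piMr ?(ltW d0)// ler_pdivrMr ?mul1r ?lerDl//.
apply: mxbd_entries => [|k j]; first exact: ltW.
by apply/(repr_opbd ha); [exact: ltW|rewrite mxE; exact: hi].
Qed.

End RiggedUnit.

(** * Fullness of the frame *)

Section Fullness.
Context {R : realType} (A B : opAlg R) (Y : rmod A) (f : frame Y).
Context (D : directed) (e : D -> A).
Hypothesis e_bai : is_bai e 1.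
Local Notation H := (fH f).
Local Notation a := (fa f).
Local Notation u := (fu f).
Local Notation M := (@fM _ _ _ f).
Local Notation N := (clspan (@aMM _ _ _ f)).
Hypothesis MMa_sub : clspan (prods (prods (adjs M) M) (range a)) `<=`
  clspan (prods (range a) (prods (adjs M) M)).
Context (X : opSpace R) (rB : X -> B -> X) (lB : B -> Y -> Y) (t : {bilinear X -> Y -> A}).
Hypothesis t_haag : is_haagerup rB lB t.
Hypothesis t_mod : forall x y b, t x (ract y b) = amul (t x y) b.

(** [A] is generated by the [t g y]. For fixed [g], the set [W] of those [u y] with [a (t g y)] in
    the span must contain each [T \o a x']. The right sequence of the TRO writes [T] as a limit of
    sums of [T \o adj (n j) \o n j], and [MMa_sub] moves [adj (n j) \o n j] to the right of
    [a x']. *)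
Lemma a_full_of_haagerup x : N (a x).
Proof.
have Nc : clsub N := clspan_clsub _.
have eM z T T' : M T -> M T' -> N (a z \o adj T \o T').
  by move=> MT MT'; apply: sub_clspan; exists z, T, T'.
have er z : opcvg (tails D) (fun i => a (amul z (e i))) (a z).
  by apply/(opcvg_repr _ _ (fa_repr f))/ncvgP; case: e_bai.
apply: (haag_ind t_haag (N := [set x | N (a x)])); first exact: a_nclosed Nc.
move=> g y /=.
pose W := u @` [set y | N (a (t g y))].
have Wc : clsub W.
  apply: clsub_preim (fu_repr f) _.
  apply: (@nclosed_preim _ _ _ (t g) (rnorm g) [set x | N (a x)]) => [c z z'|z|].
  - by rewrite linearPr.
  - exact: haag_rnorm t_haag _ _.
  - exact: a_nclosed Nc.
(* [x'] is replaced by [amul x' (e i)] because [a (e i) \o adj T1 \o T2] lies in [a(A)], hence can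
   be taken out of [t] on the right. *)
have Wa T x' T1 T2 : M T -> M T1 -> M T2 -> W (T \o (a x' \o adj T1 \o T2)).
  move=> MT MT1 MT2; have [y' _ y'E] := f_Ma x' MT.
  have TT := bounded_comp (adjM_bounded MT1) (fM_bounded MT2).
  have cv : opcvg (tails D) (fun i => T \o (a (amul x' (e i)) \o (adj T1 \o T2)))
      (T \o (a x' \o (adj T1 \o T2))).
    by apply: opcvg_compl (fM_bounded MT) _; apply: opcvg_compr TT _; exact: er.
  apply: (clsub_lim Wc _ cv); apply: filterE => i.
  have [z _ zE] := f_aMM (e i) MT1 MT2.
  exists (ract y' z); last by rewrite fu_mod y'E zE fa_mul.
  rewrite /=; have -> : a (t g (ract y' z)) = a (amul (t g y') (e i)) \o adj T1 \o T2.
    by rewrite t_mod fa_mul zE fa_mul.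
  exact: eM.
have WN T S : M T -> N S -> W (T \o S).
  move=> MT; suff : N `<=` [set S : H -> H | W (T \o S)] by apply.
  apply: clspan_min; first exact: clsub_compl (fM_bounded MT) Wc.
  by move=> _ [x' [T1 [T2 [MT1 MT2 ->]]]]; exact: Wa.
suff [y' Ny' /(repr_inj (fu_repr f)) <-] : W (u y) by [].
suff h : clspan (prods M (range a)) `<=` W by exact: h (f_u f y).
apply: clspan_min => // _ [T MT [_ [x' _ <-] <-]].
have [n [nM ncv _]] := stro_right (fM_tro f).
apply: (clsub_lim Wc _ (opcvg_compr (fa_bounded f x') (ncv T MT))); apply: filterE => k.
have -> : T \o (\sum_(j < k) (adj (n j) \o n j)) \o a x' =
    \sum_(j < k) (T \o ((adj (n j) \o n j) \o a x')).
  by apply/funext => h; rewrite sum_fctE /= sum_fctE (linf_sum (bounded_lin (fM_bounded MT))).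
apply: (clsub_sum Wc) => j; apply: WN => //.
have sub : clspan (prods (range a) (prods (adjs M) M)) `<=` N.
  apply: clspan_min => // _ [_ [z _ <-] [_ [_ [T1 MT1 <-] [T2 MT2 <-]] <-]].
  exact: eM.
apply/sub/MMa_sub/sub_clspan; exists (adj (n j) \o n j); last by exists (a x'); [exists x'|].
by exists (adj (n j)); [exists (n j)|exists (n j)].
Qed.

End Fullness.

Lemma frame_exists (R : realType) (A : opAlg R) (Y : rmod A) : doubly_sigmaDelta Y ->
  exists f : frame Y,
    clspan (prods (prods (adjs (@fM _ _ _ f)) (@fM _ _ _ f)) (range (fa f))) `<=`
    clspan (prods (range (fa f)) (prods (adjs (@fM _ _ _ f)) (@fM _ _ _ f))).
Proof.
move=> [H [K [a [M [u [[ha am] Mtro MMa aMM_eq [hu ru um]]]]]]].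
have MMa' m m' x : M m -> M m' -> range a (adj m \o m' \o a x).
  move=> Mm Mm'; apply: MMa; exists (adj m \o m'); last by exists (a x); [exists x|].
  by exists (adj m); [exists m|exists m'].
(* The equality of closed spans reduces this inclusion to the given one, as [range a] is closed. *)
have aMM' x m m' : M m -> M m' -> range a (a x \o adj m \o m').
  move=> Mm Mm'; suff h : clspan (prods (range a) (prods (adjs M) M)) `<=` range a.
    apply/h/sub_clspan; exists (a x); first by exists x.
    by exists (adj m \o m'); [exists (adj m); [exists m|exists m']|].
  by rewrite -aMM_eq; apply: clspan_min => //; exact: repr_clsub ha.
have Ma m x : M m -> range u (m \o a x).
  by move=> Mm; rewrite ru; apply: sub_clspan; exists m => //; exists (a x); [exists x|].
have uS y : clspan (prods M (range a)) (u y) by rewrite -ru; exists y.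
exists (Frame ha am Mtro hu um MMa' aMM' Ma uS) => /=.
by rewrite aMM_eq.
Qed.

Theorem theorem4p7 (R : realType) (A B : opAlg R)
    (hA : approx_unital A) (hB : approx_unital B)
    (E : rmod B) (F : rmod A) (hE : rigged E) (hF : rigged F)
    (hEF : sigmaMorita E F) : sigmaDelta E F.
Proof.
have [Y [r [Yt [l [lt [rt [tA [tB [tF [hY [l_act ltE rtE] [tA_haag _ tA_r]
  [tB_haag tB_l tB_r] [tF_haag tF_r]]]]]]]]]]] := hEF.
have [f fMM] := frame_exists hY.
have [DA [eA eA_bai]] := hA; have [DB [eB eB_bai]] := hB.
have [rE] := hE; have [rF] := hF.
have full x := a_full_of_haagerup eA_bai fMM tA_haag tA_r x.
(* Any index will do: it witnesses that the index set of the Hilbert sum is not empty, so that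
   amplification is isometric. *)
have [b0] := dinh (rdir rF).
pose f' := amp_frame f (b0 : {classic dcar (rdir rF)}).
have [p] := approximants_exist f' hA.
apply: (morita_sigmaDelta l_act ltE rtE tB_haag tB_l tB_r p eB_bai (amp_full _ full) tF_haag tF_r
   (rigged_bai rE eB_bai) (rig_repr_isom rF (fa_repr f)) (rig_repr_mod rF (fa_repr f) (@fa_mul _ _ _ f))).
Qed.
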